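(* In the homogeneous setting described in the context, for all $X,Y\in\mathfrak m$ the Chern-Ricci form $\rho$ of $J$ at $x$ satisfies $$\rho(X,Y)_x=\mathrm{tr}\left(\mathrm{ad}_{H[X,Y]_{\mathfrak g}}-H\,\mathrm{ad}_{[X,Y]_{\mathfrak g}}\right),$$ where the trace is that of endomorphisms of $\mathfrak g$ and $H$ is extended to $\mathfrak g$ by $H\mathfrak k=\{0\}$.
   Context: Setting: $(M,\omega)$ is a connected symplectic manifold of dimension $2n$ with a compatible almost complex structure $J$ (i.e. $J^2=-\mathrm{id}$, $\omega(J\cdot,J\cdot)=\omega$, $\omega(v,Jv)>0$ for $v\ne0$), and $g(u,v)=\omega(u,Jv)$. A connected Lie group $G$ acts transitively on $M$ preserving $\omega$ and $J$, almost effectively (no non-discrete normal subgroup of $G$ acts trivially). Fix $x\in M$ with isotropy subgroup $K\subset G$, taken to be compact. Let $\mathfrak g,\mathfrak k$ be the Lie algebras of $G,K$, with bracket $[\cdot,\cdot]_{\mathfrak g}$ and $\mathrm{ad}_X(Y)=[X,Y]_{\mathfrak g}$. Each $X\in\mathfrak g$ is identified with the vector field on $M$ generating the flow $z\mapsto e^{tX}z$ (a symplectic and holomorphic vector field; vector field brackets satisfy $[X,Y]=-[X,Y]_{\mathfrak g}$). Fix an $\mathrm{Ad}_K$-invariant complement $\mathfrak m$, $\mathfrak g=\mathfrak k\oplus\mathfrak m$. Evaluation at $x$ gives an isomorphism $\mathfrak m\cong T_xM$, through which $\omega_x$ and $J_x$ define a symplectic form $\sigma$ and a complex structure $H$ on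 $\mathfrak m$. Chern-Ricci form: with $4N(X,Y)=[JX,JY]-J[JX,Y]-J[X,JY]-[X,Y]$, the Chern connection $\nabla$ is the unique connection preserving $g$ with torsion $N$; $R(X,Y)=\nabla_X\nabla_Y-\nabla_Y\nabla_X-\nabla_{[X,Y]}$ and $\rho(X,Y)=\mathrm{tr}(JR(X,Y))$ (real trace). *)

(* Defs.v *)
From HB Require Import structures.
From mathcomp Require Export all_boot all_order all_algebra.
From mathcomp Require Export all_classical all_reals all_analysis.
Import Order.TTheory GRing.Theory Num.Theory.
Import numFieldNormedType.Exports.

Set Implicit Arguments.
Unset Strict Implicit.
Unset Printing Implicit Defensive.

Local Open Scope classical_set_scope.
Local Open Scope ring_scope.

(* Manifolds are Hausdorff, second countable, and given by an atlas indexed by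
   points: [chart_at p] is a chart around [p], and any two of these charts are
   smoothly compatible.  The tangent space at [p] is identified with 'rV_m
   through [chart_at p]; so vector fields, forms and tensors at [p] are
   expressed in components relative to [chart_at p]. *)

(* f is C^infinity on a neighbourhood of y: near y, all iterated directional
   derivatives of f exist and are (Frechet) differentiable. *)
Definition smooth_near (R : realType) (V W : normedModType R)
    (f : V -> W) (y : V) : Prop :=
  \forall y' \near y, forall s : seq V,
    differentiable (foldr (fun v h => (fun a => 'D_v h a)) f s) y'.

Record chart (R : realType) (T : topologicalType) (m : nat) := Chart {
  cdom : set T;
  cmap : T -> 'rV[R]_m;
  (* only meaningful on [cmap @` cdom] *)
  cinv : 'rV[R]_m -> T;
  cdom_open : open cdom;
  cimage_open : open (cmap @` cdom);
  cmapK : forall z, cdom z -> cinv (cmap z) = z;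
  cmap_continuous : forall z, cdom z -> {for z, continuous cmap};
  cinv_continuous : forall z, cdom z -> {for cmap z, continuous cinv}
}.

Record manifold (R : realType) (m : nat) := Manifold {
  msort :> topologicalType;
  chart_at : msort -> chart R msort m;
  mem_chart_at : forall p, cdom (chart_at p) p;
  chart_compat : forall p q z, cdom (chart_at p) z -> cdom (chart_at q) z ->
    smooth_near (cmap (chart_at q) \o cinv (chart_at p)) (cmap (chart_at p) z);
  manifold_hausdorff : hausdorff_space msort;
  manifold_second_countable : @second_countable msort
}.

Section Calculus.
Variable R : realType.

Section OneManifold.
Variables (m : nat) (M : manifold R m).

Definition coord (p : M) : M -> 'rV[R]_m := cmap (chart_at p).
Definition point (p : M) : 'rV[R]_m -> M := cinv (chart_at p).

(* A tangent vector at z, from components in chart_at p to components in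
   chart_at q. *)
Definition coord_change (p q z : M) (v : 'rV[R]_m) : 'rV[R]_m :=
  'd (coord q \o point p) (coord p z) v.

Definition smooth_fun (f : M -> R) : Prop :=
  forall p, smooth_near (f \o point p) (coord p p).

(* df_p(v) *)
Definition dfun (f : M -> R) (p : M) (v : 'rV[R]_m) : R :=
  'd (f \o point p) (coord p p) v.

Definition smooth_curve (c : R -> M) : Prop :=
  continuous c /\ forall t, smooth_near (coord (c t) \o c) t.

Definition velocity (c : R -> M) (t : R) : 'rV[R]_m :=
  derive1 (coord (c t) \o c) t.

(* X z is the value at z, in components relative to chart_at z. *)
Definition vfield := M -> 'rV[R]_m.

(* The components of X in the single chart chart_at p, as a map on 'rV_m. *)
Definition vloc (p : M) (X : vfield) (y : 'rV[R]_m) : 'rV[R]_m :=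
  coord_change (point p y) p (point p y) (X (point p y)).

Definition smooth_vfield (X : vfield) : Prop :=
  forall p, smooth_near (vloc p X) (coord p p).

(* The coordinate vector field of chart_at p with constant components v. *)
Definition coord_field (p : M) (v : 'rV[R]_m) : vfield :=
  fun z => coord_change p z z v.

(* [X, Y] = X^i d_i Y - Y^i d_i X, so that [X, Y] f = X (Y f) - Y (X f). *)
Definition bracket (X Y : vfield) : vfield := fun p =>
  'd (vloc p Y) (coord p p) (X p) - 'd (vloc p X) (coord p p) (Y p).

Definition form2 := M -> 'rV[R]_m -> 'rV[R]_m -> R.
Definition tensor11 := M -> 'rV[R]_m -> 'rV[R]_m.

Definition app11 (J : tensor11) (X : vfield) : vfield := fun z => J z (X z).
Definition app2 (w : form2) (X Y : vfield) : M -> R :=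
  fun z => w z (X z) (Y z).

Definition smooth_tensor11 (J : tensor11) : Prop :=
  forall p v,
    smooth_near (vloc p (app11 J (coord_field p v))) (coord p p).

Definition smooth_form2 (w : form2) : Prop :=
  forall p u v,
    smooth_near (app2 w (coord_field p u) (coord_field p v) \o point p)
      (coord p p).

(* The exterior derivative of a 2-form, evaluated on vector fields. *)
Definition ext_deriv (w : form2) (X Y Z : vfield) (p : M) : R :=
  dfun (app2 w Y Z) p (X p) + dfun (app2 w Z X) p (Y p)
  + dfun (app2 w X Y) p (Z p)
  - app2 w (bracket X Y) Z p - app2 w (bracket Y Z) X p
  - app2 w (bracket Z X) Y p.

Definition symplectic (w : form2) : Prop :=
  [/\ forall z u, scalar (w z u),
      forall z u v, w z u v = - w z v u,
      smooth_form2 w,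
      forall z u, (forall v, w z u v = 0) -> u = 0 &
      forall X Y Z p, smooth_vfield X -> smooth_vfield Y -> smooth_vfield Z ->
        ext_deriv w X Y Z p = 0].

Definition almost_complex (J : tensor11) : Prop :=
  [/\ forall z, linear (J z),
      smooth_tensor11 J &
      forall z v, J z (J z v) = - v].

Definition compatible (w : form2) (J : tensor11) : Prop :=
  (forall z u v, w z (J z u) (J z v) = w z u v) /\
  (forall z v, v != 0 -> 0 < w z v (J z v)).

Definition metric (w : form2) (J : tensor11) : form2 :=
  fun z u v => w z u (J z v).

Definition nijenhuis (J : tensor11) (X Y : vfield) : vfield := fun z =>
  4^-1 *: (bracket (app11 J X) (app11 J Y) z
           - J z (bracket (app11 J X) Y z)
           - J z (bracket X (app11 J Y) z)
           - bracket X Y z).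

(* A connection: D Y z v is the derivative of Y at z in the direction v.  Only
   its values on smooth Y matter. *)
Definition covderiv := vfield -> forall z : M, 'rV[R]_m -> 'rV[R]_m.

Definition cov (D : covderiv) (X Y : vfield) : vfield := fun z => D Y z (X z).

Definition is_connection (D : covderiv) : Prop :=
  [/\ forall Y z, smooth_vfield Y -> linear (D Y z),
      forall X Y, smooth_vfield X -> smooth_vfield Y ->
        smooth_vfield (cov D X Y),
      forall Y Z z v, smooth_vfield Y -> smooth_vfield Z ->
        D (fun z' => Y z' + Z z') z v = D Y z v + D Z z v &
      forall f Y z v, smooth_fun f -> smooth_vfield Y ->
        D (fun z' => f z' *: Y z') z v = f z *: D Y z v + dfun f z v *: Y z].

Definition preserves_metric (g : form2) (D : covderiv) : Prop :=
  forall Y Z z v, smooth_vfield Y -> smooth_vfield Z ->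
    dfun (app2 g Y Z) z v = g z (D Y z v) (Z z) + g z (Y z) (D Z z v).

Definition torsion (D : covderiv) (X Y : vfield) : vfield := fun z =>
  cov D X Y z - cov D Y X z - bracket X Y z.

Definition chern_connection (w : form2) (J : tensor11) (D : covderiv) : Prop :=
  [/\ is_connection D,
      preserves_metric (metric w J) D &
      forall X Y z, smooth_vfield X -> smooth_vfield Y ->
        torsion D X Y z = nijenhuis J X Y z].

Definition curvature (D : covderiv) (X Y Z : vfield) : vfield := fun z =>
  cov D X (cov D Y Z) z - cov D Y (cov D X Z) z - cov D (bracket X Y) Z z.

(* Some smooth vector field with value v at z. *)
Definition extend (z : M) (v : 'rV[R]_m) : vfield :=
  xget (fun=> 0) [set Z : vfield | smooth_vfield Z /\ Z z = v].

(* R(X, Y)_z as an endomorphism of the tangent space at z (by tensoriality the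
   choice of the extension is irrelevant). *)
Definition curvature_at (D : covderiv) (X Y : vfield) (z : M)
    (v : 'rV[R]_m) : 'rV[R]_m := curvature D X Y (extend z v) z.

End OneManifold.

Definition endo_tr (m : nat) (f : 'rV[R]_m -> 'rV[R]_m) : R := \tr (lin1_mx f).

Definition chern_ricci (m : nat) (M : manifold R m) (J : tensor11 M)
    (D : covderiv M) (X Y : vfield M) (z : M) : R :=
  endo_tr (fun v => J z (curvature_at D X Y z v)).

Section Maps.
Variables (m1 m2 m3 : nat).
Variables (M1 : manifold R m1) (M2 : manifold R m2) (M3 : manifold R m3).

Definition smooth_map (f : M1 -> M2) : Prop :=
  continuous f /\
  forall p, smooth_near (coord (f p) \o f \o point p) (coord p p).

(* Smoothness of f as a map on the product manifold M1 x M2. *)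
Definition smooth_map2 (f : M1 -> M2 -> M3) : Prop :=
  continuous (fun p : M1 * M2 => f p.1 p.2) /\
  forall p q, smooth_near
    (fun y : 'rV[R]_(m1 + m2) =>
       coord (f p q) (f (point p (lsubmx y)) (point q (rsubmx y))))
    (row_mx (coord p p) (coord q q)).

(* The differential of f at p. *)
Definition tmap (f : M1 -> M2) (p : M1) (v : 'rV[R]_m1) : 'rV[R]_m2 :=
  'd (coord (f p) \o f \o point p) (coord p p) v.

End Maps.

End Calculus.

Record lieGroup (R : realType) (N : nat) := LieGroup {
  gmfd :> manifold R N;
  gmul : gmfd -> gmfd -> gmfd;
  gone : gmfd;
  ginv : gmfd -> gmfd;
  gmulA : associative gmul;
  gmul1 : left_id gone gmul;
  gmulV : left_inverse gone ginv gmul;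
  gmul_smooth : smooth_map2 gmul;
  ginv_smooth : smooth_map ginv
}.

Section Groups.
Variables (R : realType) (N : nat) (G : lieGroup R N).

Local Notation one := (gone G).

(* The Lie algebra of G is its tangent space 'rV_N at the identity, with the
   bracket of left-invariant vector fields. *)
Definition left_inv_field (X : 'rV[R]_N) : vfield G :=
  fun g => tmap (gmul g) one X.

Definition lie_br (X Y : 'rV[R]_N) : 'rV[R]_N :=
  bracket (left_inv_field X) (left_inv_field Y) one.

Definition Ad (g : G) (X : 'rV[R]_N) : 'rV[R]_N :=
  tmap (fun h => gmul (gmul g h) (ginv g)) one X.

(* e is the exponential map of G: t |-> e (t X) is the one-parameter subgroup
   with initial velocity X. *)
Definition is_exp (e : 'rV[R]_N -> G) : Prop :=
  forall X : 'rV[R]_N,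
    [/\ smooth_curve (fun t => e (t *: X)),
        forall s t, e ((s + t) *: X) = gmul (e (s *: X)) (e (t *: X)) &
        velocity (fun t => e (t *: X)) 0 = X].

Definition normal_subgroup (S : set G) : Prop :=
  [/\ S one,
      forall g h, S g -> S h -> S (gmul g h),
      forall g, S g -> S (ginv g) &
      forall g h, S h -> S (gmul (gmul g h) (ginv g))].

Definition discrete_subset (S : set G) : Prop :=
  forall g, S g -> \forall h \near g, S h -> h = g.

Section Actions.
Variables (m : nat) (M : manifold R m) (act : G -> M -> M).

Definition smooth_action : Prop :=
  [/\ forall z, act one z = z,
      forall g h z, act (gmul g h) z = act g (act h z) &
      smooth_map2 act].

Definition transitive_action : Prop := forall z z', exists g, act g z = z'.

Definition almost_effective : Prop :=
  forall S : set G, normal_subgroup S -> (forall g z, S g -> act g z = z) ->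
    discrete_subset S.

Definition preserves_form (w : form2 M) : Prop :=
  forall g z u v,
    w (act g z) (tmap (act g) z u) (tmap (act g) z v) = w z u v.

Definition preserves_tensor (J : tensor11 M) : Prop :=
  forall g z v, tmap (act g) z (J z v) = J (act g z) (tmap (act g) z v).

Definition isotropy (x : M) : set G := [set g | act g x = x].

(* The vector field generating the flow z |-> e (t X) z. *)
Definition fund (e : 'rV[R]_N -> G) (X : 'rV[R]_N) : vfield M :=
  fun z => velocity (fun t => act (e (t *: X)) z) 0.

End Actions.
End Groups.

(* Main.v *)
(* Write D for the Chern connection, and call a vector field preserving w and
   J an infinitesimal automorphism.  For such an X the operator
   A_X W = [X, W] - D_X W is tensorial, commutes with J, and satisfies
   tr (J A_X) = - div (J X).  Expanding R(X, Y) on a local frame of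
   infinitesimal automorphisms by means of A_X, A_Y and the Jacobi identity,
   all commutators disappear from tr (J R(X, Y)), and since infinitesimal
   automorphisms preserve J and the divergence there remains
     rho(X, Y) = - div (J [Y, X]).
   The fundamental vector fields of a basis of mm form such a frame near x.
   Computing the divergence in it expresses rho as the trace over mm of
   ad_(H [X, Y]) - H ad_[X, Y]; this is also the trace over the whole Lie
   algebra, because the operator maps kk into mm. *)

(* The definition of the Chern connection prescribes only the metric and the torsion, so D J = 0 has
   to be proved; it follows from d w = 0 by solving a small linear system. The divergence is the
   trace of D W. It can be computed from the coefficients of W alone because every infinitesimal
   automorphism X has divergence zero: the torsion identity gives D X = - A_X - N(X, .), where A_X
   is skew for the metric and N(X, .) anticommutes with J, so both are traceless. For the same
   reason N drops out of tr (J D X). Two obstacles shape the rest. A vector at z is given by its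
   components in the chart chosen for z, so whatever is to be differentiated must first be rewritten
   in one fixed chart. And a connection is specified only on global smooth fields, so expansions in
   a local frame are cleared of denominators by the Gram determinant. The group acts only
   infinitesimally: its identities are differentiated at the identity element, and exponential
   curves only at time 0. *)
From HB Require Import structures.
Require Import Defs.
From mathcomp Require Import ring lra.
Import Order.TTheory GRing.Theory Num.Theory.
Import numFieldNormedType.Exports.

Set Implicit Arguments.
Unset Strict Implicit.
Unset Printing Implicit Defensive.

Local Open Scope classical_set_scope.
Local Open Scope ring_scope.

(** * Differential calculus *)

Section NearDiff.
Variables (R : realType) (V W : normedModType R).
Implicit Types f g : V -> W.

(** Identities between chart expressions hold only near a point; this carries them over to
    differentials. It rests on the uniqueness of the first order expansion. *)
Lemma near_eq_is_diff f g y : (\near y, f y = g y) -> differentiable f y ->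
  differentiable g y /\ 'd g y = 'd f y :> (V -> W).
Proof.
move=> fg df; have fgy : f y = g y := nbhs_singleton fg.
have ex : g \o shift y = cst (g y) + 'd f y +o_ 0 id.
  have /diff_locally := df => fE.
  apply/eqaddoP => e e0.
  move/eqaddoP : fE => /(_ e e0) fE.
  have fg0 : \forall h \near 0, f (h + (y - 0)) = g (h + (y - 0)).
    by move: fg; rewrite (near_shift 0).
  near=> h.
  have <- : (f \o shift y - (cst (f y) + 'd f y)) h =
     (g \o shift y - (cst (g y) + 'd f y)) h.
    rewrite /= !fctE /= fgy; congr (_ - _).
    have -> : (h + y = h + (y - 0)) by rewrite subr0.
    by near: h.
  by near: h.
have dg := diff_unique (@diff_continuous _ _ _ _ _ df) ex.
split=> //; apply/diff_locallyP; split; first by rewrite dg; exact: diff_continuous.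
by rewrite dg.
Unshelve. all: by end_near. Qed.

Lemma near_eq_differentiable f g y : (\near y, f y = g y) ->
  differentiable f y -> differentiable g y.
Proof. by move=> fg /(near_eq_is_diff fg)[]. Qed.

Lemma near_eq_diff f g y v : (\near y, f y = g y) -> differentiable f y ->
  'd g y v = 'd f y v.
Proof. by move=> fg /(near_eq_is_diff fg)[_ ->]. Qed.

End NearDiff.

Section DiffRules.
Variables (R : realType) (V : normedModType R).

Lemma diff_add (W : normedModType R) (f g : V -> W) y v :
  differentiable f y -> differentiable g y ->
  'd (fun z => f z + g z) y v = 'd f y v + 'd g y v.
Proof. by move=> df dg; rewrite (diffD df dg). Qed.

Lemma diff_sub (W : normedModType R) (f g : V -> W) y v :
  differentiable f y -> differentiable g y ->
  'd (fun z => f z - g z) y v = 'd f y v - 'd g y v.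
Proof. by move=> df dg; rewrite (diffB df dg). Qed.

Lemma diff_scalec (W : normedModType R) (f : V -> W) k y v :
  differentiable f y -> 'd (fun z => k *: f z) y v = k *: 'd f y v.
Proof. by move=> df; rewrite (diffZ k df). Qed.

Lemma differentiable_bigsum (W : normedModType R) n (f : 'I_n -> V -> W) y :
  (forall i, differentiable (f i) y) ->
  differentiable (fun z => \sum_(i < n) f i z) y.
Proof.
move=> df; have -> : (fun z => \sum_(i < n) f i z) = \sum_(i < n) f i.
  by apply/funext => z; rewrite fct_sumE.
exact: differentiable_sum.
Qed.

Lemma diff_bigsum (W : normedModType R) n (f : 'I_n -> V -> W) y v :
  (forall i, differentiable (f i) y) ->
  'd (fun z => \sum_(i < n) f i z) y v = \sum_(i < n) 'd (f i) y v.
Proof.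
elim: n f => [|n ih] f df.
  have -> : (fun z => \sum_(i < 0) f i z) = cst 0.
    by apply/funext => z; rewrite big_ord0.
  by rewrite big_ord0 diff_cst.
have -> : (fun z => \sum_(i < n.+1) f i z) =
    (fun z => f ord0 z + \sum_(i < n) f (lift ord0 i) z).
  by apply/funext => z; rewrite big_ord_recl.
rewrite diff_add //; last exact: differentiable_bigsum.
by rewrite big_ord_recl ih.
Qed.

Lemma diff_mul (f g : V -> R) y v :
  differentiable f y -> differentiable g y ->
  'd (fun z => f z * g z) y v = f y * 'd g y v + g y * 'd f y v.
Proof. by move=> df dg; rewrite (diffM df dg). Qed.

Lemma diff_inv (f : V -> R) y v : differentiable f y -> f y != 0 ->
  'd (fun z => (f z)^-1) y v = - (f y)^-1 ^+ 2 * 'd f y v.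
Proof. by move=> df fy; rewrite (diffV df fy) /= exprVn. Qed.

Lemma differentiable_mxP m n (f : V -> 'M[R]_(m, n)) y :
  differentiable f y <-> forall i j, differentiable (fun z => f z i j) y.
Proof.
split=> [df i j|df].
  apply: (@differentiable_comp _ _ _ _ f (fun N : 'M[R]_(m, n) => N i j)) => //.
  exact: differentiable_coord.
have -> : f = fun z => \sum_i \sum_j f z i j *: delta_mx i j.
  by apply/funext => z; rewrite -matrix_sum_delta.
apply: differentiable_bigsum => i; apply: differentiable_bigsum => j.
exact: differentiableZl.
Qed.

Lemma diff_mxE m n (f : V -> 'M[R]_(m, n)) y v i j : differentiable f y ->
  'd f y v i j = 'd (fun z => f z i j) y v.
Proof.
move=> df; rewrite -!deriveE//; last by move/differentiable_mxP: df; exact.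
rewrite derive_mx ?mxE//; exact: diff_derivable.
Qed.

Lemma scale_is_bilinear (W : normedModType R) :
  bilinear_for
    (GRing.Scale.Law.clone _ _ *:%R _) (GRing.Scale.Law.clone _ _ *:%R _)
    (fun (c : R) (w : W) => c *: w).
Proof.
split=> [w|c] a x y /=; first by rewrite scalerDl scalerA.
by rewrite scalerDr !scalerA mulrC.
Qed.

Lemma is_diff_scale (W : normedModType R) (f : V -> R) (g : V -> W) y :
  differentiable f y -> differentiable g y ->
  differentiable (fun z => f z *: g z) y /\
  forall v, 'd (fun z => f z *: g z) y v = f y *: 'd g y v + 'd f y v *: g y.
Proof.
move=> df dg; pose bM :=
  bilinear_isBilinear.Build R R W W _ _ _ (@scale_is_bilinear W).
pose b : {bilinear R -> W -> W} := HB.pack (fun (c : R) (w : W) => c *: w) bM.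
have cb : continuous (fun p : R * W => b p.1 p.2).
  by move=> p; exact: scale_continuous.
have db := @differentiable_bilin _ _ _ _ b (f y, g y) cb.
have dfg := differentiable_pair df dg.
split=> [|v]; first exact: (differentiable_comp dfg db).
have -> : (fun z => f z *: g z) = (fun p => b p.1 p.2) \o (fun z => (f z, g z)).
  by [].
by rewrite (diff_comp dfg db) /= (diff_bilin _ cb) (diff_pair df dg).
Qed.

Lemma differentiable_scale (W : normedModType R) (f : V -> R) (g : V -> W) y :
  differentiable f y -> differentiable g y ->
  differentiable (fun z => f z *: g z) y.
Proof. by move=> df /(is_diff_scale df)[]. Qed.

Lemma diff_scale (W : normedModType R) (f : V -> R) (g : V -> W) y v :
  differentiable f y -> differentiable g y ->
  'd (fun z => f z *: g z) y v = f y *: 'd g y v + 'd f y v *: g y.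
Proof. by move=> df /(is_diff_scale df)[]. Qed.

Lemma diff_chain (W X : normedModType R) (g : W -> X) (f : V -> W) y v :
  differentiable f y -> differentiable g (f y) ->
  'd (fun z => g (f z)) y v = 'd g (f y) ('d f y v).
Proof. by move=> df dg; rewrite (diff_comp df dg). Qed.

Lemma differentiable_chain (W X : normedModType R) (g : W -> X) (f : V -> W) y :
  differentiable f y -> differentiable g (f y) ->
  differentiable (fun z => g (f z)) y.
Proof. exact: differentiable_comp. Qed.

End DiffRules.

(** Tensors occur as bare functions with a proof of linearity; the bundled linear map is built only
    here. *)
Lemma rowvec_expand (R : realType) k (W : lmodType R) (T : 'rV[R]_k -> W) v :
  linear T -> T v = \sum_i v 0 i *: T (delta_mx 0 i).
Proof.
move=> lT; pose lM := GRing.isLinear.Build _ _ _ _ _ lT.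
pose L : {linear 'rV[R]_k -> W} := HB.pack T lM.
have -> : T = L by [].
rewrite {1}[v]row_sum_delta linear_sum; apply: eq_bigr => i _.
by rewrite linearZ.
Qed.

Section LinDiff.
Variables (R : realType) (k : nat).

Lemma rowvec_linear_diff (W : normedModType R) (T : 'rV[R]_k -> W) y :
  linear T -> differentiable T y /\ forall v, 'd T y v = T v.
Proof.
move=> lT.
have TE : T = fun z => \sum_i z 0 i *: T (delta_mx 0 i).
  by apply/funext => z; exact: rowvec_expand.
have dc i : differentiable (fun z : 'rV[R]_k => z 0 i *: T (delta_mx 0 i)) y.
  exact/differentiableZl/differentiable_coord.
split=> [|v].
  by rewrite TE; exact: differentiable_bigsum.
rewrite {1}TE diff_bigsum// (rowvec_expand _ lT); apply: eq_bigr => i _.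
rewrite (diffZl _ (@differentiable_coord _ _ _ _ _ _)); congr (_ *: _).
by rewrite -diff_mxE// diff_val.
Qed.

(** Product rule for a field [T] of linear maps, read along [h] and applied to a moving vector [a].
    Expanding [a] in the standard basis reduces differentiability of [T] to constant vectors, which
    is what smoothness of a tensor provides. *)
Lemma diff_linear_family (V Y W : normedModType R)
   (T : Y -> 'rV[R]_k -> W) (h : V -> Y) (a : V -> 'rV[R]_k) z :
  (forall y, linear (T y)) -> differentiable h z -> differentiable a z ->
  (forall i, differentiable (fun y => T y (delta_mx 0 i)) (h z)) ->
  differentiable (fun z => T (h z) (a z)) z /\
  forall v, 'd (fun z => T (h z) (a z)) z v =
    T (h z) ('d a z v) + 'd (fun y => T y (a z)) (h z) ('d h z v).
Proof.
move=> lT dh da dT.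
have TE : (fun z => T (h z) (a z)) =
    fun z => \sum_i a z 0 i *: T (h z) (delta_mx 0 i).
  by apply/funext => z'; exact: rowvec_expand.
have dai i : differentiable (fun z => a z 0 i) z by move/differentiable_mxP: da.
have dTi i : differentiable (fun z => T (h z) (delta_mx 0 i)) z.
  exact: (differentiable_chain dh (dT i)).
split=> [|v]; rewrite TE.
  by apply: differentiable_bigsum => i; exact: differentiable_scale.
have TaE : (fun y => T y (a z)) =
    fun y => \sum_i a z 0 i *: T y (delta_mx 0 i).
  by apply/funext => y; exact: rowvec_expand.
rewrite TaE diff_bigsum; last by move=> i; exact: differentiable_scale.
rewrite diff_bigsum; last by move=> i; exact: differentiableZ.
rewrite (rowvec_expand _ (lT _)) -big_split; apply: eq_bigr => i _ /=.
rewrite diff_scale// addrC (diff_chain _ dh (dT i)) -(diff_mxE _ _ _ da).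
congr (_ + _); exact/esym/(diff_scalec _ _ (dT i)).
Qed.

Lemma diff_linear_field (V W : normedModType R)
   (T : V -> 'rV[R]_k -> W) (a : V -> 'rV[R]_k) z :
  (forall y, linear (T y)) -> differentiable a z ->
  (forall i, differentiable (fun y => T y (delta_mx 0 i)) z) ->
  differentiable (fun z => T z (a z)) z /\
  forall v, 'd (fun z => T z (a z)) z v =
    T z ('d a z v) + 'd (fun y => T y (a z)) z v.
Proof.
move=> lT da dT; have differentiable_var : differentiable (fun y : V => y) z by [].
have [df E] := diff_linear_family lT differentiable_var da dT; split=> // v.
have dE : 'd (fun y : V => y) z v = v by rewrite diff_val.
rewrite (E v) /=; congr (_ + _).
exact: (congr1 ('d (fun y => T y (a z)) z) dE).
Qed.

(** The linear rule is applied to the first argument, with [h] and the second one absorbed into the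
    family, and then to the second argument with the first frozen. *)
Lemma diff_bilinear_family (V Y : normedModType R)
    (T : Y -> 'rV[R]_k -> 'rV[R]_k -> R) (h : V -> Y) (a b : V -> 'rV[R]_k) z :
  (forall y u, scalar (T y u)) -> (forall y v, scalar (T y ^~ v)) ->
  differentiable h z -> differentiable a z -> differentiable b z ->
  (forall i j, differentiable (fun y => T y (delta_mx 0 i) (delta_mx 0 j)) (h z)) ->
  differentiable (fun z => T (h z) (a z) (b z)) z /\
  forall v, 'd (fun z => T (h z) (a z) (b z)) z v =
    T (h z) ('d a z v) (b z) + T (h z) (a z) ('d b z v) +
    'd (fun y => T y (a z) (b z)) (h z) ('d h z v).
Proof.
move=> lr ll dh da db dT.
have dTi i := diff_linear_family (T := fun y => T y (delta_mx 0 i))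
  (fun y => lr y (delta_mx 0 i)) dh db (dT i).
have dTa j : differentiable (fun y => T y (a z) (delta_mx 0 j)) (h z).
  have -> : (fun y => T y (a z) (delta_mx 0 j)) =
      fun y => \sum_i a z 0 i *: (T y (delta_mx 0 i) (delta_mx 0 j) : R).
    by apply/funext => y; exact: (@rowvec_expand _ _ R (T y ^~ (delta_mx 0 j))).
  by apply: differentiable_bigsum => i; exact: differentiableZ.
have [d1 E1] := diff_linear_family (T := fun y => T y (a z))
  (fun y => lr y (a z)) dh db dTa.
have [d2 E2] := diff_linear_field (T := fun z' u => T (h z') u (b z'))
  (fun z' => ll (h z') (b z')) da (fun i => (dTi i).1).
split=> [|v]; first exact: d2.
apply: (etrans (E2 v)); apply: (etrans (congr1 (fun s => _ + s) (E1 v))).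
exact: addrA.
Qed.

End LinDiff.

(** * Differentiability of finite order, and smoothness near a point *)

Section Ck.
Variable R : realType.
Implicit Types V W X : normedModType R.

(** A form of smoothness suited to induction: [smooth_near] quantifies over lists of directions and
    has no order to induct on. Order 0 already asks for differentiability, so [Ck k] makes the
    iterated differentials up to order [k] differentiable. *)
Fixpoint Ck V W (k : nat) (U : set V) (f : V -> W) : Prop :=
  if k is k'.+1 then
    (forall y, U y -> differentiable f y) /\
    forall v, Ck k' U (fun y => 'd f y v)
  else forall y, U y -> differentiable f y.

Lemma open_near_eq V W (U : set V) (f g : V -> W) y : open U -> U y ->
  (forall y, U y -> f y = g y) -> \near y, f y = g y.
Proof. by move=> oU Uy fg; apply: filterS (open_nbhs_nbhs (conj oU Uy)) => z /fg. Qed.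

Lemma Ck_eq V W k (U : set V) (f g : V -> W) : open U ->
  (forall y, U y -> f y = g y) -> Ck k U f -> Ck k U g.
Proof.
move=> oU; elim: k f g => [|k ih] f g fg /=.
  move=> df y Uy; apply: near_eq_differentiable (df y Uy).
  exact: open_near_eq fg.
case=> df Df; split=> [y Uy|v].
  by apply: near_eq_differentiable (df y Uy); exact: open_near_eq fg.
apply: ih (Df v) => y Uy; apply/esym/near_eq_diff; last exact: df.
exact: open_near_eq fg.
Qed.

Lemma CkW V W k (U : set V) (f : V -> W) : Ck k.+1 U f -> Ck k U f.
Proof.
elim: k f => [|k ih] f; first by case.
by case=> df Df; split=> // v; exact: ih.
Qed.

Lemma Ck_sub V W k (U U' : set V) (f : V -> W) :
  U' `<=` U -> Ck k U f -> Ck k U' f.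
Proof.
move=> sU; elim: k f => [|k ih] f /=; first by move=> df y /sU; exact: df.
by case=> df Df; split=> [y /sU|v]; [exact: df|exact: ih].
Qed.

Lemma Ck_cst V W k (U : set V) (c : W) : Ck k U (fun=> c).
Proof.
elim: k c => [|k ih] c /=; first by move=> y _; exact: differentiable_cst.
split=> [y _|v]; first exact: differentiable_cst.
by under eq_fun do rewrite diff_cst; exact: ih.
Qed.

Lemma Ck_add V W k (U : set V) (f g : V -> W) : open U ->
  Ck k U f -> Ck k U g -> Ck k U (fun y => f y + g y).
Proof.
move=> oU; elim: k f g => [|k ih] f g.
  by move=> df dg y Uy; apply: differentiableD; [exact: df|exact: dg].
case=> df Df [dg Dg]; split=> [y Uy|v].
  by apply: differentiableD; [exact: df|exact: dg].
apply: Ck_eq (ih _ _ (Df v) (Dg v)) => // y Uy.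
by rewrite diff_add; [|exact: df|exact: dg].
Qed.

Lemma Ck_mul V k (U : set V) (f g : V -> R) : open U ->
  Ck k U f -> Ck k U g -> Ck k U (fun y => f y * g y).
Proof.
move=> oU; elim: k f g => [|k ih] f g.
  by move=> df dg y Uy; apply: differentiableM; [exact: df|exact: dg].
move=> Cf Cg; have [df Df] := Cf; have [dg Dg] := Cg; split=> [y Uy|v].
  by apply: differentiableM; [exact: df|exact: dg].
apply: (@Ck_eq _ _ _ _ (fun y => f y * 'd g y v + g y * 'd f y v)) => //.
  by move=> y Uy; rewrite (diff_mul v (df y Uy) (dg y Uy)).
have Dg' := Dg v; have Df' := Df v; have := CkW Cf; have := CkW Cg => Cg' Cf'.
by apply: Ck_add => //; apply: ih.
Qed.

Lemma Ck_inv V k (U : set V) (f : V -> R) : open U ->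
  (forall y, U y -> f y != 0) -> Ck k U f -> Ck k U (fun y => (f y)^-1).
Proof.
move=> oU f0; elim: k => [|k ih] => [df y Uy|Cf].
  by apply: differentiableV; [exact: df|exact: f0].
have [df Df] := Cf; split=> [y Uy|v].
  by apply: differentiableV; [exact: df|exact: f0].
have Ci := ih (CkW Cf).
apply: (@Ck_eq _ _ _ _ (fun y => -1 * ((f y)^-1 * (f y)^-1) * 'd f y v)) => //.
  move=> y Uy; rewrite (diff_inv v (df y Uy) (f0 y Uy)) mulN1r.
  by rewrite expr2.
have Ci2 := Ck_mul oU (@Ck_cst V R k U (-1)) (Ck_mul oU Ci Ci).
exact: (Ck_mul oU Ci2 (Df v)).
Qed.

Lemma Ck_mxP V k (U : set V) m n (f : V -> 'M[R]_(m, n)) : open U ->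
  Ck k U f <-> forall i j, Ck k U (fun y => f y i j).
Proof.
move=> oU; elim: k f => [|k ih] f.
  split=> [df i j y /df/differentiable_mxP//|df y Uy].
  by apply/differentiable_mxP => i j; exact: df.
split=> [[df Df] i j|df].
  split=> [y /df/differentiable_mxP//|v].
  by apply: Ck_eq ((ih _).1 (Df v) i j) => // y /df; exact: diff_mxE.
have df' y : U y -> differentiable f y.
  by move=> Uy; apply/differentiable_mxP => i j; have [+ _] := df i j; exact.
split=> // v; apply/ih => i j; have [_ Df] := df i j.
by apply: Ck_eq (Df v) => // y /df'/diff_mxE.
Qed.

(** When the differential of [h] is the same at every point, the differential of the composite is
    again a composite with [h], and the induction never has to differentiate the chain rule. The
    inclusions of the factors into a product are of this kind. *)
Lemma Ck_affine V W X k (U : set W) (f : W -> X) (h : V -> W) (L : V -> W) :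
  (forall y, differentiable h y /\ forall v, 'd h y v = L v) -> open U ->
  Ck k U f -> Ck k (h @^-1` U) (fun y => f (h y)).
Proof.
move=> hL oU; have dh y := (hL y).1.
have oU' : open (h @^-1` U).
  apply: open_comp => // y _; exact: differentiable_continuous.
elim: k f => [|k ih] f => [df y Uy|[df Df]].
  exact: differentiable_chain (df _ Uy).
split=> [y Uy|v]; first exact: differentiable_chain (df _ Uy).
apply: Ck_eq (ih _ (Df (L v))) => // y Uy.
by rewrite (diff_chain v (dh y) (df _ Uy)) (hL y).2.
Qed.

Lemma CkP V W (U : set V) (f : V -> W) k : open U ->
  Ck k U f <-> forall s : seq V, (size s <= k)%N -> forall y, U y ->
    differentiable (foldr (fun v h => (fun a => 'D_v h a)) f s) y.
Proof.
move=> oU; elim: k f => [|k ih] f.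
  split=> [df s|]; first by rewrite leqn0 size_eq0 => /eqP->.
  by move=> /(_ [::]); exact.
have DE v : (forall y, U y -> differentiable f y) ->
    Ck k U (fun y => 'd f y v) <-> Ck k U (fun y => 'D_v f y).
  by move=> df; split; apply: Ck_eq => // y Uy; rewrite deriveE//; exact: df.
split=> [[df Df] s|df].
  (* [foldr] applies the last entry of the list first, so this entry is the direction peeled off by
     one unfolding of [Ck]. *)
  case/lastP: s => [_|s v]; first exact: df.
  rewrite size_rcons foldr_rcons => sk; apply: (ih _).1 => //.
  exact: ((DE v df).1 (Df v)).
have df0 y : U y -> differentiable f y by exact: (df [::]).
split=> // v; apply: (DE v df0).2; apply/ih => s sk.
by have := df (rcons s v); rewrite size_rcons foldr_rcons; exact.
Qed.

(** One open set serves all orders: the interior of the set where all iterated derivatives are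
    differentiable. *)
Lemma smooth_nearP V W (f : V -> W) y :
  smooth_near f y <-> exists U, [/\ open U, U y & forall k, Ck k U f].
Proof.
split=> [sf|[U [oU Uy Cf]]].
  pose P := [set y | forall s : seq V,
    differentiable (foldr (fun v h => (fun a => 'D_v h a)) f s) y].
  exists P°; split; [exact: open_interior|exact: sf|] => k.
  apply/CkP; first exact: open_interior.
  by move=> s _ z /interior_subset; exact.
apply: filterS (open_nbhs_nbhs (conj oU Uy)) => z Uz s.
exact: ((CkP _ _ oU).1 (Cf (size s)) s _ _ Uz).
Qed.

Lemma smooth_near_near V W (f : V -> W) y :
  smooth_near f y -> \forall z \near y, smooth_near f z.
Proof.
move=> /smooth_nearP[U [oU Uy Cf]].
apply: filterS (open_nbhs_nbhs (conj oU Uy)) => z Uz.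
by apply/smooth_nearP; exists U.
Qed.

Lemma smooth_near_differentiable V W (f : V -> W) y :
  smooth_near f y -> differentiable f y.
Proof. by move=> /smooth_nearP[U [_ Uy /(_ 0)]]; exact. Qed.

Lemma smooth_near_diff V W (f : V -> W) y v :
  smooth_near f y -> smooth_near (fun z => 'd f z v) y.
Proof.
move=> /smooth_nearP[U [oU Uy Cf]]; apply/smooth_nearP; exists U; split=> // k.
by have [_] := Cf k.+1; exact.
Qed.

Lemma smooth_near_eq V W (f g : V -> W) y :
  (\near y, f y = g y) -> smooth_near f y -> smooth_near g y.
Proof.
move=> fg /smooth_nearP[U [oU Uy Cf]]; apply/smooth_nearP.
pose P := [set z | f z = g z].
have oUP : open (U `&` P°) by apply: openI => //; exact: open_interior.
exists (U `&` P°); split=> // k.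
have CI : Ck k (U `&` P°) f by apply: Ck_sub (Cf k) => z [].
by apply: (Ck_eq oUP _ CI) => z [_ /interior_subset].
Qed.

Lemma smooth_near_cst V W (c : W) (y : V) : smooth_near (fun=> c) y.
Proof.
by apply/smooth_nearP; exists setT; split=> // [|k]; [exact: openT|exact: Ck_cst].
Qed.

Lemma smooth_near_add V W (f g : V -> W) y :
  smooth_near f y -> smooth_near g y -> smooth_near (fun z => f z + g z) y.
Proof.
move=> /smooth_nearP[U [oU Uy Cf]] /smooth_nearP[U' [oU' U'y Cg]].
have oI := openI oU oU'.
apply/smooth_nearP; exists (U `&` U'); split=> // k.
by apply: Ck_add => //; [apply: Ck_sub (Cf k)|apply: Ck_sub (Cg k)] => z [].
Qed.

Lemma smooth_near_mul V (f g : V -> R) y :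
  smooth_near f y -> smooth_near g y -> smooth_near (fun z => f z * g z) y.
Proof.
move=> /smooth_nearP[U [oU Uy Cf]] /smooth_nearP[U' [oU' U'y Cg]].
have oI := openI oU oU'.
apply/smooth_nearP; exists (U `&` U'); split=> // k.
by apply: Ck_mul => //; [apply: Ck_sub (Cf k)|apply: Ck_sub (Cg k)] => z [].
Qed.

Lemma smooth_near_inv V (f : V -> R) y :
  smooth_near f y -> f y != 0 -> smooth_near (fun z => (f z)^-1) y.
Proof.
move=> sf fy0; have /smooth_nearP[U [oU Uy Cf]] := sf.
have cf : {for y, continuous f}.
  exact/differentiable_continuous/smooth_near_differentiable.
pose P := [set z | f z != 0].
have Py : P° y.
  have : \forall z \near f y, z != 0.
    by apply: open_nbhs_nbhs; split=> //; exact: open_neq.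
  by move=> /cf.
have oI : open (U `&` P°) by apply: openI => //; exact: open_interior.
apply/smooth_nearP; exists (U `&` P°); split=> // k.
apply: Ck_inv => //; last by apply: Ck_sub (Cf k) => z [].
by move=> z [_ /interior_subset].
Qed.

Lemma smooth_near_bigsum V W (I : Type) (r : seq I) (f : I -> V -> W) y :
  (forall i, smooth_near (f i) y) ->
  smooth_near (fun z => \sum_(i <- r) f i z) y.
Proof.
move=> cf; elim: r => [|i r ih].
  by under eq_fun do rewrite big_nil; exact: smooth_near_cst.
by under eq_fun do rewrite big_cons; exact: smooth_near_add.
Qed.

Lemma smooth_near_bigprod V (I : Type) (r : seq I) (f : I -> V -> R) y :
  (forall i, smooth_near (f i) y) ->
  smooth_near (fun z => \prod_(i <- r) f i z) y.
Proof.
move=> cf; elim: r => [|i r ih].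
  by under eq_fun do rewrite big_nil; exact: smooth_near_cst.
by under eq_fun do rewrite big_cons; exact: smooth_near_mul.
Qed.

Lemma smooth_near_mxP V m n (f : V -> 'M[R]_(m, n)) y :
  smooth_near f y <-> forall i j, smooth_near (fun z => f z i j) y.
Proof.
split=> [/smooth_nearP[U [oU Uy Cf]] i j|sf].
  apply/smooth_nearP; exists U; split=> // k.
  by have := Cf k => /(Ck_mxP _ _ oU).
have -> : f = fun z => \sum_i \sum_j f z i j *: delta_mx i j.
  by apply/funext => z; rewrite -matrix_sum_delta.
apply: smooth_near_bigsum => i; apply: smooth_near_bigsum => j.
have /smooth_nearP[U [oU Uy Cf]] := sf i j.
apply/smooth_nearP; exists U; split=> // k.
apply/(Ck_mxP _ _ oU) => a b; under eq_fun do rewrite mxE.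
exact: (Ck_mul oU (Cf k) (@Ck_cst V R k U _)).
Qed.

Lemma smooth_near_scale V m (f : V -> R) (g : V -> 'rV[R]_m) y :
  smooth_near f y -> smooth_near g y -> smooth_near (fun z => f z *: g z) y.
Proof.
move=> sf /smooth_near_mxP sg; apply/smooth_near_mxP => i j.
by under eq_fun do rewrite mxE; exact: smooth_near_mul.
Qed.

Lemma smooth_near_affine V W X (f : W -> X) (h L : V -> W) y :
  (forall y, differentiable h y /\ forall v, 'd h y v = L v) ->
  smooth_near f (h y) -> smooth_near (fun z => f (h z)) y.
Proof.
move=> hL /smooth_nearP[U [oU Uy Cf]].
apply/smooth_nearP; exists (h @^-1` U); split=> // [|k].
  by apply: open_comp => // z _; apply: differentiable_continuous; have [] := hL z.
exact: Ck_affine hL oU (Cf k).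
Qed.

End Ck.

(** * Symmetry of second differentials *)

Section Schwarz.
Variables (R : realType) (V : normedModType R).
Implicit Types f g : V -> R.

Lemma line_is_diff (W : normedModType R) (g : V -> W) (p u : V) (s : R) :
  differentiable g (p + s *: u) ->
  is_derive s (1 : R) (fun t => g (p + t *: u)) ('d g (p + s *: u) u).
Proof.
move=> dg.
have du : differentiable (fun t : R => t *: u) s.
  exact: (@differentiableZl _ _ _ (fun t : R => t)).
have dl : differentiable (fun t : R => p + t *: u) s.
  exact: (differentiableD (differentiable_cst p s) du).
have dgl := differentiable_chain dl dg.
apply: DeriveDef; first exact: diff_derivable.
rewrite deriveE// (diff_chain _ dl dg); congr ('d g _ _).
rewrite (diff_add _ (differentiable_cst p s) du) diff_cst add0r.
by rewrite (@diffZl _ _ _ (fun t : R => t)) ?diff_val ?scale1r.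
Qed.

Lemma MVT_line g (p u : V) (h : R) : 0 < h ->
  (forall s, 0 <= s <= h -> differentiable g (p + s *: u)) ->
  exists2 c, 0 <= c <= h & g (p + h *: u) - g p = h * 'd g (p + c *: u) u.
Proof.
move=> h0 dg.
have [||c ch E] := @MVT R (fun t => g (p + t *: u))
  (fun t => 'd g (p + t *: u) u) 0 h h0.
- move=> s; rewrite in_itv /= => /andP[s0 sh]; apply: line_is_diff.
  by apply: dg; rewrite !ltW.
- apply: derivable_within_continuous => s; rewrite in_itv/= => sh.
  by have [] := line_is_diff (dg s sh).
exists c; first by move: ch; rewrite in_itv/= => /andP[c0 ch]; rewrite !ltW.
by move: E; rewrite scale0r addr0 subr0 mulrC.
Qed.

(** The mean value theorem is applied along [u] to the increment of [f] by [h *: v], then along [v]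
    to the differential. The left side is symmetric in [u] and [v], whence the symmetry of second
    differentials. *)
Lemma second_difference f (y u v : V) (h : R) : 0 < h ->
  (forall s t, 0 <= s <= h -> 0 <= t <= h ->
     differentiable f (y + s *: u + t *: v) /\
     differentiable (fun z => 'd f z u) (y + s *: u + t *: v)) ->
  exists s t, [/\ 0 <= s <= h, 0 <= t <= h &
   f (y + h *: u + h *: v) - f (y + h *: u) - (f (y + h *: v) - f y) =
   h * (h * 'd (fun z => 'd f z u) (y + s *: u + t *: v) v)].
Proof.
move=> h0 df.
have hh : 0 <= h <= h by lra.
have h00 : (0 : R) <= 0 <= h by lra.
have differentiable_var (z : V) : differentiable (fun y : V => y) z by [].
have dsh z : differentiable (fun y => y + h *: v) z.
  exact: (differentiableD (differentiable_var z) (differentiable_cst _ _)).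
have dsE z w : 'd (fun y => y + h *: v) z w = w.
  rewrite (diff_add _ (differentiable_var z) (differentiable_cst _ _)).
  by rewrite diff_cst addr0 diff_val.
have df1 s : 0 <= s <= h -> differentiable f (y + s *: u).
  by move=> sh; have [+ _] := df s 0 sh h00; rewrite scale0r addr0.
have df2 s : 0 <= s <= h -> differentiable (fun z => f (z + h *: v)) (y + s *: u).
  move=> sh; apply: (differentiable_chain (dsh _)).
  by have [+ _] := df s h sh hh.
have [s sh E] := @MVT_line (fun z => f (z + h *: v) - f z) y u h h0
  (fun s sh => differentiableB (df2 s sh) (df1 s sh)).
have [|t th E'] := @MVT_line (fun z => 'd f z u) (y + s *: u) v h h0.
  by move=> t th; have [] := df s t sh th.
exists s, t; split=> //; rewrite E diff_sub; [|exact: df2|exact: df1].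
rewrite -E'; congr (_ * (_ - _)).
rewrite (diff_chain _ (dsh _)) ?dsE//.
by have [+ _] := df s h sh hh.
Qed.

Lemma schwarz_real f y u v : smooth_near f y ->
  'd (fun z => 'd f z u) y v = 'd (fun z => 'd f z v) y u.
Proof.
move=> sf.
pose A z := 'd (fun z => 'd f z u) z v; pose B z := 'd (fun z => 'd f z v) z u.
have cA : {for y, continuous A}.
  apply/differentiable_continuous/smooth_near_differentiable.
  exact/smooth_near_diff/smooth_near_diff.
have cB : {for y, continuous B}.
  apply/differentiable_continuous/smooth_near_differentiable.
  exact/smooth_near_diff/smooth_near_diff.
rewrite -/(A y) -/(B y); apply/eqP/contraT => AB.
(* Half of the supposed gap, so that two estimates below [e] are contradictory. *)
pose e := `|A y - B y| / 2.
have e0 : 0 < e by rewrite divr_gt0// normr_gt0 subr_eq0.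
have nA : \forall z \near y, `|A y - A z| < e by move/cvgrPdist_lt : cA; exact.
have nB : \forall z \near y, `|B y - B z| < e by move/cvgrPdist_lt : cB; exact.
have [r /= r0 Hr] :=
  (nbhs_ballP _ _).1 (filterI (filterI nA nB) (smooth_near_near sf)).
(* With this step the whole parallelogram spanned by [h *: u] and [h *: v] stays in the ball of
   radius [r]; the summand 1 keeps the denominator positive and the inequality strict. *)
pose h := r / (`|u| + `|v| + 1).
have D0 : 0 < `|u| + `|v| + 1 by rewrite ltr_wpDl// addr_ge0.
have h0 : 0 < h by rewrite divr_gt0.
have inr s t a b : 0 <= s <= h -> 0 <= t <= h -> `|a| + `|b| = `|u| + `|v| ->
    ball y r (y + s *: a + t *: b).
  move=> /andP[s0 sh] /andP[t0 th] ab.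
  rewrite -ball_normE /ball_/= -addrA opprD addNKr normrN.
  rewrite (le_lt_trans (ler_normD _ _))// !normrZ !ger0_norm//.
  rewrite (@le_lt_trans _ _ (h * `|a| + h * `|b|))//.
    by rewrite lerD// ler_wpM2r.
  rewrite -mulrDr ab.
  have -> : r = h * (`|u| + `|v| + 1) by rewrite /h divfK// gt_eqF.
  by rewrite ltr_pM2l// ltrDl.
have [s [t [sh th E]]] : exists s t, [/\ 0 <= s <= h, 0 <= t <= h &
   f (y + h *: u + h *: v) - f (y + h *: u) - (f (y + h *: v) - f y) =
   h * (h * A (y + s *: u + t *: v))].
  apply: second_difference => // s t sh th.
  have [_ sm] := Hr _ (inr s t u v sh th erefl).
  split; first exact: smooth_near_differentiable.
  exact/smooth_near_differentiable/smooth_near_diff.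
have vu : `|v| + `|u| = `|u| + `|v| by rewrite addrC.
have [s' [t' [sh' th' E']]] : exists s t, [/\ 0 <= s <= h, 0 <= t <= h &
   f (y + h *: v + h *: u) - f (y + h *: v) - (f (y + h *: u) - f y) =
   h * (h * B (y + s *: v + t *: u))].
  apply: second_difference => // s1 t1 sh1 th1.
  have [_ sm] := Hr _ (inr s1 t1 v u sh1 th1 vu).
  split; first exact: smooth_near_differentiable.
  exact/smooth_near_differentiable/smooth_near_diff.
have [[An _] _] := Hr _ (inr s t u v sh th erefl).
have [[_ Bn] _] := Hr _ (inr s' t' v u sh' th' vu).
(* The two second differences are the same number, so [A] and [B] agree at two intermediate points,
   both close to [y]. *)
have EE : A (y + s *: u + t *: v) = B (y + s' *: v + t' *: u).
  apply/(mulfI (lt0r_neq0 h0))/(mulfI (lt0r_neq0 h0)).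
  rewrite -E -E' [y + h *: v + h *: u]addrAC; lra.
have : `|A y - B y| < e + e.
  rewrite [A y - B y](_ : _ = (A y - A (y + s *: u + t *: v)) -
     (B y - B (y + s' *: v + t' *: u))); last by rewrite EE; lra.
  by rewrite (le_lt_trans (ler_normB _ _))// ltrD.
by rewrite -splitr ltxx.
Qed.

Lemma schwarz m (f : V -> 'rV[R]_m) y u v : smooth_near f y ->
  'd (fun z => 'd f z u) y v = 'd (fun z => 'd f z v) y u.
Proof.
move=> sf; have sfi j : smooth_near (fun z => f z 0 j) y.
  by move/smooth_near_mxP: sf; exact.
have dE j w w' : 'd (fun z => 'd f z w) y w' 0 j =
    'd (fun z => 'd (fun z => f z 0 j) z w) y w'.
  rewrite diff_mxE; last exact/smooth_near_differentiable/smooth_near_diff.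
  apply: near_eq_diff; last exact/smooth_near_differentiable/smooth_near_diff.
  near=> z; apply/esym/diff_mxE/smooth_near_differentiable.
  near: z; exact: smooth_near_near.
by apply/rowP => j; rewrite !dE; exact: schwarz_real.
Unshelve. all: by end_near. Qed.

End Schwarz.

(** * Vector fields and frames on a manifold *)

Section Charts.
Variables (R : realType) (m : nat) (M : manifold R m).
Implicit Types (p q r z : M) (u v : 'rV[R]_m).

Definition dom p : set M := cdom (chart_at p).

Lemma dom_self p : dom p p. Proof. exact: mem_chart_at. Qed.
Hint Resolve dom_self : core.

Lemma dom_nbhs p z : dom p z -> nbhs z (dom p).
Proof. by move=> pz; apply: open_nbhs_nbhs; split=> //; exact: cdom_open. Qed.

Lemma coordK p z : dom p z -> point p (coord p z) = z.
Proof. exact: cmapK. Qed.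

Lemma near_coord_dom p z : dom p z ->
  \forall y \near coord p z, dom p (point p y) /\ coord p (point p y) = y.
Proof.
move=> pz; have oI := @cimage_open _ _ _ (chart_at p).
have Iz : (coord p @` dom p) (coord p z) by exists z.
apply: filterS (open_nbhs_nbhs (conj oI Iz)) => y [z' pz' <-].
by rewrite /point /coord cmapK.
Qed.

Lemma near_point p z (A : set M) : dom p z -> nbhs z A ->
  \forall y \near coord p z, A (point p y).
Proof.
move=> pz Az; have := cinv_continuous pz.
by apply; rewrite /= -/(point p) -/(coord p) coordK.
Qed.

Lemma near_coord p z (A : set 'rV[R]_m) : dom p z -> nbhs (coord p z) A ->
  \forall z' \near z, A (coord p z').
Proof. by move=> pz Az; exact: (cmap_continuous pz). Qed.

Lemma trans_smooth p q z : dom p z -> dom q z ->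
  smooth_near (coord q \o point p) (coord p z).
Proof. exact: chart_compat. Qed.

Lemma trans_differentiable p q z : dom p z -> dom q z ->
  differentiable (fun y => coord q (point p y)) (coord p z).
Proof. by move=> pz qz; exact/smooth_near_differentiable/trans_smooth. Qed.

Lemma coord_change_linear p q z : linear (coord_change p q z).
Proof. by move=> a u v; rewrite /coord_change linearP. Qed.

Lemma differentiable_chart (W : normedModType R) (f : M -> W) p q z :
  dom p z -> dom q z -> differentiable (f \o point p) (coord p z) ->
  differentiable (f \o point q) (coord q z) /\
  forall v, 'd (f \o point p) (coord p z) v =
            'd (f \o point q) (coord q z) (coord_change p q z v).
Proof.
have H p' q' : dom p' z -> dom q' z ->
    differentiable (f \o point p') (coord p' z) ->
    differentiable (f \o point q') (coord q' z).
  move=> pz qz df; have dt := trans_differentiable qz pz.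
  have dc : differentiable (fun y => (f \o point p') (coord p' (point q' y)))
      (coord q' z).
    by apply: (differentiable_chain dt); rewrite coordK.
  apply: near_eq_differentiable dc.
  near=> y; rewrite /= coordK//.
  by near: y; apply: (near_point qz); exact: dom_nbhs.
move=> pz qz df; have dfq := H _ _ pz qz df; split=> // v.
have dt := trans_differentiable pz qz.
have tE : coord q (point p (coord p z)) = coord q z by rewrite coordK.
have dfq' : differentiable (f \o point q) (coord q (point p (coord p z))).
  by rewrite tE.
have := diff_chain v dt dfq'; rewrite [in RHS]tE; apply: etrans.
apply: near_eq_diff; last exact: (differentiable_chain dt dfq').
near=> y; rewrite /= coordK//.
by near: y; apply: (near_point pz); exact: dom_nbhs.
Unshelve. all: by end_near. Qed.

Lemma coord_change_comp p q r z v : dom p z -> dom q z -> dom r z ->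
  coord_change q r z (coord_change p q z v) = coord_change p r z v.
Proof.
move=> pz qz rz; have [_ E] := @differentiable_chart _ (coord r) p q z pz qz
  (trans_differentiable pz rz).
exact/esym/E.
Qed.

Lemma coord_change_id p z v : dom p z -> coord_change p p z v = v.
Proof.
move=> pz; transitivity ('d (fun y : 'rV[R]_m => y) (coord p z) v).
  apply: near_eq_diff => //.
  by apply: filterS (near_coord_dom pz) => y [_ E]; rewrite /= E.
by rewrite diff_val.
Qed.

Lemma vloc_self p (X : vfield M) : vloc p X (coord p p) = X p.
Proof. by rewrite /vloc coordK// coord_change_id. Qed.

Lemma vlocK p z (X : vfield M) : dom p z ->
  coord_change p z z (vloc p X (coord p z)) = X z.
Proof.
by move=> pz; rewrite /vloc coordK// coord_change_comp// coord_change_id.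
Qed.

Definition smooth_at (W : normedModType R) (f : M -> W) p :=
  smooth_near (f \o point p) (coord p p).

Lemma smooth_at_near (W : normedModType R) (f : M -> W) p : smooth_at f p ->
  \forall y \near coord p p,
    [/\ dom p (point p y), coord p (point p y) = y & smooth_near (f \o point p) y].
Proof.
move=> sf; near=> y; have [? ?] : dom p (point p y) /\ coord p (point p y) = y.
  by near: y; exact: near_coord_dom.
split=> //; near: y; exact: (smooth_near_near sf).
Unshelve. all: by end_near. Qed.

Lemma near_chart p : \forall y \near coord p p,
  dom p (point p y) /\ coord p (point p y) = y.
Proof. exact: near_coord_dom. Qed.

Lemma dfun_chart (f : M -> R) p z v : dom p z ->
  differentiable (f \o point p) (coord p z) ->
  dfun f z v = 'd (f \o point p) (coord p z) (coord_change z p z v).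
Proof.
move=> pz df; have [df' E] := differentiable_chart pz (dom_self z) df.
rewrite E (coord_change_comp v (dom_self z) pz (dom_self z)).
by rewrite (coord_change_id v (dom_self z)).
Qed.

(** The left side uses at each point the chart chosen for that point, a choice that need not be
    continuous. The right side, in the fixed chart at [p], can be differentiated again. *)
Lemma dfun_vfield (f : M -> R) p (X : vfield M) : smooth_at f p ->
  \forall y \near coord p p,
    dfun f (point p y) (X (point p y)) = 'd (f \o point p) y (vloc p X y).
Proof.
move=> sf; near=> y.
have [py cy sfy] : [/\ dom p (point p y), coord p (point p y) = y &
  smooth_near (f \o point p) y] by near: y; exact: smooth_at_near.
rewrite (dfun_chart _ py) ?cy//; exact: smooth_near_differentiable.
Unshelve. all: by end_near. Qed.

Lemma smooth_at_differentiable (W : normedModType R) (f : M -> W) p :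
  smooth_at f p -> differentiable (f \o point p) (coord p p).
Proof. exact: smooth_near_differentiable. Qed.

Lemma smooth_at_dfun (f : M -> R) p (X : vfield M) :
  smooth_at f p -> smooth_vfield X -> smooth_at (fun z => dfun f z (X z)) p.
Proof.
move=> sf sX; apply: (@smooth_near_eq _ _ _
   (fun y => 'd (f \o point p) y (vloc p X y))).
  by apply: filterS (dfun_vfield X sf) => y Ey; exact/esym/Ey.
apply: (@smooth_near_eq _ _ _ (fun y => \sum_i vloc p X y 0 i *:
    ('d (f \o point p) y (delta_mx 0 i) : R))).
  apply: filterE => y.
  rewrite [in RHS](rowvec_expand (vloc p X y))//.
  by move=> a u v; rewrite linearP.
apply: smooth_near_bigsum => i; apply: smooth_near_mul.
  by have /smooth_near_mxP := sX p; exact.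
exact: smooth_near_diff.
Qed.

(** The second order terms of the two iterated derivatives are the second differential of [f] with
    its arguments in the two orders, hence cancel. *)
Lemma dfun_bracket (f : M -> R) p (X Y : vfield M) :
  smooth_at f p -> smooth_vfield X -> smooth_vfield Y ->
  dfun f p (bracket X Y p) =
  dfun (fun z => dfun f z (Y z)) p (X p) - dfun (fun z => dfun f z (X z)) p (Y p).
Proof.
move=> sf sX sY; pose phi := f \o point p.
have H (Z W : vfield M) : smooth_vfield Z -> smooth_vfield W ->
   dfun (fun z => dfun f z (W z)) p (Z p) =
   'd phi (coord p p) ('d (vloc p W) (coord p p) (Z p)) +
   'd (fun y => 'd phi y (W p)) (coord p p) (Z p).
  move=> sZ sW; rewrite {1}/dfun.
  have dphi i : differentiable (fun y => 'd phi y (delta_mx 0 i) : R) (coord p p).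
    exact/smooth_near_differentiable/smooth_near_diff.
  have lphi y : linear ('d phi y) by move=> a u v; rewrite linearP.
  have dW : differentiable (vloc p W) (coord p p).
    exact/smooth_near_differentiable/sW.
  have [df E] := diff_linear_field lphi dW dphi.
  have := E (Z p); rewrite (vloc_self p W); apply: etrans.
  apply: near_eq_diff _ df.
  by apply: filterS (dfun_vfield W sf) => y Ey; exact/esym/Ey.
have cancel (a b c c' : R) : c = c' -> a - b = (a + c) - (b + c').
  by move=> ->; rewrite opprD addrACA subrr addr0.
rewrite (H X Y sX sY) (H Y X sY sX).
transitivity ('d phi (coord p p) ('d (vloc p Y) (coord p p) (X p)) -
   'd phi (coord p p) ('d (vloc p X) (coord p p) (Y p))); first exact: linearB.
exact/cancel/schwarz_real.
Qed.

End Charts.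
#[export] Hint Resolve dom_self : core.

Opaque diff.

Section Fields.
Variables (R : realType) (m : nat) (M : manifold R m).
Implicit Types (p q r z : M) (u v : 'rV[R]_m) (f g : M -> R) (X Y : vfield M).

Lemma smooth_at_cst (c : R) p : smooth_at (fun=> c) p.
Proof. exact: smooth_near_cst. Qed.

Lemma smooth_at_add f g p :
  smooth_at f p -> smooth_at g p -> smooth_at (fun z => f z + g z) p.
Proof. exact: smooth_near_add. Qed.

Lemma smooth_at_mul f g p :
  smooth_at f p -> smooth_at g p -> smooth_at (fun z => f z * g z) p.
Proof. exact: smooth_near_mul. Qed.

Lemma smooth_at_inv f p :
  smooth_at f p -> f p != 0 -> smooth_at (fun z => (f z)^-1) p.
Proof. by move=> sf fp; apply: smooth_near_inv => //=; rewrite coordK. Qed.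

Lemma smooth_at_sum (I : Type) (r : seq I) (f : I -> M -> R) p :
  (forall i, smooth_at (f i) p) -> smooth_at (fun z => \sum_(i <- r) f i z) p.
Proof. exact: smooth_near_bigsum. Qed.

Lemma smooth_at_prod (I : Type) (r : seq I) (f : I -> M -> R) p :
  (forall i, smooth_at (f i) p) -> smooth_at (fun z => \prod_(i <- r) f i z) p.
Proof. exact: smooth_near_bigprod. Qed.

Lemma smooth_at_det k (A : M -> 'M[R]_k) p :
  (forall i j, smooth_at (fun z => A z i j) p) -> smooth_at (fun z => \det (A z)) p.
Proof.
move=> sA; apply: smooth_at_sum => s; apply: smooth_at_mul.
  exact: smooth_at_cst.
by apply: smooth_at_prod => i; exact: sA.
Qed.

(** Entries of the adjugate are polynomials in those of [A], so smoothness requires no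
    invertibility; this is what makes the global coefficients [ccoef] smooth. *)
Lemma smooth_at_mul_adj k (b : M -> 'rV[R]_k) (A : M -> 'M[R]_k) p j :
  (forall i, smooth_at (fun z => b z 0 i) p) ->
  (forall i j, smooth_at (fun z => A z i j) p) ->
  smooth_at (fun z => (b z *m \adj (A z)) 0 j) p.
Proof.
move=> sb sA; under eq_fun do rewrite mxE.
apply: smooth_at_sum => i; apply: smooth_at_mul => //.
under eq_fun do rewrite mxE; apply: smooth_at_mul; first exact: smooth_at_cst.
apply: smooth_at_det => a c.
by under eq_fun do rewrite !mxE; exact: sA.
Qed.

Lemma smooth_at_eq f g p : (\forall z \near p, f z = g z) ->
  smooth_at f p -> smooth_at g p.
Proof. by move=> /(near_point (dom_self p)) fg; exact: smooth_near_eq. Qed.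

Lemma smooth_at_neq0 f p : smooth_at f p -> f p != 0 ->
  \forall z \near p, f z != 0.
Proof.
move=> sf fp0; have c := differentiable_continuous (smooth_at_differentiable sf).
have : \forall y \near coord p p, f (point p y) != 0.
  apply: (c [set x : R | x != 0]); rewrite /= coordK//.
  by apply: open_nbhs_nbhs; split=> //; exact: open_neq.
move=> /(near_coord (dom_self p)) H.
near=> z; have <- : point p (coord p z) = z.
  by apply: coordK; near: z; exact: dom_nbhs.
by near: z.
Unshelve. all: by end_near. Qed.

Lemma dfun_eq f g p v : (\forall z \near p, f z = g z) -> smooth_at f p ->
  dfun g p v = dfun f p v.
Proof.
move=> /(near_point (dom_self p)) fg /smooth_near_differentiable.
exact: near_eq_diff.
Qed.

Lemma dfun_cst (c : R) p v : dfun (fun=> c) p v = 0.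
Proof. by rewrite /dfun (_ : _ \o _ = cst c)// diff_cst. Qed.

Lemma dfun_add f g p v : smooth_at f p -> smooth_at g p ->
  dfun (fun z => f z + g z) p v = dfun f p v + dfun g p v.
Proof. by move=> *; apply: diff_add; exact: smooth_at_differentiable. Qed.

Lemma dfun_sum k (f : 'I_k -> M -> R) p v : (forall i, smooth_at (f i) p) ->
  dfun (fun z => \sum_(i < k) f i z) p v = \sum_(i < k) dfun (f i) p v.
Proof.
move=> sf; apply: (@diff_bigsum _ _ _ _ (fun i => f i \o point p)) => i.
exact: smooth_at_differentiable.
Qed.

Lemma dfun_mul f g p v : smooth_at f p -> smooth_at g p ->
  dfun (fun z => f z * g z) p v = f p * dfun g p v + g p * dfun f p v.
Proof.
move=> sf sg.
have := @diff_mul _ _ (f \o point p) (g \o point p) (coord p p) v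
  (smooth_at_differentiable sf) (smooth_at_differentiable sg).
by rewrite /= coordK.
Qed.

Lemma dfun_comb f p k (a : 'I_k -> R) (u : 'I_k -> 'rV[R]_m) :
  dfun f p (\sum_i a i *: u i) = \sum_i a i * dfun f p (u i).
Proof.
by rewrite /dfun linear_sum; apply: eq_bigr => i _; rewrite linearZ.
Qed.

Lemma smooth_vfield_scale f X :
  smooth_fun f -> smooth_vfield X -> smooth_vfield (fun z => f z *: X z).
Proof.
move=> sf sX p; have := smooth_near_scale (sf p) (sX p).
by apply: smooth_near_eq; near=> y; rewrite /vloc /coord_change linearZ.
Unshelve. all: by end_near. Qed.

Lemma smooth_vfield_add X Y :
  smooth_vfield X -> smooth_vfield Y -> smooth_vfield (fun z => X z + Y z).
Proof.
move=> sX sY p; have := smooth_near_add (sX p) (sY p).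
by apply: smooth_near_eq; near=> y; rewrite /vloc /coord_change linearD.
Unshelve. all: by end_near. Qed.

Lemma smooth_vfield0 : @smooth_vfield R m M (fun=> 0).
Proof.
move=> p; have := @smooth_near_cst _ 'rV[R]_m 'rV[R]_m 0 (coord p p).
by apply: smooth_near_eq; near=> y; rewrite /vloc /coord_change linear0.
Unshelve. all: by end_near. Qed.

Lemma smooth_vfield_sum k (X : 'I_k -> vfield M) :
  (forall i, smooth_vfield (X i)) -> smooth_vfield (fun z => \sum_(i < k) X i z).
Proof.
elim: k X => [|k ih] X sX.
  by under eq_fun do rewrite big_ord0; exact: smooth_vfield0.
under eq_fun do rewrite big_ord_recl.
by apply: smooth_vfield_add => //; apply: ih => i.
Qed.

Lemma smooth_vfield_opp X : smooth_vfield X -> smooth_vfield (fun z => - X z).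
Proof.
move=> sX; under eq_fun do rewrite -scaleN1r.
by apply: smooth_vfield_scale => // p; exact: smooth_at_cst.
Qed.

Lemma vloc_differentiable X p : smooth_vfield X ->
  differentiable (vloc p X) (coord p p).
Proof. by move=> sX; exact/smooth_near_differentiable/sX. Qed.

Lemma bracket_anti X Y p : bracket X Y p = - bracket Y X p.
Proof. by rewrite /bracket opprB. Qed.

Lemma bracket_add X Y Z p :
  smooth_vfield Y -> smooth_vfield Z ->
  bracket X (fun z => Y z + Z z) p = bracket X Y p + bracket X Z p.
Proof.
move=> sY sZ; rewrite /bracket.
have -> : vloc p (fun z => Y z + Z z) = fun y => vloc p Y y + vloc p Z y.
  by apply/funext => y; rewrite /vloc /coord_change linearD.
rewrite [X in X - _ = _](diff_add _ (vloc_differentiable p sY)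
  (vloc_differentiable p sZ)).
by rewrite [X in _ - X = _]linearD opprD addrACA.
Qed.

Lemma bracket_scale f X Y p : smooth_fun f -> smooth_vfield Y ->
  bracket X (fun z => f z *: Y z) p =
  f p *: bracket X Y p + dfun f p (X p) *: Y p.
Proof.
move=> sf sY; rewrite /bracket.
have -> : vloc p (fun z => f z *: Y z) = fun y => (f \o point p) y *: vloc p Y y.
  by apply/funext => y; rewrite /vloc /coord_change linearZ.
rewrite [X in X - _ = _](diff_scale _ (smooth_at_differentiable (sf p))
  (vloc_differentiable p sY)).
by rewrite [X in _ - X = _]linearZ/= coordK// vloc_self scalerBr addrAC.
Qed.

Lemma bracket_opp X Y p : smooth_vfield Y ->
  bracket X (fun z => - Y z) p = - bracket X Y p.
Proof.
move=> sY; under eq_fun do rewrite -scaleN1r.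
rewrite (@bracket_scale (fun=> -1))//; last by move=> q; exact: smooth_at_cst.
by rewrite dfun_cst scale0r addr0 scaleN1r.
Qed.

Lemma vloc_point p y X : dom p (point p y) -> coord p (point p y) = y ->
  coord_change p (point p y) (point p y) (vloc p X y) = X (point p y).
Proof. by move=> py cy; have := vlocK X py; rewrite cy. Qed.

Section Tensors.
Variables (w : form2 M) (J : tensor11 M).
Hypotheses (lJ : forall z, linear (J z)) (sJ : smooth_tensor11 J).
Hypotheses (lw : forall z u, scalar (w z u)) (aw : forall z u v, w z u v = - w z v u).
Hypothesis sw : smooth_form2 w.

(** Reading the tensors in the single chart at [p] turns them into families of multilinear maps on a
    fixed space, the form to which the product rules apply. *)
Definition locJ p y v :=
  coord_change (point p y) p (point p y)
    (J (point p y) (coord_change p (point p y) (point p y) v)).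

Definition locw p y u v :=
  w (point p y) (coord_change p (point p y) (point p y) u)
    (coord_change p (point p y) (point p y) v).

Lemma locJ_linear p y : linear (locJ p y).
Proof. by move=> a u v; rewrite /locJ !coord_change_linear lJ coord_change_linear. Qed.

Lemma locw_linear p y u : scalar (locw p y u).
Proof. by move=> a v v'; rewrite /locw !coord_change_linear lw. Qed.

Lemma locw_anti p y u v : locw p y u v = - locw p y v u.
Proof. exact: aw. Qed.

Lemma locJ_smooth p v : smooth_near (fun y => locJ p y v) (coord p p).
Proof. exact: sJ. Qed.

Lemma locw_smooth p u v : smooth_near (fun y => locw p y u v) (coord p p).
Proof. exact: sw. Qed.

Lemma vloc_app11 p X : \forall y \near coord p p,
  vloc p (app11 J X) y = locJ p y (vloc p X y).
Proof.
apply: filterS (near_chart p) => y [py cy].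
by rewrite /locJ vloc_point.
Qed.

Lemma app2_loc p X Y : \forall y \near coord p p,
  app2 w X Y (point p y) = locw p y (vloc p X y) (vloc p Y y).
Proof.
apply: filterS (near_chart p) => y [py cy].
by rewrite /app2 /locw !vloc_point.
Qed.

Lemma smooth_vfield_app11 X : smooth_vfield X -> smooth_vfield (app11 J X).
Proof.
move=> sX p; apply: (@smooth_near_eq _ _ _ (fun y => \sum_i vloc p X y 0 i *:
    locJ p y (delta_mx 0 i))).
  apply: filterS (vloc_app11 p X) => y ->.
  exact/esym/(rowvec_expand _ (locJ_linear p y)).
apply: smooth_near_bigsum => i; apply: smooth_near_scale.
  by have /smooth_near_mxP := sX p; exact.
exact: locJ_smooth.
Qed.

Lemma smooth_fun_app2 X Y : smooth_vfield X -> smooth_vfield Y ->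
  smooth_fun (app2 w X Y).
Proof.
move=> sX sY p; apply: (@smooth_near_eq _ _ _ (fun y =>
  \sum_i \sum_j vloc p X y 0 i * vloc p Y y 0 j *
    locw p y (delta_mx 0 i) (delta_mx 0 j))).
  apply: filterS (app2_loc p X Y) => y E; rewrite /= E.
  rewrite (rowvec_expand _ (@locw_linear p y _)).
  rewrite exchange_big; apply: eq_bigr => j _ /=.
  rewrite locw_anti (rowvec_expand _ (@locw_linear p y _)).
  rewrite -sumrN scaler_sumr; apply: eq_bigr => i _.
  by rewrite [in RHS]locw_anti /GRing.scale /=; ring.
have cX i : smooth_near (fun y => vloc p X y 0 i) (coord p p).
  by have /smooth_near_mxP := sX p; exact.
have cY i : smooth_near (fun y => vloc p Y y 0 i) (coord p p).
  by have /smooth_near_mxP := sY p; exact.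
apply: smooth_near_bigsum => i; apply: smooth_near_bigsum => j.
by apply: smooth_near_mul; [exact: smooth_near_mul|exact: locw_smooth].
Qed.

End Tensors.
End Fields.

(** * Frames, and the expansion of derivations in a frame *)

Section Frame.
Variables (R : realType) (m : nat) (M : manifold R m).
Implicit Types (z : M) (u v : 'rV[R]_m) (f : M -> R) (W : vfield M).
Variable g : form2 M.
Hypotheses (lg : forall z u, scalar (g z u)) (gC : forall z u v, g z u v = g z v u).
Hypothesis gpos : forall z u, u != 0 -> 0 < g z u u.
Hypothesis sg : forall U V : vfield M,
  smooth_vfield U -> smooth_vfield V -> smooth_fun (app2 g U V).
Variable E : 'I_m -> vfield M.
Hypothesis sE : forall i, smooth_vfield (E i).

Definition Emat z : 'M[R]_m := \matrix_i E i z.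
Definition gram z : 'M[R]_m := \matrix_(i, j) g z (E i z) (E j z).
Definition gramdet z : R := \det (gram z).
(* The coefficients of W z in the frame E; junk unless gramdet z != 0. *)
Definition cf W z : 'rV[R]_m := W z *m invmx (Emat z).
(* gramdet W = \sum_i ccoef W i E_i holds on all of M, with smooth coefficients;
   this replaces cutting off local coefficients by bump functions. *)
Definition ccoef W z : 'rV[R]_m :=
  (\row_j g z (W z) (E j z)) *m \adj (gram z).

Lemma g0r z u : g z u 0 = 0.
Proof. by have := lg z u (-1) 0 0; rewrite scaler0 addr0 mulN1r addNr. Qed.

Lemma gDr z u v v' : g z u (v + v') = g z u v + g z u v'.
Proof. by have := lg z u 1 v v'; rewrite scale1r mul1r. Qed.

Lemma gZr z u a v : g z u (a *: v) = a * g z u v.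
Proof. by have := lg z u a v 0; rewrite addr0 g0r addr0. Qed.

Lemma gDl z u v v' : g z (v + v') u = g z v u + g z v' u.
Proof. by rewrite gC gDr !(gC z u). Qed.

Lemma gZl z u a v : g z (a *: v) u = a * g z v u.
Proof. by rewrite gC gZr gC. Qed.

Lemma gNr z u v : g z u (- v) = - g z u v.
Proof. by rewrite -scaleN1r gZr mulN1r. Qed.

Lemma gNl z u v : g z (- v) u = - g z v u.
Proof. by rewrite gC gNr gC. Qed.

Lemma g_sumr z u k (v : 'I_k -> 'rV[R]_m) :
  g z u (\sum_i v i) = \sum_i g z u (v i).
Proof.
by elim/big_ind2: _ => [|a b c d <- <-|//]; [exact: g0r|exact: gDr].
Qed.

Lemma g_eq0 z u : g z u u = 0 -> u = 0.
Proof. by move=> gu; apply: contrapT => /eqP/(@gpos z); rewrite gu ltxx. Qed.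

Lemma mul_Emat z (c : 'rV[R]_m) : c *m Emat z = \sum_i c 0 i *: E i z.
Proof. by rewrite mulmx_sum_row; apply: eq_bigr => i _; rewrite rowK. Qed.

Lemma g_mul_Emat z (c : 'rV[R]_m) j :
  g z (c *m Emat z) (E j z) = (c *m gram z) 0 j.
Proof.
rewrite gC mul_Emat g_sumr mxE; apply: eq_bigr => i _.
by rewrite gZr gC mxE.
Qed.

Lemma Emat_unit z : gramdet z != 0 -> Emat z \in unitmx.
Proof.
move=> d0; rewrite -row_free_unit -kermx_eq0; apply/rowV0P => c /sub_kermxP cE.
have cG : c *m gram z = 0.
  apply/rowP => j; by rewrite -g_mul_Emat cE gC g0r mxE.
have Gu : gram z \in unitmx by rewrite unitmxE unitfE.
by rewrite -[c](mulmxK Gu) cG mul0mx.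
Qed.

Lemma cfK W z : gramdet z != 0 -> cf W z *m Emat z = W z.
Proof. by move=> d0; rewrite /cf mulmxKV// Emat_unit. Qed.

(** By Cramer's rule for the Gram matrix, the difference of the two sides is orthogonal to every
    [E j z]. It also lies in their span: where the frame is a basis this is clear, and where
    [gramdet] vanishes the left side is 0. So it is orthogonal to itself, and positivity of the
    metric makes it 0. *)
Lemma ccoefE W z : gramdet z *: W z = \sum_i ccoef W z 0 i *: E i z.
Proof.
rewrite -mul_Emat; set S := ccoef W z *m Emat z.
have gS j : g z (gramdet z *: W z - S) (E j z) = 0.
  rewrite gDl gZl -scaleN1r gZl g_mul_Emat /ccoef -mulmxA mul_adj_mx.
  by rewrite mul_mx_scalar !mxE mulN1r subrr.
have [c cE] : exists c, gramdet z *: W z - S = c *m Emat z.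
  have [d0|d0] := eqVneq (gramdet z) 0.
    by exists (- ccoef W z); rewrite d0 scale0r add0r mulNmx.
  exists (gramdet z *: cf W z - ccoef W z).
  by rewrite mulmxBl -scalemxAl cfK.
apply/eqP; rewrite -subr_eq0; apply/eqP/(@g_eq0 z).
rewrite {2}cE mul_Emat g_sumr big1// => j _.
by rewrite gZr gS mulr0.
Qed.

Lemma smooth_at_gram i j p : smooth_at (fun z => gram z i j) p.
Proof. by under eq_fun do rewrite mxE; exact: sg. Qed.

Lemma smooth_gramdet : smooth_fun gramdet.
Proof. by move=> p; apply: smooth_at_det => i j; exact: smooth_at_gram. Qed.

Lemma smooth_ccoef W i : smooth_vfield W -> smooth_fun (fun z => ccoef W z 0 i).
Proof.
move=> sW p; apply: smooth_at_mul_adj => [j|a b]; last exact: smooth_at_gram.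
by under eq_fun do rewrite mxE; exact: sg.
Qed.

Lemma near_gramdet_neq0 z : gramdet z != 0 -> \forall z' \near z, gramdet z' != 0.
Proof. by apply: smooth_at_neq0; exact: smooth_gramdet. Qed.

Lemma ccoef_cf W z : gramdet z != 0 -> ccoef W z = gramdet z *: cf W z.
Proof.
move=> d0; have Eu := Emat_unit d0; apply: (can_inj (mulmxK Eu)).
by rewrite -scalemxAl cfK// mul_Emat -ccoefE.
Qed.

Lemma smooth_cf W i z : smooth_vfield W -> gramdet z != 0 ->
  smooth_at (fun z => cf W z 0 i) z.
Proof.
move=> sW d0.
apply: (@smooth_at_eq _ _ _ (fun z => (gramdet z)^-1 * ccoef W z 0 i)).
  apply: filterS (near_gramdet_neq0 d0) => z' d'.
  by rewrite ccoef_cf// mxE mulKf.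
apply: smooth_at_mul; last exact: smooth_ccoef.
by apply: smooth_at_inv => //; exact: smooth_gramdet.
Qed.

(* T is either tensorial at z (v = 0) or a derivation along v. *)
Lemma frame_derivation z v (T : vfield M -> 'rV[R]_m) W :
  (forall U V, smooth_vfield U -> smooth_vfield V ->
     T (fun z => U z + V z) = T U + T V) ->
  (forall f U, smooth_fun f -> smooth_vfield U ->
     T (fun z => f z *: U z) = f z *: T U + dfun f z v *: U z) ->
  gramdet z != 0 -> smooth_vfield W ->
  T W = \sum_i (cf W z 0 i *: T (E i) + dfun (fun z => cf W z 0 i) z v *: E i z).
Proof.
move=> TD TZ d0 sW.
have T0 : T (fun=> 0) = 0.
  have := TD _ _ (@smooth_vfield0 _ _ M) (@smooth_vfield0 _ _ M).
  under eq_fun do rewrite addr0.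
  by move/eqP; rewrite -subr_eq0 opprD addNKr oppr_eq0 => /eqP.
have TS k (U : 'I_k -> vfield M) : (forall i, smooth_vfield (U i)) ->
    T (fun z => \sum_(i < k) U i z) = \sum_(i < k) T (U i).
  elim: k U => [|k ih] U sU.
    by rewrite big_ord0 -[RHS]T0; congr T; apply/funext => z'; rewrite big_ord0.
  rewrite big_ord_recl; under eq_fun do rewrite big_ord_recl.
  rewrite (TD _ _ (sU ord0) (smooth_vfield_sum (fun i => sU (lift ord0 i)))).
  by rewrite (ih _ (fun i => sU (lift ord0 i))).
(* [T] is evaluated on [gramdet *: W] in two ways: by the Leibniz rule, and through the global
   expansion with coefficients [ccoef]. *)
have := TZ _ _ smooth_gramdet sW.
have -> : (fun z => gramdet z *: W z) = fun z => \sum_i ccoef W z 0 i *: E i z.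
  by apply/funext => z'; rewrite ccoefE.
rewrite TS; last first.
  by move=> i; apply: smooth_vfield_scale => //; exact: smooth_ccoef.
move=> H; apply: (scalerI d0); apply/eqP.
rewrite -(inj_eq (addIr (dfun gramdet z v *: W z))) -{}H; apply/eqP.
rewrite scaler_sumr -(cfK W d0) mul_Emat scaler_sumr -big_split.
apply: eq_bigr => i _ /=; rewrite TZ//; last exact: smooth_ccoef.
(* Near [z] one has [ccoef = gramdet *: cf], so the derivative of [gramdet] produces the same extra
   term on both sides. *)
have -> : dfun (fun z => ccoef W z 0 i) z v =
    gramdet z * dfun (fun z => cf W z 0 i) z v + cf W z 0 i * dfun gramdet z v.
  rewrite -dfun_mul; [|exact: smooth_gramdet|exact: smooth_cf].
  apply/esym/dfun_eq; last exact: smooth_ccoef.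
  by apply: filterS (near_gramdet_neq0 d0) => z' d'; rewrite ccoef_cf// mxE.
rewrite ccoef_cf// mxE scalerDr !scalerA scalerDl addrA.
by rewrite [dfun gramdet z v * _]mulrC.
Qed.

Lemma frame_tensorial z (T : vfield M -> 'rV[R]_m) W :
  (forall U V, smooth_vfield U -> smooth_vfield V ->
     T (fun z => U z + V z) = T U + T V) ->
  (forall f U, smooth_fun f -> smooth_vfield U ->
     T (fun z => f z *: U z) = f z *: T U) ->
  gramdet z != 0 -> smooth_vfield W ->
  T W = \sum_i cf W z 0 i *: T (E i).
Proof.
move=> TD TZ d0 sW; rewrite (@frame_derivation z 0 T W)//.
  by apply: eq_bigr => i _; rewrite /dfun linear0 scale0r addr0.
by move=> f U sf sU; rewrite TZ// /dfun linear0 scale0r addr0.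
Qed.

End Frame.

Opaque dfun.

(** * Group actions and fundamental fields *)

Section RowMx.
Variables (R : realType) (V : normedModType R) (n1 n2 : nat).

Lemma is_diff_row_mx (f : V -> 'rV[R]_n1) (g : V -> 'rV[R]_n2) y :
  differentiable f y -> differentiable g y ->
  differentiable (fun z => row_mx (f z) (g z)) y /\
  forall v, 'd (fun z => row_mx (f z) (g z)) y v = row_mx ('d f y v) ('d g y v).
Proof.
move=> df dg.
pose L1 (u : 'rV[R]_n1) := u *m row_mx 1%:M 0 : 'rV[R]_(n1 + n2).
pose L2 (u : 'rV[R]_n2) := u *m row_mx 0 1%:M : 'rV[R]_(n1 + n2).
have l1 : linear L1 by move=> a u v; rewrite /L1 mulmxDl scalemxAl.
have l2 : linear L2 by move=> a u v; rewrite /L2 mulmxDl scalemxAl.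
have LE u v : row_mx u v = L1 u + L2 v.
  by rewrite /L1 /L2 !mul_mx_row !mulmx1 !mulmx0 add_row_mx addr0 add0r.
have [d1 E1] := rowvec_linear_diff (f y) l1.
have [d2 E2] := rowvec_linear_diff (g y) l2.
have d1f := differentiable_chain df d1; have d2g := differentiable_chain dg d2.
have -> : (fun z => row_mx (f z) (g z)) = fun z => L1 (f z) + L2 (g z).
  by apply/funext => z.
split=> [|v]; first exact: (differentiableD d1f d2g).
apply: (etrans (diff_add v d1f d2g)); rewrite LE; congr (_ + _).
  exact: (etrans (diff_chain v df d1) (E1 _)).
exact: (etrans (diff_chain v dg d2) (E2 _)).
Qed.

End RowMx.

Section Partial.
Variables (R : realType) (n1 n2 : nat).
Implicit Types (u a : 'rV[R]_n1) (v y : 'rV[R]_n2).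

Lemma differentiable_var (V : normedModType R) (x : V) :
  differentiable (fun z : V => z) x.
Proof. by []. Qed.

Lemma diff_idE (V : normedModType R) (x v : V) : 'd (fun z : V => z) x v = v.
Proof. by rewrite diff_val. Qed.

Lemma is_diff_row_mxl y a :
  differentiable (fun a => row_mx a y) a /\
  forall u, 'd (fun a => row_mx a y) a u = row_mx u 0.
Proof.
have [d E] := is_diff_row_mx (differentiable_var a) (differentiable_cst y a).
by split=> // u; rewrite E diff_idE diff_cst.
Qed.

Lemma is_diff_row_mxr a y :
  differentiable (fun y => row_mx a y) y /\
  forall v, 'd (fun y => row_mx a y) y v = row_mx 0 v.
Proof.
have [d E] := is_diff_row_mx (differentiable_cst a y) (differentiable_var y).
by split=> // v; rewrite E diff_idE diff_cst.
Qed.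

Variables (W : normedModType R) (f : 'rV[R]_(n1 + n2) -> W).

Lemma diff_partial1 a y u : differentiable f (row_mx a y) ->
  'd (fun a => f (row_mx a y)) a u = 'd f (row_mx a y) (row_mx u 0).
Proof.
move=> df; have [d E] := is_diff_row_mxl y a.
by apply: (etrans (diff_chain u d df)); rewrite E.
Qed.

Lemma diff_partial2 a y v : differentiable f (row_mx a y) ->
  'd (fun y => f (row_mx a y)) y v = 'd f (row_mx a y) (row_mx 0 v).
Proof.
move=> df; have [d E] := is_diff_row_mxr a y.
by apply: (etrans (diff_chain v d df)); rewrite E.
Qed.

Lemma smooth_near_partial1 a y : smooth_near f (row_mx a y) ->
  smooth_near (fun a => f (row_mx a y)) a.
Proof.
apply: (smooth_near_affine (h := fun a => row_mx a y) (L := fun u => row_mx u 0)).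
by move=> a'; exact: is_diff_row_mxl.
Qed.

Lemma smooth_near_partial2 a y : smooth_near f (row_mx a y) ->
  smooth_near (fun y => f (row_mx a y)) y.
Proof.
apply: (smooth_near_affine (h := fun y => row_mx a y) (L := fun v => row_mx 0 v)).
by move=> y'; exact: is_diff_row_mxr.
Qed.

Lemma near_row_mxl (P : 'rV[R]_(n1 + n2) -> Prop) a y :
  (\forall h \near row_mx a y, P h) -> \forall a' \near a, P (row_mx a' y).
Proof.
have [d _] := is_diff_row_mxl y a.
by move=> nP; exact: (differentiable_continuous d).
Qed.

Lemma near_row_mxr (P : 'rV[R]_(n1 + n2) -> Prop) a y :
  (\forall h \near row_mx a y, P h) -> \forall y' \near y, P (row_mx a y').
Proof.
have [d _] := is_diff_row_mxr a y.
by move=> nP; exact: (differentiable_continuous d).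
Qed.

Lemma diff_row_split a y u v :
  'd f (row_mx a y) (row_mx u v) =
  'd f (row_mx a y) (row_mx u 0) + 'd f (row_mx a y) (row_mx 0 v).
Proof. by rewrite -linearD add_row_mx addr0 add0r. Qed.

End Partial.

Section GroupBasics.
Variables (R : realType) (N : nat) (G : lieGroup R N).
Local Notation one := (gone G).

Lemma gmulgV (g : G) : gmul g (ginv g) = one.
Proof.
rewrite -[LHS]gmul1 -{1}(gmulV (ginv g)) -gmulA [X in gmul _ X]gmulA gmulV.
by rewrite gmul1 gmulV.
Qed.

Lemma gmulg1 (g : G) : gmul g one = g.
Proof. by rewrite -(gmulV g) gmulA gmulgV gmul1. Qed.

Lemma ginv1 : ginv one = one.
Proof. by rewrite -[LHS]gmulg1 gmulV. Qed.

Lemma gmul_action : smooth_action (@gmul R N G).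
Proof.
split; [exact: gmul1|by move=> g h z; rewrite gmulA|exact: gmul_smooth].
Qed.

Variable e : 'rV[R]_N -> G.
Hypothesis e_exp : is_exp e.

Lemma exp0 : e 0 = one.
Proof.
have [_ /(_ 0 0) E _] := e_exp 0.
rewrite !scaler0 in E.
by rewrite -(gmulV (e 0)) {3}E gmulA gmulV gmul1.
Qed.

End GroupBasics.

(** * The action and its fundamental fields in charts *)

Section ActionChart.
Variables (R : realType) (N m : nat) (G : lieGroup R N) (M : manifold R m).
Variable act : G -> M -> M.
Hypothesis act_smooth : smooth_action act.
Local Notation one := (gone G).
Local Notation o := (coord (gone G) (gone G)).
Implicit Types (p z : M) (g : G) (a b u : 'rV[R]_N) (y v : 'rV[R]_m).

Lemma act1 z : act one z = z. Proof. by case: act_smooth. Qed.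
Lemma actM g h z : act (gmul g h) z = act g (act h z). Proof. by case: act_smooth. Qed.
Lemma act_smooth2 : smooth_map2 act. Proof. by case: act_smooth. Qed.

(** The chart at [p] serves both source and target, since the identity element fixes [p]; the first
    block holds the coordinates of the group element. *)
Definition act_loc p (h : 'rV[R]_(N + m)) : 'rV[R]_m :=
  coord p (act (point one (lsubmx h)) (point p (rsubmx h))).

Lemma act_loc_row p a y :
  act_loc p (row_mx a y) = coord p (act (point one a) (point p y)).
Proof. by rewrite /act_loc row_mxKl row_mxKr. Qed.

Lemma point_o : point one o = one. Proof. exact: coordK (dom_self _). Qed.

Lemma act_loc_smooth p : smooth_near (act_loc p) (row_mx o (coord p p)).
Proof. by have [_ /(_ one p)] := act_smooth2; rewrite act1. Qed.

Lemma near_act p (A : set M) : nbhs p A ->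
  \forall h \near row_mx o (coord p p),
    A (act (point one (lsubmx h)) (point p (rsubmx h))).
Proof.
move=> pA; have [c _] := act_smooth2.
have cl : {for row_mx o (coord p p), continuous (fun h : 'rV[R]_(N + m) => lsubmx h)}.
  exact/differentiable_continuous/differentiable_lsubmx.
have cr : {for row_mx o (coord p p), continuous (fun h : 'rV[R]_(N + m) => rsubmx h)}.
  exact/differentiable_continuous/differentiable_rsubmx.
have c1 : (point one (lsubmx h)) @[h --> row_mx o (coord p p)] --> one.
  move=> B /(near_point (dom_self one)) nB; apply: (cl [set a | B (point one a)]).
  by rewrite /= row_mxKl.
have c2 : (point p (rsubmx h)) @[h --> row_mx o (coord p p)] --> p.
  move=> B /(near_point (dom_self p)) nB; apply: (cr [set y | B (point p y)]).
  by rewrite /= row_mxKr.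
have pA1 : nbhs (act one p) A by rewrite act1.
have [[A1 A2] [/= n1 n2] sA] := c (one, p) A pA1.
have m1 : \forall h \near row_mx o (coord p p), A1 (point one (lsubmx h)).
  exact: c1.
have m2 : \forall h \near row_mx o (coord p p), A2 (point p (rsubmx h)).
  exact: c2.
apply: filterS (filterI m1 m2) => h [h1 h2].
by apply: (sA (point one (lsubmx h), point p (rsubmx h))); split.
Qed.

Lemma near_act_loc p : \forall h \near row_mx o (coord p p),
  [/\ smooth_near (act_loc p) h,
      dom one (point one (lsubmx h)) /\ coord one (point one (lsubmx h)) = lsubmx h,
      dom p (point p (rsubmx h)) /\ coord p (point p (rsubmx h)) = rsubmx h &
      dom p (act (point one (lsubmx h)) (point p (rsubmx h)))].
Proof.
near=> h; split.
- by near: h; exact: (smooth_near_near (act_loc_smooth p)).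
- near: h.
  have cl : {for row_mx o (coord p p), continuous (fun h : 'rV[R]_(N + m) => lsubmx h)}.
    exact/differentiable_continuous/differentiable_lsubmx.
  apply: (cl [set a | dom one (point one a) /\ coord one (point one a) = a]).
  by rewrite /= row_mxKl; exact: near_chart.
- near: h.
  have cr : {for row_mx o (coord p p), continuous (fun h : 'rV[R]_(N + m) => rsubmx h)}.
    exact/differentiable_continuous/differentiable_rsubmx.
  apply: (cr [set y | dom p (point p y) /\ coord p (point p y) = y]).
  by rewrite /= row_mxKr; exact: near_chart.
- by near: h; apply: near_act; exact: dom_nbhs.
Unshelve. all: by end_near. Qed.

Lemma near_act_loc_r p : \forall y \near coord p p,
  [/\ smooth_near (act_loc p) (row_mx o y), dom p (point p y),
     coord p (point p y) = y & act_loc p (row_mx o y) = y].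
Proof.
have := near_row_mxr (near_act_loc p); apply: filterS => y.
rewrite row_mxKl row_mxKr => -[s1 _ [s2 s3] _]; split=> //.
by rewrite act_loc_row point_o act1.
Qed.

(** The fundamental field of [X] in the chart at [p], as a partial differential at the identity.
    This form makes linearity in [X] and smoothness in [y] immediate and involves no exponential. *)
Definition loc_fund p X y := 'd (act_loc p) (row_mx o y) (row_mx X 0).

Lemma loc_fund_linear p y : linear (loc_fund p ^~ y).
Proof.
move=> c X X'; rewrite /loc_fund -linearP; congr ('d _ _ _).
by rewrite scale_row_mx add_row_mx scaler0 addr0.
Qed.

Lemma loc_fund_smooth p X : smooth_near (loc_fund p X) (coord p p).
Proof.
apply: (smooth_near_partial2 (f := fun h => 'd (act_loc p) h (row_mx X 0))).
exact/smooth_near_diff/act_loc_smooth.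
Qed.

Variable e : 'rV[R]_N -> G.
Hypothesis e_exp : is_exp e.
Local Notation fund := (fund act e).

Lemma near_exp X (A : set G) : nbhs one A -> \forall t \near 0, A (e (t *: X)).
Proof.
have [[c _] _ _] := e_exp X.
by have := c 0; rewrite /continuous_at scale0r (exp0 e_exp); exact.
Qed.

Lemma coord_exp X : differentiable (fun t : R => coord one (e (t *: X))) 0 /\
  'd (fun t : R => coord one (e (t *: X))) 0 1 = X.
Proof.
have [[_ /(_ 0) s] _ v] := e_exp X; rewrite scale0r (exp0 e_exp) in s.
have d := smooth_near_differentiable s; split=> //.
by rewrite /velocity scale0r (exp0 e_exp) derive1E' in v.
Qed.

(** Chain rule for the curve [coord one (e (t *: X))], whose velocity at 0 is [X]; [tr] passes from
    the chart at [p] to the one in which [fund] is expressed. *)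
Lemma fund_loc p X : \forall y \near coord p p, vloc p (fund X) y = loc_fund p X y.
Proof.
apply: filterS (near_act_loc_r p) => y [sy py cy ay]; set z := point p y.
have [dc Ec] := coord_exp X; pose c (t : R) := coord one (e (t *: X)).
have c0 : c 0 = o by rewrite /c scale0r exp0.
have k0 : row_mx (c 0) y = row_mx o y by rewrite c0.
have [dk Ek] := is_diff_row_mx dc (differentiable_cst y 0).
have da : differentiable (act_loc p) (row_mx (c 0) y).
  by rewrite k0; exact: smooth_near_differentiable.
have dak := differentiable_chain dk da.
pose tr := coord z \o point p.
have dt : differentiable tr (act_loc p (row_mx (c 0) y)).
  by rewrite k0 ay -[y in differentiable _ y]cy; exact: trans_differentiable.
have near_curve : \forall t \near (0 : R),
    tr (act_loc p (row_mx (c t) y)) = coord z (act (e (t *: X)) z).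
  have nz : \forall g \near one, dom p (act g z).
    have nz : nbhs (act one z) (dom p) by rewrite act1; exact: dom_nbhs.
    have [cc _] := act_smooth2; have [[A1 A2] [/= n1 n2] sA] := cc (one, z) _ nz.
    by apply: filterS n1 => g A1g; apply: (sA (g, z)); split=> //; exact: nbhs_singleton.
  near=> t; have de : dom one (e (t *: X)).
    by near: t; exact: (near_exp X (dom_nbhs (dom_self one))).
  have dz : dom p (act (e (t *: X)) z) by near: t; exact: (near_exp X nz).
  by rewrite /tr /= act_loc_row /c (coordK de) (coordK dz).
have E1 : fund X z = 'd (fun t => tr (act_loc p (row_mx (c t) y))) 0 1.
  rewrite /fund /velocity scale0r (exp0 e_exp) act1 derive1E'.
    apply: near_eq_diff; first exact: near_curve.
    exact: (differentiable_chain dak dt).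
  apply: near_eq_differentiable (differentiable_chain dak dt).
  exact: near_curve.
have E2 : fund X z = coord_change p z z (loc_fund p X y).
  have E0 : 'd (cst y) (0 : R) (1 : R) = 0 by rewrite diff_cst.
  have Ek1 := etrans (Ek 1) (congr2 _ Ec E0).
  have inner := etrans (diff_chain (1 : R) dk da) (congr1 _ Ek1).
  rewrite E1; apply: (etrans (diff_chain (1 : R) dak dt)).
  by rewrite inner k0 ay /coord_change cy.
rewrite /vloc -/z E2 (coord_change_comp _ py (dom_self z) py).
exact: coord_change_id.
Unshelve. all: by end_near. Qed.

Lemma smooth_fund X : smooth_vfield (fund X).
Proof.
move=> p; apply: smooth_near_eq (loc_fund_smooth p X).
by apply: filterS (fund_loc p X) => y ->.
Qed.

Lemma fundE p X : fund X p = loc_fund p X (coord p p).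
Proof. by rewrite -(nbhs_singleton (fund_loc p X)) vloc_self. Qed.

Lemma fund_linear p : linear (fund ^~ p).
Proof. by move=> c X X'; rewrite !fundE loc_fund_linear. Qed.

Lemma diff_fund p X v : \forall y \near coord p p,
  'd (vloc p (fund X)) y v = 'd (loc_fund p X) y v.
Proof.
near=> y.
have s : smooth_near (loc_fund p X) y.
  by near: y; exact: (smooth_near_near (loc_fund_smooth p X)).
have n : \forall z \near y, vloc p (fund X) z = loc_fund p X z.
  by near: y; exact: (nbhs_interior (fund_loc p X)).
apply: near_eq_diff; last exact: smooth_near_differentiable.
by apply: filterS n => z ->.
Unshelve. all: by end_near. Qed.

End ActionChart.

Lemma near_row_mx (R : realType) (n1 n2 : nat) (Q : 'rV[R]_(n1 + n2) -> Prop)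
    (a : 'rV[R]_n1) (y : 'rV[R]_n2) :
  (\forall h \near row_mx a y, Q h) ->
  \forall a' \near a, \forall y' \near y, Q (row_mx a' y').
Proof.
move=> /nbhs_interior nQ; near=> a'; apply: near_row_mxr.
by near: a'; exact: (near_row_mxl nQ).
Unshelve. all: by end_near. Qed.

(** * The second derivative of the group multiplication *)

Section StructureConstants.
Variables (R : realType) (N : nat) (G : lieGroup R N).
Local Notation one := (gone G).
Local Notation o := (coord (gone G) (gone G)).
Implicit Types (X Y : 'rV[R]_N).

Definition mul_loc : 'rV[R]_(N + N) -> 'rV[R]_N := act_loc (@gmul R N G) one.

(* The mixed second derivative of the multiplication at (1, 1). *)
Definition mixed X Y : 'rV[R]_N :=
  'd (fun a => 'd mul_loc (row_mx a o) (row_mx 0 Y)) o X.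

Lemma mul_loc_smooth : smooth_near mul_loc (row_mx o o).
Proof. exact: (act_loc_smooth (gmul_action G)). Qed.

Lemma mul_loc_l : \forall b \near o, mul_loc (row_mx o b) = b.
Proof.
by apply: filterS (near_act_loc_r (gmul_action G) one) => b [].
Qed.

Lemma mul_loc_r : \forall a \near o, mul_loc (row_mx a o) = a.
Proof.
apply: filterS (near_chart one) => a [_ ca].
by rewrite /mul_loc act_loc_row point_o gmulg1.
Qed.

Lemma diff_mul_loc_l Y : 'd mul_loc (row_mx o o) (row_mx 0 Y) = Y.
Proof.
have dm := smooth_near_differentiable mul_loc_smooth.
rewrite -(diff_partial2 _ dm) -[RHS](diff_idE o).
by apply: near_eq_diff => //; apply: filterS mul_loc_l => b ->.
Qed.

Lemma diff_mul_loc_r X : 'd mul_loc (row_mx o o) (row_mx X 0) = X.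
Proof.
have dm := smooth_near_differentiable mul_loc_smooth.
rewrite -(diff_partial1 _ dm) -[RHS](diff_idE o).
by apply: near_eq_diff => //; apply: filterS mul_loc_r => b ->.
Qed.

Lemma diff_mul_loc2_smooth Y :
  smooth_near (fun a => 'd mul_loc (row_mx a o) (row_mx 0 Y)) o.
Proof.
apply: (smooth_near_partial1 (f := fun h => 'd mul_loc h (row_mx 0 Y))).
exact/smooth_near_diff/mul_loc_smooth.
Qed.

End StructureConstants.

Section Action.
Variables (R : realType) (N m : nat) (G : lieGroup R N) (M : manifold R m).
Variable act : G -> M -> M.
Hypothesis act_smooth : smooth_action act.
Local Notation one := (gone G).
Local Notation o := (coord (gone G) (gone G)).
Implicit Types (p z : M) (g : G) (a b u : 'rV[R]_N) (y v : 'rV[R]_m).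
Local Notation act_loc := (act_loc act).
Local Notation loc_fund := (loc_fund act).

Lemma act_loc_comp p a b y : dom one (gmul (point one a) (point one b)) ->
  dom p (act (point one b) (point p y)) ->
  act_loc p (row_mx (mul_loc G (row_mx a b)) y) =
  act_loc p (row_mx a (act_loc p (row_mx b y))).
Proof.
move=> d1 d2; rewrite !act_loc_row /mul_loc act_loc_row (coordK d1) (coordK d2).
by rewrite (actM act_smooth).
Qed.

(** Obtained from (a b) y = a (b y) by differentiating in b at the identity along [Y], with a kept
    fixed near the identity. *)
Lemma diff_act_loc_comp p y Y : (\forall h \near row_mx o y, smooth_near (act_loc p) h) ->
  (\forall b \near o, dom p (act (point one b) (point p y))) ->
  act_loc p (row_mx o y) = y ->
  \forall a \near o,
    'd (act_loc p) (row_mx a y) (row_mx ('d (mul_loc G) (row_mx a o) (row_mx 0 Y)) 0) =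
    'd (act_loc p) (row_mx a y) (row_mx 0 (loc_fund p Y y)).
Proof.
move=> sal ndom alo; near=> a.
have sa : differentiable (act_loc p) (row_mx a y).
  by apply: smooth_near_differentiable; near: a; exact: near_row_mxl.
have so : differentiable (act_loc p) (row_mx o y).
  exact/smooth_near_differentiable/(nbhs_singleton sal).
have sm : differentiable (mul_loc G) (row_mx a o).
  apply: smooth_near_differentiable; near: a; apply: near_row_mxl.
  exact/smooth_near_near/mul_loc_smooth.
have nd : \forall b \near o, dom one (gmul (point one a) (point one b)).
  near: a; have := near_row_mx (near_act_loc (gmul_action G) one).
  apply: filterS => a'; apply: filterS => b [_ _ _].
  by rewrite row_mxKl row_mxKr.
have mra : mul_loc G (row_mx a o) = a by near: a; exact: mul_loc_r.
have [dr Er] := is_diff_row_mxr a o.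
have dmu2 := differentiable_chain dr sm.
have [dk1 Ek1] := is_diff_row_mx dmu2 (differentiable_cst y o).
have [dl El] := is_diff_row_mxl y o.
have dal1 := differentiable_chain dl so.
have [dk2 Ek2] := is_diff_row_mx (differentiable_cst a o) dal1.
have da1 : differentiable (act_loc p) (row_mx (mul_loc G (row_mx a o)) (cst y o)).
  by rewrite mra.
have da2 : differentiable (act_loc p) (row_mx (cst a o) (act_loc p (row_mx o y))).
  by rewrite alo.
have E : 'd (fun b => act_loc p (row_mx (mul_loc G (row_mx a b)) y)) o Y =
    'd (fun b => act_loc p (row_mx a (act_loc p (row_mx b y)))) o Y.
  apply: near_eq_diff; last exact: (differentiable_chain dk2 da2).
  by near=> b; apply/esym/act_loc_comp; near: b.
have K1 : 'd (fun b => row_mx (mul_loc G (row_mx a b)) (cst y b)) o Y =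
    row_mx ('d (mul_loc G) (row_mx a o) (row_mx 0 Y)) 0.
  apply: (etrans (Ek1 Y)); congr row_mx; last by rewrite diff_cst.
  exact: diff_partial2.
have K2 : 'd (fun b => row_mx (cst a b) (act_loc p (row_mx b y))) o Y =
    row_mx 0 (loc_fund p Y y).
  apply: (etrans (Ek2 Y)); congr row_mx; first by rewrite diff_cst.
  exact: diff_partial1.
have L1 := etrans (diff_chain Y dk1 da1) (congr1 _ K1).
have L2 := etrans (diff_chain Y dk2 da2) (congr1 _ K2).
have := etrans (esym L1) (etrans E L2).
by rewrite mra alo.
Unshelve. all: by end_near. Qed.

(** Symmetry of second differentials exchanges the derivative in the group variable with the one in
    the point. *)
Lemma diff_act_loc_mixed p y X v : smooth_near (act_loc p) (row_mx o y) ->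
  'd (fun a => 'd (act_loc p) (row_mx a y) (row_mx 0 v)) o X = 'd (loc_fund p X) y v.
Proof.
move=> so.
have f2 : smooth_near (fun h => 'd (act_loc p) h (row_mx 0 v)) (row_mx o y).
  exact: smooth_near_diff.
rewrite (diff_partial1 X (smooth_near_differentiable f2)) (schwarz _ _ so).
apply/esym; apply: (diff_partial2 (f := fun h => 'd (act_loc p) h (row_mx X 0))).
exact/smooth_near_differentiable/smooth_near_diff.
Qed.

(* Both sides are the derivative at (1, y) of the second member of
   a b y = a (b y), first in b along Y and then in a along X. *)
Lemma loc_fund_bracket p X Y : \forall y \near coord p p,
  loc_fund p (mixed G X Y) y
  + 'd (fun h => 'd (act_loc p) h (row_mx Y 0)) (row_mx o y) (row_mx X 0) =
  'd (loc_fund p X) y (loc_fund p Y y).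
Proof.
near=> y.
have nal : \forall h \near row_mx o y, [/\ smooth_near (act_loc p) h,
      dom one (point one (lsubmx h)) /\ coord one (point one (lsubmx h)) = lsubmx h,
      dom p (point p (rsubmx h)) /\ coord p (point p (rsubmx h)) = rsubmx h &
      dom p (act (point one (lsubmx h)) (point p (rsubmx h)))].
  by near: y; exact: (near_row_mxr (nbhs_interior (near_act_loc act_smooth p))).
have sal : \forall h \near row_mx o y, smooth_near (act_loc p) h.
  by apply: filterS nal => h [].
have ndom : \forall b \near o, dom p (act (point one b) (point p y)).
  apply: filterS (near_row_mxl nal) => b [_ _ _].
  by rewrite row_mxKl row_mxKr.
have [_ _ _ alo] : [/\ smooth_near (act_loc p) (row_mx o y), dom p (point p y),
     coord p (point p y) = y & act_loc p (row_mx o y) = y].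
  by near: y; exact: near_act_loc_r.
have so : smooth_near (act_loc p) (row_mx o y) := nbhs_singleton sal.
have E := diff_act_loc_comp Y sal ndom alo.
pose W a : 'rV[R]_(N + m) := row_mx ('d (mul_loc G) (row_mx a o) (row_mx 0 Y)) 0.
have dW0 : differentiable (fun a => 'd (mul_loc G) (row_mx a o) (row_mx 0 Y)) o.
  exact/smooth_near_differentiable/diff_mul_loc2_smooth.
have [dW EW] := is_diff_row_mx dW0 (differentiable_cst (0 : 'rV[R]_m) o).
have [dl El] := is_diff_row_mxl y o.
have lT h : linear ('d (act_loc p) h) by move=> c u v; exact: linearP.
have dT i : differentiable (fun h => 'd (act_loc p) h (delta_mx 0 i)) (row_mx o y).
  exact/smooth_near_differentiable/smooth_near_diff.
have [dL EL] := diff_linear_family lT dl dW dT.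
have Wo : W o = row_mx Y 0 by rewrite /W diff_mul_loc_l.
have E2 := diff_act_loc_mixed X (loc_fund p Y y) so.
apply: (etrans _ (etrans (esym (near_eq_diff X E dL)) E2)).
have E0 : 'd (cst (0 : 'rV[R]_m)) o X = 0 by rewrite diff_cst.
have EWX := etrans (EW X) (congr1 (row_mx _) E0).
apply/esym; apply: (etrans (EL X)); congr (_ + _).
  exact: (congr1 _ EWX).
apply: (etrans (congr1 _ (El X))).
by rewrite (_ : row_mx _ (cst 0 o) = row_mx Y 0)//; exact: Wo.
Unshelve. all: by end_near. Qed.

(** Antisymmetrising [loc_fund_bracket] removes the second derivative of the action in two group
    directions, which is symmetric. *)
Lemma fund_bracket_loc p X Y : \forall y \near coord p p,
  'd (loc_fund p X) y (loc_fund p Y y) - 'd (loc_fund p Y) y (loc_fund p X y) =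
  loc_fund p (mixed G X Y - mixed G Y X) y.
Proof.
near=> y.
have EXY : loc_fund p (mixed G X Y) y
    + 'd (fun h => 'd (act_loc p) h (row_mx Y 0)) (row_mx o y) (row_mx X 0) =
    'd (loc_fund p X) y (loc_fund p Y y).
  by near: y; exact: loc_fund_bracket.
have EYX : loc_fund p (mixed G Y X) y
    + 'd (fun h => 'd (act_loc p) h (row_mx X 0)) (row_mx o y) (row_mx Y 0) =
    'd (loc_fund p Y) y (loc_fund p X y).
  by near: y; exact: loc_fund_bracket.
have [so _ _ _] : [/\ smooth_near (act_loc p) (row_mx o y), dom p (point p y),
     coord p (point p y) = y & act_loc p (row_mx o y) = y].
  by near: y; exact: near_act_loc_r.
have S := schwarz (row_mx X 0) (row_mx Y 0) so.
have lL : loc_fund p (mixed G X Y - mixed G Y X) y =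
    loc_fund p (mixed G X Y) y - loc_fund p (mixed G Y X) y.
  have := loc_fund_linear act p y (-1) (mixed G Y X) (mixed G X Y).
  by rewrite !scaleN1r ![- _ + _]addrC.
have alg (s t q r : 'rV[R]_m) : q = r -> (s + r) - (t + q) = s - t.
  by move=> ->; rewrite opprD addrACA subrr addr0.
apply: (etrans (congr2 (fun s t => s - t) (esym EXY) (esym EYX))).
exact: (etrans (alg _ _ _ _ S) (esym lL)).
Unshelve. all: by end_near. Qed.

(** [tmap] refers to the charts chosen for the point and for its image, which vary with both; here
    it becomes a partial differential of [act_loc] in the fixed chart at [p]. *)
Lemma tmap_loc p : \forall h \near row_mx o (coord p p), forall v,
  tmap (act (point one (lsubmx h))) (point p (rsubmx h))
    (coord_change p (point p (rsubmx h)) (point p (rsubmx h)) v) =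
  coord_change p (act (point one (lsubmx h)) (point p (rsubmx h)))
    (act (point one (lsubmx h)) (point p (rsubmx h))) ('d (act_loc p) h (row_mx 0 v)).
Proof.
near=> h => v.
have [sh _ [py cy] pgz] : [/\ smooth_near (act_loc p) h,
      dom one (point one (lsubmx h)) /\ coord one (point one (lsubmx h)) = lsubmx h,
      dom p (point p (rsubmx h)) /\ coord p (point p (rsubmx h)) = rsubmx h &
      dom p (act (point one (lsubmx h)) (point p (rsubmx h)))].
  by near: h; exact: near_act_loc.
have := sh; rewrite -{1}[h]hsubmxK.
move: (lsubmx h) (rsubmx h) py cy pgz (hsubmxK h) => a y py cy pgz hE sa.
rewrite -hE; set g := point one a; set z := point p y.
pose f (z' : M) := coord p (act g z').
have da := smooth_near_differentiable sa.
have df : differentiable (f \o point p) (coord p z).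
  rewrite cy; have [dr _] := is_diff_row_mxr a y.
  have := differentiable_chain dr da; apply: near_eq_differentiable.
  by apply: filterE => y'; rewrite act_loc_row.
have fE : 'd (f \o point p) (coord p z) v = 'd (act_loc p) (row_mx a y) (row_mx 0 v).
  rewrite cy -(diff_partial2 v da); apply: near_eq_diff; last first.
    by have [dr _] := is_diff_row_mxr a y; exact: (differentiable_chain dr da).
  by apply: filterE => y'; rewrite act_loc_row.
have [dfz Ez] := differentiable_chart py (dom_self z) df.
have fz : (f \o point z) (coord z z) = coord p (act g z) by rewrite /= coordK.
have dt : differentiable (coord (act g z) \o point p) ((f \o point z) (coord z z)).
  by rewrite fz; exact: trans_differentiable.
rewrite -fE (Ez v) /tmap.
have L := diff_chain (coord_change p z z v) dfz dt.
have cE w : 'd (coord (act g z) \o point p) ((f \o point z) (coord z z)) w =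
    coord_change p (act g z) (act g z) w.
  exact: (congr1 (fun b : 'rV[R]_m => 'd (coord (act g z) \o point p) b w) fz).
apply: (etrans _ (etrans L (cE _))).
apply: near_eq_diff; first last.
  exact: (differentiable_chain dfz dt).
have nz : nbhs z [set z' | dom p (act g z')].
  have [cc _] := act_smooth2 act_smooth.
  have [[A1 A2] [/= n1 n2] sA] := cc (g, z) _ (dom_nbhs pgz).
  by apply: filterS n2 => z' A2z; apply: (sA (g, z')); split=> //; exact: nbhs_singleton.
have nz' := near_point (dom_self z) nz.
by apply: filterS nz' => y' d'; rewrite /= /f coordK.
Unshelve. all: by end_near. Qed.

End Action.

Section VectorJacobi.
Variables (R : realType) (m : nat).
Implicit Types (F G H : 'rV[R]_m -> 'rV[R]_m) (y u : 'rV[R]_m).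

Definition bracket_loc F G y := 'd G y (F y) - 'd F y (G y).

Lemma diff_bracket_loc F G y : smooth_near F y -> smooth_near G y ->
  differentiable (bracket_loc F G) y /\
  forall u, 'd (bracket_loc F G) y u =
    ('d G y ('d F y u) + 'd (fun z => 'd G z (F y)) y u) -
    ('d F y ('d G y u) + 'd (fun z => 'd F z (G y)) y u).
Proof.
move=> sF sG.
have H (A B : 'rV[R]_m -> 'rV[R]_m) : smooth_near A y -> smooth_near B y ->
    differentiable (fun z => 'd B z (A z)) y /\ forall u,
    'd (fun z => 'd B z (A z)) y u =
    'd B y ('d A y u) + 'd (fun z => 'd B z (A y)) y u.
  move=> sA sB; apply: (diff_linear_field (T := fun z => 'd B z)).
  - by move=> z c u v; exact: linearP.
  - exact: smooth_near_differentiable.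
  by move=> i; exact/smooth_near_differentiable/smooth_near_diff.
have [d1 E1] := H F G sF sG; have [d2 E2] := H G F sG sF.
split=> [|u]; first exact: (differentiableB d1 d2).
exact: (etrans (diff_sub u d1 d2) (congr2 (fun s t => s - t) (E1 u) (E2 u))).
Qed.

(** Each of the three maps contributes its second differential with the arguments in two orders,
    which Schwarz identifies; the compositions of first differentials match formally. *)
Lemma bracket_loc_jacobi F G H y :
  smooth_near F y -> smooth_near G y -> smooth_near H y ->
  bracket_loc F (bracket_loc G H) y - bracket_loc G (bracket_loc F H) y =
  bracket_loc (bracket_loc F G) H y.
Proof.
move=> sF sG sH.
have [_ E1] := diff_bracket_loc sG sH; have [_ E2] := diff_bracket_loc sF sH.
have [_ E3] := diff_bracket_loc sF sG.
have SF := schwarz (G y) (H y) sF; have SG := schwarz (F y) (H y) sG.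
have SH := schwarz (F y) (G y) sH.
have lB A u v : 'd A y (u - v) = 'd A y u - 'd A y v by exact: linearB.
have -> : bracket_loc F (bracket_loc G H) y = 'd (bracket_loc G H) y (F y)
   - ('d F y ('d H y (G y)) - 'd F y ('d G y (H y))) by rewrite -lB.
have -> : bracket_loc G (bracket_loc F H) y = 'd (bracket_loc F H) y (G y)
   - ('d G y ('d H y (F y)) - 'd G y ('d F y (H y))) by rewrite -lB.
have -> : bracket_loc (bracket_loc F G) H y =
   'd H y ('d G y (F y)) - 'd H y ('d F y (G y))
   - 'd (bracket_loc F G) y (H y) by rewrite -lB.
have alg (a b b' c d d' e f k q i i' : 'rV[R]_m) : b' = b -> d' = d -> i' = i ->
    (a + b - (c + d) - (e - f)) - (q + b' - (e + i) - (c - k)) =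
    a - q - (k + d' - (f + i')).
  by move=> -> -> ->; apply/rowP => r; rewrite !mxE; ring.
apply: (etrans (congr2 (fun s t => s - _ - (t - _)) (E1 (F y)) (E2 (G y)))).
apply: (etrans _ (congr1 (fun s => _ - s) (esym (E3 (H y))))).
exact: (alg _ _ _ _ _ _ _ _ _ _ _ _ SH SG SF).
Qed.

End VectorJacobi.

Section LieBracket.
Variables (R : realType) (N : nat) (G : lieGroup R N).
Local Notation one := (gone G).
Local Notation o := (coord (gone G) (gone G)).
Implicit Types (X Y : 'rV[R]_N).

Lemma left_inv_loc Y : \forall a \near o,
  vloc one (left_inv_field Y) a = 'd (mul_loc G) (row_mx a o) (row_mx 0 Y).
Proof.
have := near_row_mxl (tmap_loc (gmul_action G) one).
apply: filterS2 (near_chart one) => a [da _] H.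
have := H Y; rewrite !row_mxKl !row_mxKr !point_o gmulg1.
rewrite (coord_change_id Y (dom_self one)) /vloc /left_inv_field => ->.
rewrite (coord_change_comp _ da (dom_self _) da).
exact: coord_change_id.
Qed.

Lemma lie_brE X Y : lie_br G X Y = mixed G X Y - mixed G Y X.
Proof.
have lE Z : left_inv_field Z one = Z.
  by rewrite -[LHS]vloc_self (nbhs_singleton (left_inv_loc Z)) diff_mul_loc_l.
have dE Z Z' : 'd (vloc one (left_inv_field Z)) o Z' = mixed G Z' Z.
  apply: near_eq_diff; last exact/smooth_near_differentiable/diff_mul_loc2_smooth.
  by apply: filterS (left_inv_loc Z) => a ->.
rewrite /lie_br /bracket (lE X) (lE Y).
exact: (congr2 (fun s t => s - t) (dE Y X) (dE X Y)).
Qed.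

End LieBracket.

Section FundamentalFields.
Variables (R : realType) (N m : nat) (G : lieGroup R N) (M : manifold R m).
Variable act : G -> M -> M.
Hypothesis act_smooth : smooth_action act.
Variable e : 'rV[R]_N -> G.
Hypothesis e_exp : is_exp e.
Implicit Types (p z : M) (X Y Z : 'rV[R]_N) (u v : 'rV[R]_m).
Local Notation loc_fund := (loc_fund act).
Local Notation fund := (fund act e).
Local Notation fundE := (fundE act_smooth e_exp).

(** The sign arises because [lie_br] is the bracket of left-invariant fields, while for left
    translations of the group on itself the fundamental fields are right-invariant. *)
Lemma fund_bracket X Y : bracket (fund X) (fund Y) = fund (- lie_br G X Y).
Proof.
apply/funext => p; rewrite /bracket.
have dX := nbhs_singleton (diff_fund act_smooth e_exp p X (fund Y p)).
have dY := nbhs_singleton (diff_fund act_smooth e_exp p Y (fund X p)).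
rewrite fundE in dX; rewrite fundE in dY; rewrite !fundE lie_brE opprB.
have := nbhs_singleton (fund_bracket_loc act_smooth p Y X).
exact: (etrans (congr2 (fun s t => s - t) dY dX)).
Qed.

Lemma vloc_bracket_fund p X Y : \forall y \near coord p p,
  vloc p (bracket (fund X) (fund Y)) y = bracket_loc (loc_fund p X) (loc_fund p Y) y.
Proof.
rewrite fund_bracket.
apply: filterS2 (fund_loc act_smooth e_exp p (- lie_br G X Y))
  (fund_bracket_loc act_smooth p Y X) => y -> E.
by rewrite lie_brE opprB -E.
Qed.

(** Brackets of fundamental fields are again fundamental, so every field here has a smooth local
    expression and the identity reduces to [bracket_loc_jacobi]. *)
Lemma fund_jacobi X Y Z p :
  bracket (fund X) (bracket (fund Y) (fund Z)) p
  - bracket (fund Y) (bracket (fund X) (fund Z)) p =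
  bracket (bracket (fund X) (fund Y)) (fund Z) p.
Proof.
have s A := loc_fund_smooth act_smooth p A.
have fE A : fund A p = loc_fund p A (coord p p) := fundE p A.
have bE A B : bracket (fund A) (fund B) p =
    bracket_loc (loc_fund p A) (loc_fund p B) (coord p p).
  by rewrite -(nbhs_singleton (vloc_bracket_fund p A B)) vloc_self.
have dE A v : 'd (vloc p (fund A)) (coord p p) v = 'd (loc_fund p A) (coord p p) v.
  exact: (nbhs_singleton (diff_fund act_smooth e_exp p A v)).
have dbE A B v : 'd (vloc p (bracket (fund A) (fund B))) (coord p p) v =
    'd (bracket_loc (loc_fund p A) (loc_fund p B)) (coord p p) v.
  apply: near_eq_diff; last by have [] := diff_bracket_loc (s A) (s B).
  by apply: filterS (vloc_bracket_fund p A B) => y ->.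
have E1 A B C : bracket (fund A) (bracket (fund B) (fund C)) p =
    bracket_loc (loc_fund p A) (bracket_loc (loc_fund p B) (loc_fund p C)) (coord p p).
  rewrite {1}/bracket (bE B C) (fE A).
  exact: (congr2 (fun s t => s - t) (dbE B C _) (dE A _)).
have E2 : bracket (bracket (fund X) (fund Y)) (fund Z) p =
    bracket_loc (bracket_loc (loc_fund p X) (loc_fund p Y)) (loc_fund p Z) (coord p p).
  rewrite {1}/bracket (bE X Y) (fE Z).
  exact: (congr2 (fun s t => s - t) (dE Z _) (dbE X Y _)).
by rewrite E2 -bracket_loc_jacobi ?E1.
Qed.

End FundamentalFields.

(** * Infinitesimal invariance of the complex structure and of the symplectic form *)

Section Invariance.
Variables (R : realType) (N m : nat) (G : lieGroup R N) (M : manifold R m).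
Variable act : G -> M -> M.
Hypothesis act_smooth : smooth_action act.
Variable e : 'rV[R]_N -> G.
Hypothesis e_exp : is_exp e.
Local Notation one := (gone G).
Local Notation o := (coord (gone G) (gone G)).
Implicit Types (p z : M) (X : 'rV[R]_N) (u v : 'rV[R]_m) (U V W : vfield M).
Local Notation act_loc := (act_loc act).
Local Notation loc_fund := (loc_fund act).
Local Notation fund := (fund act e).

Lemma point_self p : point p (coord p p) = p. Proof. exact: coordK. Qed.

Lemma act_near p : \forall a \near o, exists g : G,
  [/\ dom p (act g p), act_loc p (row_mx a (coord p p)) = coord p (act g p) &
    forall v, tmap (act g) p v =
      coord_change p (act g p) (act g p)
        ('d (act_loc p) (row_mx a (coord p p)) (row_mx 0 v))].
Proof.
have n1 := near_row_mxl (near_act_loc act_smooth p).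
apply: filterS2 n1 (near_row_mxl (tmap_loc act_smooth p)) => a [_ _ _ dgp] H.
exists (point one a); move: dgp H; rewrite !row_mxKl !row_mxKr !point_self => dgp H.
split=> //; first by rewrite act_loc_row point_self.
by move=> v; have := H v; rewrite coord_change_id.
Qed.

(** Transport of the tangent vector [v] at [p] by the group element with coordinates [a]. Components
    stay in the chart at [p], so the result can be differentiated in [a]. *)
Definition push p v a := 'd (act_loc p) (row_mx a (coord p p)) (row_mx 0 v).

Lemma push_o p v : push p v o = v.
Proof.
have dm := smooth_near_differentiable (act_loc_smooth act_smooth p).
rewrite /push -(diff_partial2 _ dm) -[RHS](diff_idE (coord p p)).
by apply: near_eq_diff => //; apply: filterS (near_act_loc_r act_smooth p) => y [].
Qed.

Lemma diff_push p v X : differentiable (push p v) o /\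
  'd (push p v) o X = 'd (loc_fund p X) (coord p p) v.
Proof.
have so := act_loc_smooth act_smooth p; split; last exact: diff_act_loc_mixed.
apply/smooth_near_differentiable.
apply: (smooth_near_partial1 (f := fun h => 'd (act_loc p) h (row_mx 0 v))).
exact: smooth_near_diff.
Qed.

Lemma diff_orbit p X : differentiable (fun a => act_loc p (row_mx a (coord p p))) o /\
  'd (fun a => act_loc p (row_mx a (coord p p))) o X = loc_fund p X (coord p p).
Proof.
have dm := smooth_near_differentiable (act_loc_smooth act_smooth p).
have [dl _] := is_diff_row_mxl (coord p p) o.
by split; [exact: (differentiable_chain dl dm)|exact: diff_partial1].
Qed.

Lemma act_loc_o p : act_loc p (row_mx o (coord p p)) = coord p p.
Proof. by have [] := nbhs_singleton (near_act_loc_r act_smooth p). Qed.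

Section ComplexStructure.
Variable J : tensor11 M.
Hypotheses (lJ : forall z, linear (J z)) (sJ : smooth_tensor11 J).
Hypothesis act_J : preserves_tensor act J.

Lemma locJ_self p v : locJ J p (coord p p) v = J p v.
Proof. by rewrite /locJ point_self !coord_change_id. Qed.

Lemma locJ_diff p i :
  differentiable (fun y => locJ J p y (delta_mx 0 i)) (coord p p).
Proof. exact/smooth_near_differentiable/locJ_smooth. Qed.

(** Invariance says that J commutes with [push]; this is the derivative of that relation in the
    group variable at the identity. *)
Lemma loc_fund_J p X v :
  J p ('d (loc_fund p X) (coord p p) v)
  + 'd (fun y => locJ J p y v) (coord p p) (loc_fund p X (coord p p)) =
  'd (loc_fund p X) (coord p p) (J p v).
Proof.
have [dp Ep] := diff_push p v X; have [dp' Ep'] := diff_push p (J p v) X.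
have [dh Eh] := diff_orbit p X.
have dJ i : differentiable (fun y => locJ J p y (delta_mx 0 i))
    (act_loc p (row_mx o (coord p p))) by rewrite act_loc_o; exact: locJ_diff.
have [d1 E1] := diff_linear_family (T := locJ J p) (locJ_linear lJ p) dh dp dJ.
have nE : \forall a \near o,
    locJ J p (act_loc p (row_mx a (coord p p))) (push p v a) = push p (J p v) a.
  apply: filterS (act_near p) => a [g [dg ag tg]].
  rewrite ag /locJ coordK// -/(push p v a) -tg -act_J tg -/(push p (J p v) a).
  rewrite (coord_change_comp _ dg (dom_self _) dg).
  exact: coord_change_id.
have E2 := near_eq_diff X nE d1.
apply: (etrans _ (etrans (esym (E1 X)) (etrans (esym E2) Ep'))); apply: congr2.
  apply: (etrans _ (congr1 (fun y => locJ J p y _) (esym (act_loc_o p)))).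
  exact: (etrans (congr1 (J p) (esym Ep)) (esym (locJ_self _ _))).
apply: (etrans _ (congr1 (fun y => 'd _ y _) (esym (act_loc_o p)))).
apply: (etrans (congr1 ('d (fun y => locJ J p y v) (coord p p)) (esym Eh))).
by rewrite push_o.
Qed.

(** The product rule for [app11 J W] brings in the derivative of J along the field, which
    [loc_fund_J] trades for derivatives of the field itself. *)
Lemma fund_holomorphic X W p : smooth_vfield W ->
  bracket (fund X) (app11 J W) p = J p (bracket (fund X) W p).
Proof.
move=> sW; rewrite /bracket (fundE act_smooth e_exp p X).
have dX v := nbhs_singleton (diff_fund act_smooth e_exp p X v).
have [d1 E1] := diff_linear_field (T := locJ J p) (locJ_linear lJ p)
  (vloc_differentiable p sW) (locJ_diff p).
have E2 : 'd (vloc p (app11 J W)) (coord p p) (loc_fund p X (coord p p)) =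
    'd (fun y => locJ J p y (vloc p W y)) (coord p p) (loc_fund p X (coord p p)).
  apply: near_eq_diff; last exact: d1.
  by apply: filterS (vloc_app11 J p W) => y ->.
have L := loc_fund_J p X (W p).
have E3 := etrans E2 (E1 (loc_fund p X (coord p p))).
rewrite locJ_self vloc_self in E3.
have JB u v : J p (u - v) = J p u - J p v.
  by rewrite -scaleN1r addrC lJ scaleN1r addrC.
rewrite /app11 in E3 *.
apply: (etrans (congr2 (fun s t => s - t) E3 (dX (J p (W p))))).
apply: (etrans (congr1 (fun s => _ - s) (esym L))).
apply: (etrans _ (esym (JB _ _))).
apply: (etrans _ (congr1 (fun s => _ - J p s) (esym (dX (W p))))).
by rewrite opprD addrACA subrr addr0.
Qed.

End ComplexStructure.

Section Form.
Variable w : form2 M.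
Hypotheses (lw : forall z u, scalar (w z u)) (aw : forall z u v, w z u v = - w z v u).
Hypothesis sw : smooth_form2 w.
Hypothesis act_w : preserves_form act w.

Lemma locw_scalar_l p y v : scalar (locw w p y ^~ v).
Proof.
move=> a u u'; rewrite !(locw_anti aw _ _ _ v) locw_linear// /GRing.scale/=; ring.
Qed.

Lemma locw_self p u v : locw w p (coord p p) u v = w p u v.
Proof. by rewrite /locw point_self !coord_change_id. Qed.

Lemma locw_diff p u v : differentiable (fun y => locw w p y u v) (coord p p).
Proof. exact/smooth_near_differentiable/locw_smooth. Qed.

(** The pairing of [push p u a] with [push p v a] does not depend on [a], so its derivative at the
    identity is 0. *)
Lemma loc_fund_w p X u v :
  w p ('d (loc_fund p X) (coord p p) u) v + w p u ('d (loc_fund p X) (coord p p) v)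
  + 'd (fun y => locw w p y u v) (coord p p) (loc_fund p X (coord p p)) = 0.
Proof.
have [du Eu] := diff_push p u X; have [dv Ev] := diff_push p v X.
have [dh Eh] := diff_orbit p X.
have dw i j : differentiable (fun y => locw w p y (delta_mx 0 i) (delta_mx 0 j))
    (act_loc p (row_mx o (coord p p))) by rewrite act_loc_o; exact: locw_diff.
have [d1 E1] := diff_bilinear_family (T := locw w p) (locw_linear lw p)
  (locw_scalar_l p) dh du dv dw.
have nE : \forall a \near o, locw w p (act_loc p (row_mx a (coord p p)))
    (push p u a) (push p v a) = cst (w p u v) a.
  apply: filterS (act_near p) => a [g [dg ag tg]].
  by rewrite ag /locw coordK// -!tg act_w.
have E2 := near_eq_diff X nE d1.
have E0 : 'd (cst (w p u v)) o X = 0 by rewrite diff_cst.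
apply: (etrans _ (etrans (esym (E1 X)) (etrans (esym E2) E0))).
apply: congr2; first apply: congr2.
- apply: (etrans _ (congr1 (fun y => locw w p y _ _) (esym (act_loc_o p)))).
  apply: (etrans _ (esym (locw_self _ _ _))).
  exact: (congr2 (w p) (esym Eu) (esym (push_o _ _))).
- apply: (etrans _ (congr1 (fun y => locw w p y _ _) (esym (act_loc_o p)))).
  apply: (etrans _ (esym (locw_self _ _ _))).
  exact: (congr2 (w p) (esym (push_o _ _)) (esym Ev)).
apply: (etrans _ (congr1 (fun y => 'd _ y _) (esym (act_loc_o p)))).
apply: (etrans (congr1 ('d (fun y => locw w p y u v) (coord p p)) (esym Eh))).
by rewrite !push_o.
Qed.

Lemma fund_symplectic X U V p : smooth_vfield U -> smooth_vfield V ->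
  dfun (app2 w U V) p (fund X p) =
  w p (bracket (fund X) U p) (V p) + w p (U p) (bracket (fund X) V p).
Proof.
have alg (a b c d k : R) : c + d + k = 0 -> a + b + k = a - c + (b - d).
  by move=> h; lra.
move=> sU sV; rewrite (fundE act_smooth e_exp p X).
have dX v := nbhs_singleton (diff_fund act_smooth e_exp p X v).
have [d1 E1] := diff_bilinear_family (T := locw w p) (locw_linear lw p)
  (locw_scalar_l p) (differentiable_var (coord p p)) (vloc_differentiable p sU)
  (vloc_differentiable p sV) (fun i j => locw_diff p _ _).
have E2 : dfun (app2 w U V) p (loc_fund p X (coord p p)) =
    'd (fun y => locw w p y (vloc p U y) (vloc p V y)) (coord p p)
    (loc_fund p X (coord p p)).
  apply: near_eq_diff; last exact: d1.
  by apply: filterS (app2_loc w p U V) => y E; exact/esym/E.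
have E3 := etrans E2 (E1 (loc_fund p X (coord p p))).
have L := loc_fund_w p X (U p) (V p).
have bE W : bracket (fund X) W p = 'd (vloc p W) (coord p p) (loc_fund p X (coord p p))
    - 'd (loc_fund p X) (coord p p) (W p).
  rewrite /bracket (fundE act_smooth e_exp p X).
  exact: (congr1 (fun s => _ - s) (dX (W p))).
have wBr u v v' : w p u (v - v') = w p u v - w p u v'.
  by rewrite -scaleN1r addrC lw mulN1r addrC.
have wBl u u' v : w p (u - u') v = w p u v - w p u' v.
  by rewrite aw wBr opprB [w p v u]aw [w p v u']aw opprK addrC.
apply: (etrans E3); rewrite (bE U) (bE V) wBl wBr.
rewrite !locw_self !vloc_self.
apply: (etrans _ (alg _ _ _ _ _ L)); apply: congr2; first exact: erefl.
exact: (congr1 ('d (fun y => locw w p y (U p) (V p)) (coord p p))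
  (diff_idE _ (loc_fund p X (coord p p)))).
Qed.

End Form.

Lemma fund_killing (w : form2 M) (J : tensor11 M) X U V p :
  symplectic w -> almost_complex J -> preserves_form act w ->
  preserves_tensor act J -> smooth_vfield U -> smooth_vfield V ->
  dfun (app2 (metric w J) U V) p (fund X p) =
  metric w J p (bracket (fund X) U p) (V p)
  + metric w J p (U p) (bracket (fund X) V p).
Proof.
move=> [lw aw sw _ _] [lJ sJ _] act_w act_J sU sV.
have := fund_symplectic lw aw sw act_w X p sU (smooth_vfield_app11 lJ sJ sV).
by rewrite fund_holomorphic.
Qed.

End Invariance.

(** * The derivative of the adjoint action *)

Section Adjoint.
Variables (R : realType) (N : nat) (G : lieGroup R N).
Local Notation one := (gone G).
Local Notation o := (coord (gone G) (gone G)).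
Implicit Types (X Z : 'rV[R]_N).
Local Notation mul_loc := (mul_loc G).

Definition linv (a : 'rV[R]_N) : 'rV[R]_N := coord one (ginv (point one a)).

Lemma linv_o : linv o = o.
Proof. by rewrite /linv point_o ginv1. Qed.

Lemma linv_differentiable : differentiable linv o.
Proof.
have [_ s] := ginv_smooth G; have := s one; rewrite ginv1.
exact: smooth_near_differentiable.
Qed.

Lemma near_linv : \forall a \near o,
  [/\ dom one (point one a), coord one (point one a) = a &
    dom one (ginv (point one a))].
Proof.
have [c _] := ginv_smooth G.
have n1 : nbhs one [set g : G | dom one (ginv g)].
  by have := c one; rewrite /continuous_at ginv1; apply; exact: dom_nbhs.
by apply: filterS2 (near_chart one) (near_point (dom_self one) n1) => a [].
Qed.

(** Comes from differentiating the product of a and its inverse, which is constant. *)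
Lemma diff_linv Z : 'd linv o Z = - Z.
Proof.
have dl := linv_differentiable.
have [dk Ek] := is_diff_row_mx (differentiable_var o) dl.
have dm : differentiable mul_loc (row_mx o (linv o)).
  by rewrite linv_o; exact/smooth_near_differentiable/mul_loc_smooth.
have nE : \forall a \near o, mul_loc (row_mx a (linv a)) = cst o a.
  apply: filterS near_linv => a [da ca di].
  by rewrite /mul_loc act_loc_row /linv (coordK di) gmulgV.
have d1 := differentiable_chain dk dm.
have E1 := near_eq_diff Z nE d1.
have E0 : 'd (cst o) o Z = 0 by rewrite diff_cst.
have E2 := etrans (esym (diff_chain Z dk dm)) (etrans (esym E1) E0).
have K1 := etrans (Ek Z) (congr1 (fun u => row_mx u ('d linv o Z)) (diff_idE o Z)).
have K2 : 'd mul_loc (row_mx o o) (row_mx Z ('d linv o Z)) = 0.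
  apply: (etrans _ E2); apply: (etrans _ (congr1 _ (esym K1))).
  exact: (congr1 (fun b => 'd mul_loc (row_mx o b) (row_mx Z ('d linv o Z)))
    (esym linv_o)).
have K3 := congr2 +%R (diff_mul_loc_r G Z) (diff_mul_loc_l G ('d linv o Z)).
have := etrans (esym K3) (etrans (esym (diff_row_split _ _ _ _ _)) K2).
by move/eqP; rewrite addrC addr_eq0 => /eqP.
Qed.

(** The differential at the identity of b -> (a b) a^-1 by the chain rule: the inner one is taken at
    (a, 1), the outer one at (a, a^-1). *)
Definition locAd X a :=
  'd mul_loc (row_mx a (linv a)) (row_mx ('d mul_loc (row_mx a o) (row_mx 0 X)) 0).

Lemma locAdE X : \forall a \near o, Ad (point one a) X = locAd X a.
Proof.
have dl := linv_differentiable.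
have [dk _] := is_diff_row_mx (differentiable_var o) dl.
have n2 : \forall a \near o, smooth_near mul_loc (row_mx a (linv a)).
  have H : nbhs (row_mx o (linv o)) [set h | smooth_near mul_loc h].
    by rewrite linv_o; exact: (smooth_near_near (mul_loc_smooth G)).
  exact: (differentiable_continuous dk H).
near=> a.
have [da ca di] : [/\ dom one (point one a), coord one (point one a) = a &
    dom one (ginv (point one a))] by near: a; exact: near_linv.
have gE : gmul (gmul (point one a) one) (ginv (point one a)) = one.
  by rewrite gmulg1 gmulgV.
have mra : mul_loc (row_mx a o) = a by near: a; exact: mul_loc_r.
have sm : differentiable mul_loc (row_mx a o).
  apply: smooth_near_differentiable; near: a; apply: near_row_mxl.
  exact/smooth_near_near/mul_loc_smooth.
have sm2 : differentiable mul_loc (row_mx (mul_loc (row_mx a o)) (linv a)).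
  apply: smooth_near_differentiable.
  have H : smooth_near mul_loc (row_mx a (linv a)) by near: a.
  by rewrite mra.
have nd : \forall b \near o, dom one (gmul (point one a) (point one b)).
  near: a; have := near_row_mx (near_act_loc (gmul_action G) one).
  apply: filterS => a'; apply: filterS => b [_ _ _].
  by rewrite row_mxKl row_mxKr.
have [dr Er] := is_diff_row_mxr a o.
have dmu2 := differentiable_chain dr sm.
have [dk1 Ek1] := is_diff_row_mx dmu2 (differentiable_cst (linv a) o).
have d1 := differentiable_chain dk1 sm2.
have nE : \forall b \near o, mul_loc (row_mx (mul_loc (row_mx a b)) (cst (linv a) b)) =
    (coord one \o (fun h => gmul (gmul (point one a) h) (ginv (point one a)))
      \o point one) b.
  apply: filterS nd => b db.
  by rewrite /mul_loc !act_loc_row /= (coordK db) (coordK di).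
rewrite /Ad /tmap gE.
apply: (etrans (near_eq_diff X nE d1)).
apply: (etrans (diff_chain X dk1 sm2)).
have E0 : 'd (cst (linv a)) o X = 0 by rewrite diff_cst.
have E1 := etrans (Ek1 X) (congr2 _ (diff_partial2 X sm) E0).
apply: (etrans (congr1 _ E1)).
by rewrite mra.
Unshelve. all: by end_near. Qed.

(** The inner factor contributes [mixed Z X]. The base point (a, a^-1) moves with velocity (Z, -Z):
    the first half contributes nothing, since right multiplication by 1 has a constant differential,
    and the second half gives [- mixed X Z]. *)
Lemma diff_locAd X Z : differentiable (locAd X) o /\
  'd (locAd X) o Z = lie_br G Z X.
Proof.
have dl := linv_differentiable.
have [dk Ek] := is_diff_row_mx (differentiable_var o) dl.
have sm := mul_loc_smooth G.
have dv := smooth_near_differentiable (diff_mul_loc2_smooth G X).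
have lT h : linear (fun u : 'rV[R]_N => 'd mul_loc h (row_mx u 0)).
  move=> c u v; rewrite -linearP; congr ('d _ _ _).
  by rewrite scale_row_mx add_row_mx scaler0 addr0.
have s2 v : smooth_near (fun h => 'd mul_loc h v) (row_mx o o) by exact: smooth_near_diff.
have dT i : differentiable (fun h => 'd mul_loc h (row_mx (delta_mx 0 i) 0))
    (row_mx o (linv o)).
  by rewrite linv_o; exact: smooth_near_differentiable.
have [d E] := diff_linear_family (T := fun h u => 'd mul_loc h (row_mx u 0)) lT dk dv dT.
split; first exact: d.
pose Q u := 'd (fun h => 'd mul_loc h (row_mx X 0)) (row_mx o o) u.
have dX := smooth_near_differentiable (s2 (row_mx X 0)).
have Q1 : Q (row_mx Z 0) = 0.
  have E0 : 'd (cst X) o Z = 0 by rewrite diff_cst.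
  apply: (etrans (esym (diff_partial1 _ dX))); apply: (etrans _ E0).
  apply/esym; apply: near_eq_diff; last first.
    by have [dr _] := is_diff_row_mxl o o; exact: (differentiable_chain dr dX).
  near=> a.
  have sa : differentiable mul_loc (row_mx a o).
    apply: smooth_near_differentiable; near: a; apply: near_row_mxl.
    exact: smooth_near_near.
  have dm := differentiable_chain (is_diff_row_mxl o a).1 sa.
  apply: (etrans (esym (diff_partial1 X sa))).
  apply: (etrans _ (diff_idE a X)); apply/esym; apply: near_eq_diff; last exact: dm.
  by near: a; apply: filterS (nbhs_interior (mul_loc_r G)) => a' r; exact: r.
have Q2 : Q (row_mx 0 (- Z)) = - mixed G X Z.
  have -> : row_mx 0 (- Z) = - row_mx 0 Z :> 'rV[R]_(N + N).
    by rewrite opp_row_mx oppr0.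
  rewrite /Q linearN; congr (- _); rewrite (schwarz _ _ sm).
  exact/esym/(diff_partial1 X (smooth_near_differentiable (s2 _))).
have K1 : 'd (fun z => row_mx z (linv z)) o Z = row_mx Z (- Z).
  exact: (etrans (Ek Z) (congr2 _ (diff_idE o Z) (diff_linv Z))).
apply: (etrans (E Z)); rewrite lie_brE; apply: congr2.
  apply: (etrans (congr1 (fun b => 'd mul_loc (row_mx o b) _) linv_o)).
  exact: diff_mul_loc_r.
apply: (etrans (congr1 _ K1)).
apply: (etrans (congr1 (fun b =>
  'd (fun h => 'd mul_loc h (row_mx _ 0)) (row_mx o b) _) linv_o)).
apply: (etrans (congr1 (fun u =>
  'd (fun h => 'd mul_loc h (row_mx u 0)) (row_mx o o) _) (diff_mul_loc_l G X))).
apply: (etrans (diff_row_split _ _ _ _ _)).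
by apply: (etrans (congr2 +%R Q1 Q2)); rewrite add0r.
Unshelve. all: by end_near. Qed.

Variable e : 'rV[R]_N -> G.
Hypothesis e_exp : is_exp e.

(** The curve [Ad (e (t *: Z)) X] stays in the subspace and has derivative [lie_br G Z X] at 0.
    Composing it with [q], a linear map with kernel [mm], replaces an appeal to closedness of
    subspaces by the derivative of a constant. *)
Lemma lie_br_Ad_stable (mm : {vspace 'rV[R]_N}) X Z :
  (forall t : R, Ad (e (t *: Z)) X \in mm) -> lie_br G Z X \in mm.
Proof.
move=> H; pose q (v : 'rV[R]_N) := v - projv mm v.
have lq : linear q.
  by move=> a u v; rewrite /q linearP scalerBr opprD addrACA.
have [dc Ec] := coord_exp e_exp Z.
pose c (t : R) := coord one (e (t *: Z)).
have c0 : c 0 = o by rewrite /c scale0r (exp0 e_exp).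
have [dA EA] := diff_locAd X Z.
have dA' : differentiable (locAd X) (c 0) by rewrite c0.
have dAc := differentiable_chain dc dA'.
have [dq Eq] := rowvec_linear_diff (locAd X (c 0)) lq.
have nE : \forall t \near (0 : R), q (locAd X (c t)) = cst 0 t.
  near=> t; have de : dom one (e (t *: Z)).
    by near: t; exact: (near_exp e_exp Z (dom_nbhs (dom_self one))).
  have -> : locAd X (c t) = Ad (e (t *: Z)) X.
    have <- : point one (c t) = e (t *: Z) by exact: coordK.
    apply/esym; near: t.
    have := near_exp e_exp Z (near_coord (dom_self one) (locAdE X)).
    exact.
  by rewrite /q projv_id ?subrr.
have E1 := near_eq_diff (1 : R) nE (differentiable_chain dAc dq).
have E0 : 'd (cst (0 : 'rV[R]_N)) (0 : R) (1 : R) = 0 by rewrite diff_cst.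
have E2 := etrans (diff_chain (1 : R) dAc dq) (Eq _).
have E3 := etrans (diff_chain (1 : R) dc dA') (congr1 _ Ec).
have E4 : 'd (locAd X) (c 0) Z = lie_br G Z X.
  exact: (etrans (congr1 (fun b => 'd (locAd X) b Z) c0) EA).
have : q (lie_br G Z X) = 0.
  apply: (etrans (congr1 q (esym (etrans E3 E4)))).
  exact: (etrans (esym E2) (etrans (esym E1) E0)).
by move/eqP; rewrite subr_eq0 => /eqP ->; exact: memv_proj.
Unshelve. all: by end_near. Qed.

End Adjoint.

Opaque bracket.

(** * The Chern connection *)

Section Chern.
Variables (R : realType) (m : nat) (M : manifold R m).
Variables (w : form2 M) (J : tensor11 M) (D : covderiv M).
Hypotheses (w_symplectic : symplectic w) (J_almost_complex : almost_complex J).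
Hypothesis wJ_compatible : compatible w J.
Implicit Types (z : M) (u v : 'rV[R]_m) (f : M -> R) (U V W X Y Z : vfield M).

Local Notation g := (metric w J).

Lemma lJ z : linear (J z). Proof. by case: J_almost_complex. Qed.
Lemma sJ : smooth_tensor11 J. Proof. by case: J_almost_complex. Qed.
Lemma JJ z v : J z (J z v) = - v. Proof. by case: J_almost_complex. Qed.
Lemma lw z u : scalar (w z u). Proof. by case: w_symplectic. Qed.
Lemma aw z u v : w z u v = - w z v u. Proof. by case: w_symplectic. Qed.
Lemma sw : smooth_form2 w. Proof. by case: w_symplectic. Qed.
Lemma wJJ z u v : w z (J z u) (J z v) = w z u v.
Proof. by case: wJ_compatible. Qed.

Lemma J0 z : J z 0 = 0.
Proof. by have := lJ z (-1) 0 0; rewrite scaler0 addr0 scaleN1r addNr. Qed.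
Lemma JD z u v : J z (u + v) = J z u + J z v.
Proof. by have := lJ z 1 u v; rewrite !scale1r. Qed.
Lemma JZ z a v : J z (a *: v) = a *: J z v.
Proof. by have := lJ z a v 0; rewrite J0 !addr0. Qed.
Lemma JN z v : J z (- v) = - J z v.
Proof. by rewrite -scaleN1r JZ scaleN1r. Qed.
Lemma JB z u v : J z (u - v) = J z u - J z v.
Proof. by rewrite JD JN. Qed.

Lemma wDr z u v v' : w z u (v + v') = w z u v + w z u v'.
Proof. exact: gDr lw _ _ _ _. Qed.
Lemma wNr z u v : w z u (- v) = - w z u v.
Proof. exact: gNr lw _ _ _. Qed.
Lemma wDl z u v v' : w z (v + v') u = w z v u + w z v' u.
Proof. by rewrite aw wDr opprD -!aw. Qed.
Lemma wNl z u v : w z (- v) u = - w z v u.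
Proof. by rewrite aw wNr -aw. Qed.
Lemma wJl z u v : w z (J z u) v = - w z u (J z v).
Proof. by rewrite -(wJJ z u) JJ wNr opprK. Qed.

Lemma metric_scalar z u : scalar (g z u).
Proof. by move=> a v v'; rewrite /metric lJ lw. Qed.
Lemma metricC z u v : g z u v = g z v u.
Proof. by rewrite /metric aw wJl opprK. Qed.
Lemma metric_pos z u : u != 0 -> 0 < g z u u.
Proof. by case: wJ_compatible => _; exact. Qed.
Lemma metric_Jl z u v : g z (J z u) v = w z u v.
Proof. by rewrite /metric wJJ. Qed.
Lemma metric_J z u v : g z (J z u) v = - g z u (J z v).
Proof. by rewrite /metric JJ wNr opprK wJJ. Qed.

Lemma smooth_fun_metric U V :
  smooth_vfield U -> smooth_vfield V -> smooth_fun (app2 g U V).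
Proof.
move=> sU sV; apply: (smooth_fun_app2 lw aw sw sU).
exact: (smooth_vfield_app11 lJ sJ sV).
Qed.

Lemma smooth_vfield_J U : smooth_vfield U -> smooth_vfield (app11 J U).
Proof. exact: (smooth_vfield_app11 lJ sJ). Qed.

Hypothesis chern : chern_connection w J D.

Lemma D_linear Y z : smooth_vfield Y -> linear (D Y z).
Proof. by case: chern => -[+ _ _ _] _ _; exact. Qed.
Lemma D_cov X Y : smooth_vfield X -> smooth_vfield Y -> smooth_vfield (cov D X Y).
Proof. by case: chern => -[_ + _ _] _ _; exact. Qed.
Lemma D_add U V z v : smooth_vfield U -> smooth_vfield V ->
  D (fun z => U z + V z) z v = D U z v + D V z v.
Proof. by case: chern => -[_ _ + _] _ _; exact. Qed.
Lemma D_scale f U z v : smooth_fun f -> smooth_vfield U ->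
  D (fun z => f z *: U z) z v = f z *: D U z v + dfun f z v *: U z.
Proof. by case: chern => -[_ _ _ +] _ _; exact. Qed.
Lemma D_metric U V z v : smooth_vfield U -> smooth_vfield V ->
  dfun (app2 g U V) z v = g z (D U z v) (V z) + g z (U z) (D V z v).
Proof. by case: chern => _ + _; exact. Qed.
Lemma D_torsion X Y z : smooth_vfield X -> smooth_vfield Y ->
  bracket X Y z = D Y z (X z) - D X z (Y z) - nijenhuis J X Y z.
Proof.
move=> sX sY; case: chern => _ _ /(_ X Y z sX sY) <-.
by rewrite /torsion /cov opprB addrC subrK.
Qed.

Lemma D_opp U z v : smooth_vfield U -> D (fun z => - U z) z v = - D U z v.
Proof.
move=> sU; under eq_fun do rewrite -scaleN1r.
rewrite (@D_scale (fun=> -1))//; last by move=> p; exact: smooth_at_cst.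
by rewrite dfun_cst scale0r addr0 scaleN1r.
Qed.

Lemma app11K U : app11 J (app11 J U) = fun z => - U z.
Proof. by apply/funext => z; rewrite /app11 JJ. Qed.

Lemma nijenhuis_anti X Y z : nijenhuis J Y X z = - nijenhuis J X Y z.
Proof.
rewrite /nijenhuis -scalerN; congr (_ *: _).
rewrite (bracket_anti (app11 J Y)) (bracket_anti (app11 J Y) X).
rewrite (bracket_anti Y (app11 J X)) (bracket_anti Y X) !JN.
by apply/rowP => j; rewrite !mxE; lra.
Qed.

Lemma nijenhuis_Jl X Y z : smooth_vfield X -> 
  nijenhuis J (app11 J X) Y z = - J z (nijenhuis J X Y z).
Proof.
move=> sX; rewrite /nijenhuis [in RHS]JZ -[RHS]scalerN; congr (_ *: _).
rewrite app11K.
have bN Z : bracket (fun z => - X z) Z z = - bracket X Z z.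
  by rewrite bracket_anti bracket_opp// opprK; exact: bracket_anti.
rewrite !bN JN 3!JB 2!JJ.
by apply/rowP => j; rewrite !mxE; lra.
Qed.

Lemma nijenhuis_Jr X Y z : smooth_vfield Y ->
  nijenhuis J X (app11 J Y) z = - J z (nijenhuis J X Y z).
Proof.
by move=> sY; rewrite nijenhuis_anti nijenhuis_Jl// nijenhuis_anti JN opprK.
Qed.

(** The covariant derivative of J. It turns out to vanish, but this is not among the axioms of
    [chern_connection]. *)
Definition DJ Y z u := D (app11 J Y) z u - J z (D Y z u).

(** J is skew for the metric, and its covariant derivative inherits this because D preserves the
    metric. *)
Lemma DJ_skew Y Z z u : smooth_vfield Y -> smooth_vfield Z ->
  g z (DJ Y z u) (Z z) = - g z (DJ Z z u) (Y z).
Proof.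
move=> sY sZ; have sJY := smooth_vfield_J sY; have sJZ := smooth_vfield_J sZ.
have E1 := D_metric z u sJY sZ; have E2 := D_metric z u sJZ sY.
have E3 : dfun (app2 g (app11 J Y) Z) z u = - dfun (app2 g (app11 J Z) Y) z u.
  have -> : app2 g (app11 J Y) Z = fun z => -1 * app2 g (app11 J Z) Y z.
    apply/funext => z'; rewrite /app2 /app11 mulN1r metric_J metricC.
    by rewrite !metric_Jl.
  rewrite dfun_mul; [|exact: smooth_at_cst|exact: smooth_fun_metric].
  by rewrite dfun_cst mulr0 addr0 mulN1r.
move: E3; rewrite E1 E2 /DJ /app11.
rewrite !(gDl metric_scalar metricC) -!(scaleN1r (J z (D _ _ _))).
rewrite !(gZl metric_scalar metricC) !mulN1r !metric_Jl.
rewrite (aw z (D Y z u)) (aw z (D Z z u)); lra.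
Qed.

(** J squared is constant, so the derivative of J anticommutes with J. *)
Lemma DJ_J Y z u : smooth_vfield Y -> DJ (app11 J Y) z u = - J z (DJ Y z u).
Proof. by move=> sY; rewrite /DJ app11K D_opp// JB JJ opprD opprK addrC. Qed.

(** The brackets in the Nijenhuis tensor are rewritten by means of the torsion. By antilinearity of
    N in each argument their torsion parts add up to 4 N, which cancels the tensor itself and leaves
    a relation between derivatives of J alone. *)
Lemma DJ_torsion X Y z : smooth_vfield X -> smooth_vfield Y ->
  DJ Y z (J z (X z)) - DJ X z (J z (Y z)) - J z (DJ Y z (X z))
  + J z (DJ X z (Y z)) = 0.
Proof.
move=> sX sY; have sJX := smooth_vfield_J sX; have sJY := smooth_vfield_J sY.
have N1 := nijenhuis_Jl Y z sX; have N2 := nijenhuis_Jr X z sY.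
have N3 := nijenhuis_Jr (app11 J X) z sY; rewrite N1 JN JJ !opprK in N3.
have : 4 *: nijenhuis J X Y z =
    bracket (app11 J X) (app11 J Y) z - J z (bracket (app11 J X) Y z)
    - J z (bracket X (app11 J Y) z) - bracket X Y z.
  by rewrite /nijenhuis scalerA divff// scale1r.
rewrite !D_torsion// N1 N2 N3 /app11 4!JB JN JJ /DJ 2!JB 2!JJ.
move=> /rowP H; apply/rowP => j; have := H j.
by rewrite !mxE; lra.
Qed.

Definition tDJ u Y Z z := g z (DJ Y z u) (Z z).
Definition tN X Y Z z := w z (nijenhuis J X Y z) (Z z).

(** The exterior derivative of [w] expressed through D: the cyclic sum of the covariant derivative
    of [w], which is [tDJ] as the metric is parallel, and of [w] applied to the torsion. *)
Lemma closed_torsion X Y Z z :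
  smooth_vfield X -> smooth_vfield Y -> smooth_vfield Z ->
  tDJ (X z) Y Z z + tDJ (Y z) Z X z + tDJ (Z z) X Y z
  + tN X Y Z z + tN Y Z X z + tN Z X Y z = 0.
Proof.
move=> sX sY sZ; have [_ _ _ _ /(_ X Y Z z sX sY sZ)] := w_symplectic.
have dw (U V : vfield M) u : smooth_vfield U -> smooth_vfield V ->
    dfun (app2 w U V) z u =
    tDJ u U V z + w z (D U z u) (V z) + w z (U z) (D V z u).
  move=> sU sV; have sJU := smooth_vfield_J sU.
  have -> : app2 w U V = app2 g (app11 J U) V.
    by apply/funext => z'; rewrite /app2 metric_Jl.
  rewrite D_metric// /tDJ /DJ (gDl metric_scalar metricC).
  rewrite -(scaleN1r (J z (D _ _ _))) (gZl metric_scalar metricC) !metric_Jl.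
  by rewrite mulN1r subrK.
rewrite /ext_deriv !dw// /app2 (D_torsion z sX sY)
  (D_torsion z sY sZ) (D_torsion z sZ sX) 6!wDl 6!wNl /tN.
rewrite (aw z (X z)) (aw z (Y z)) (aw z (Z z)) => H; rewrite -{}H; ring.
Qed.

Lemma tDJ_skew u Y Z z : smooth_vfield Y -> smooth_vfield Z ->
  tDJ u Y Z z = - tDJ u Z Y z.
Proof. exact: DJ_skew. Qed.

Lemma tDJ_J u Y Z z : smooth_vfield Y ->
  tDJ u (app11 J Y) Z z = tDJ u Y (app11 J Z) z.
Proof.
move=> sY; rewrite /tDJ DJ_J// -scaleN1r (gZl metric_scalar metricC) mulN1r.
by rewrite metric_J opprK.
Qed.

Lemma tN_Jl X Y Z z : smooth_vfield X ->
  tN (app11 J X) Y Z z = tN X Y (app11 J Z) z.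
Proof. by move=> sX; rewrite /tN nijenhuis_Jl// wNl wJl opprK. Qed.

Lemma tN_Jr X Y Z z : smooth_vfield Y ->
  tN X (app11 J Y) Z z = tN X Y (app11 J Z) z.
Proof. by move=> sY; rewrite /tN nijenhuis_Jr// wNl wJl opprK. Qed.

Lemma tDJ_torsion X Y Z z : smooth_vfield X -> smooth_vfield Y ->
  tDJ (J z (X z)) Y Z z - tDJ (J z (Y z)) X Z z
  + tDJ (X z) Y (app11 J Z) z - tDJ (Y z) X (app11 J Z) z = 0.
Proof.
move=> sX sY; have := congr1 (fun v => g z (Z z) v) (DJ_torsion z sX sY).
rewrite (g0r metric_scalar) 3!(gDr metric_scalar) 2!(gNr metric_scalar).
by rewrite !(metricC z (Z z)) !metric_J opprK.
Qed.

Lemma closed_torsionJ X Y Z z :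
  smooth_vfield X -> smooth_vfield Y -> smooth_vfield Z ->
  tDJ (X z) Y (app11 J Z) z + tDJ (Y z) Z (app11 J X) z + tDJ (J z (Z z)) X Y z
  + tN X Y (app11 J Z) z + tN Y Z (app11 J X) z + tN Z X (app11 J Y) z = 0.
Proof.
move=> sX sY sZ; have := closed_torsion z sX sY (smooth_vfield_J sZ).
by rewrite tDJ_J// (tN_Jr Y X z sZ) (tN_Jl X Y z sZ).
Qed.

Lemma tDJ_torsionJ X Y Z z :
  smooth_vfield X -> smooth_vfield Y -> smooth_vfield Z ->
  tDJ (J z (X z)) Y Z z + tDJ (J z (Y z)) Z X z
  + tDJ (X z) Y (app11 J Z) z + tDJ (Y z) Z (app11 J X) z = 0.
Proof.
move=> sX sY sZ; have := tDJ_torsion Z z sX sY.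
rewrite (tDJ_skew (J z (Y z)) z sX sZ).
rewrite (tDJ_skew (Y z) z sX (smooth_vfield_J sZ)) (tDJ_J _ _ _ sZ).
by rewrite !opprK.
Qed.

(** The cyclic versions of [closed_torsionJ] and [tDJ_torsionJ] form a linear system. Eliminating
    the [tDJ] terms with J in the last slot shows that the three with J in the direction slot are
    equal, and then that they equal the cyclic sum of [tN]. *)
Lemma tDJ_Jl X Y Z z :
  smooth_vfield X -> smooth_vfield Y -> smooth_vfield Z ->
  tDJ (J z (X z)) Y Z z =
  tN X Y (app11 J Z) z + tN Y Z (app11 J X) z + tN Z X (app11 J Y) z.
Proof.
move=> sX sY sZ.
have := closed_torsionJ z sX sY sZ; have := closed_torsionJ z sY sZ sX.
have := closed_torsionJ z sZ sX sY; have := tDJ_torsionJ z sX sY sZ.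
have := tDJ_torsionJ z sY sZ sX; have := tDJ_torsionJ z sZ sX sY.
lra.
Qed.

Lemma tDJ_N u Y Z z : smooth_vfield Y -> tDJ (- u) Y Z z = - tDJ u Y Z z.
Proof.
move=> sY; have DN (W : vfield M) : smooth_vfield W -> D W z (- u) = - D W z u.
  move=> sW; have := D_linear z sW (-1) u 0; have := D_linear z sW (-1) 0 0.
  rewrite !addr0 scaler0 !scaleN1r => E0 ->.
  by have -> : D W z 0 = 0; [rewrite {1}E0 addNr|rewrite addr0].
rewrite /tDJ /DJ DN ?DN//; last exact: smooth_vfield_J.
rewrite JN -opprD -scaleN1r (gZl metric_scalar metricC) mulN1r.
by [].
Qed.

Lemma tN_JJ X Y Z z : tN X Y (app11 J (app11 J Z)) z = - tN X Y Z z.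
Proof. by rewrite /tN /app11 JJ wNr. Qed.

(** This is [tDJ_Jl] at [J X]: every term on either side picks up one sign from J squared. *)
Lemma tDJ_tN X Y Z z :
  smooth_vfield X -> smooth_vfield Y -> smooth_vfield Z ->
  tDJ (X z) Y Z z = tN X Y Z z + tN Y Z X z + tN Z X Y z.
Proof.
move=> sX sY sZ; have := tDJ_Jl z (smooth_vfield_J sX) sY sZ.
rewrite /app11 JJ -/(app11 J X) tDJ_N//.
rewrite -/(app11 J Z) -/(app11 J Y) -/(app11 J (app11 J X)).
rewrite (tN_Jl Y _ z sX) (tN_Jr Z _ z sX) !tN_JJ; lra.
Qed.

(* Closedness of w is what makes the connection with torsion N complex linear. *)
Lemma tDJ_eq0 X Y Z z :
  smooth_vfield X -> smooth_vfield Y -> smooth_vfield Z -> tDJ (X z) Y Z z = 0.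
Proof.
move=> sX sY sZ; have := closed_torsion z sX sY sZ.
(* Each [tDJ] equals the cyclic sum of [tN], so closedness says that four times this sum is 0. *)
rewrite !tDJ_tN//; lra.
Qed.

(** The assumption that vectors extend to smooth fields takes the place of bump functions; where the
    frame is a basis, [value_field] provides it. *)
Lemma D_J Y z u : (forall v, exists V, smooth_vfield V /\ V z = v) ->
  smooth_vfield Y -> D (app11 J Y) z u = J z (D Y z u).
Proof.
move=> ext sY; apply/eqP; rewrite -subr_eq0; apply/eqP.
apply: (g_eq0 metric_pos (z := z)).
have [X [sX Xz]] := ext u; have [Z [sZ Zz]] := ext (DJ Y z u).
by have := tDJ_eq0 z sX sY sZ; rewrite /tDJ Xz Zz.
Qed.

End Chern.

(** * The Chern-Ricci form on infinitesimal automorphisms *)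

Section ChernRicci.
Variables (R : realType) (m : nat) (M : manifold R m).
Variables (w : form2 M) (J : tensor11 M) (D : covderiv M).
Hypotheses (w_symplectic : symplectic w) (J_almost_complex : almost_complex J).
Hypothesis wJ_compatible : compatible w J.
Hypothesis chern : chern_connection w J D.
Implicit Types (z : M) (u v : 'rV[R]_m) (f : M -> R) (U V W X Y Z : vfield M).

Local Notation g := (metric w J).
Local Notation JB := (JB J_almost_complex).
Local Notation JJ := (JJ J_almost_complex).
Local Notation lg := (metric_scalar w_symplectic J_almost_complex).
Local Notation gC := (metricC w_symplectic J_almost_complex wJ_compatible).
Local Notation gpos := (metric_pos wJ_compatible).
Local Notation sg := (smooth_fun_metric w_symplectic J_almost_complex).
Local Notation smooth_vfield_J := (smooth_vfield_J J_almost_complex).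

Definition infinitesimal_automorphism X : Prop :=
  [/\ smooth_vfield X,
      forall W z, smooth_vfield W ->
        bracket X (app11 J W) z = J z (bracket X W z) &
      forall U V z, smooth_vfield U -> smooth_vfield V ->
        dfun (app2 g U V) z (X z) =
        g z (bracket X U z) (V z) + g z (U z) (bracket X V z)].

(** [K] stands for the set of fundamental fields. Keeping it abstract separates the curvature
    computation from the group. *)
Variable K : vfield M -> Prop.
Hypothesis K_aut : forall X, K X -> infinitesimal_automorphism X.
Hypothesis K_bracket : forall X Y, K X -> K Y -> K (bracket X Y).
Hypothesis K_jacobi : forall X Y Z z, K X -> K Y -> K Z ->
  bracket X (bracket Y Z) z - bracket Y (bracket X Z) z
  = bracket (bracket X Y) Z z.
Variable E : 'I_m -> vfield M.
Hypothesis KE : forall i, K (E i).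

Local Notation Emat := (Emat E).
Local Notation cf := (cf E).
Local Notation gram := (gram g E).
Local Notation gramdet := (gramdet g E).

Lemma K_smooth X : K X -> smooth_vfield X. Proof. by case/K_aut. Qed.
Local Notation sE := (fun i => K_smooth (KE i)).

Lemma E_unit z : gramdet z != 0 -> Emat z \in unitmx.
Proof. exact: (Emat_unit lg gC). Qed.

(** Row [i] holds the coordinates of [r i] in the frame. Matrices thus act on the right, and
    composites of operators become products in reverse order. *)
Definition coef z (r : 'I_m -> 'rV[R]_m) : 'M[R]_m :=
  (\matrix_i r i) *m invmx (Emat z).

Lemma coefE z (r : 'I_m -> 'rV[R]_m) i k :
  coef z r i k = (r i *m invmx (Emat z)) 0 k.
Proof. by rewrite /coef !mxE; apply: eq_bigr => j _; rewrite mxE. Qed.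

Lemma coef_comb z (c : 'M[R]_m) (r : 'I_m -> 'rV[R]_m) :
  coef z (fun i => \sum_k c i k *: r k) = c *m coef z r.
Proof.
rewrite /coef mulmxA; congr (_ *m _); apply/row_matrixP => i.
rewrite rowK row_mul mulmx_sum_row; apply: eq_bigr => k _.
by rewrite rowK !mxE.
Qed.

Lemma coefD z (r r' : 'I_m -> 'rV[R]_m) :
  coef z (fun i => r i + r' i) = coef z r + coef z r'.
Proof.
rewrite /coef -mulmxDl; congr (_ *m _).
by apply/matrixP => i k; rewrite !mxE.
Qed.

Lemma coefN z (r : 'I_m -> 'rV[R]_m) :
  coef z (fun i => - r i) = - coef z r.
Proof.
rewrite /coef -mulNmx; congr (_ *m _).
by apply/matrixP => i k; rewrite !mxE.
Qed.

Lemma coef_frame z : gramdet z != 0 -> coef z (fun i => E i z) = 1%:M.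
Proof. by move=> d0; rewrite /coef mulmxV// E_unit. Qed.

Lemma coefK z (r : 'I_m -> 'rV[R]_m) i :
  gramdet z != 0 -> r i = \sum_k coef z r i k *: E k z.
Proof.
move=> d0; rewrite -[LHS](mulmxKV (E_unit d0)) mul_Emat.
by apply: eq_bigr => k _; rewrite coefE.
Qed.

Definition jm z := coef z (fun i => J z (E i z)).

Lemma coefJ z (r : 'I_m -> 'rV[R]_m) : gramdet z != 0 ->
  coef z (fun i => J z (r i)) = coef z r *m jm z.
Proof.
move=> d0; rewrite -coef_comb; congr coef; apply/funext => i.
rewrite {1}(coefK r i d0).
rewrite (big_morph (J z) (JD J_almost_complex z) (J0 J_almost_complex z)).
by apply: eq_bigr => k _; rewrite (JZ J_almost_complex).
Qed.

Lemma jm2 z : gramdet z != 0 -> jm z *m jm z = - 1%:M.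
Proof.
move=> d0; rewrite -coefJ// -(coef_frame d0) -coefN; congr coef.
by apply/funext => i; rewrite JJ.
Qed.

Definition A X W z := bracket X W z - D W z (X z).

(** The bracket with X and D along X obey the same Leibniz rule, so derivatives of coefficients
    cancel in their difference. *)
Lemma A_tensorial X W z : gramdet z != 0 -> smooth_vfield W ->
  A X W z = \sum_i cf W z 0 i *: A X (E i) z.
Proof.
move=> d0 sW; apply: (frame_tensorial lg gC gpos sg sE (T := fun W => A X W z)) => //.
  move=> U V sU sV; rewrite /A bracket_add// (D_add chern)//.
  by rewrite opprD addrACA.
move=> f U sf sU; rewrite /A bracket_scale// (D_scale chern)//.
by rewrite opprD addrACA subrr addr0 [RHS]scalerBr.
Qed.

Definition am X z := coef z (fun i => A X (E i) z).
Definition cm X z := coef z (fun i => bracket X (E i) z).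

Lemma coef_A z X (W : 'I_m -> vfield M) : gramdet z != 0 ->
  (forall i, smooth_vfield (W i)) ->
  coef z (fun i => A X (W i) z) = coef z (fun i => W i z) *m am X z.
Proof.
move=> d0 sW; rewrite -coef_comb; congr coef; apply/funext => i.
by rewrite A_tensorial//; apply: eq_bigr => k _; rewrite coefE.
Qed.

Lemma value_field z v : gramdet z != 0 -> exists V, smooth_vfield V /\ V z = v.
Proof.
move=> d0; exists (fun z' => \sum_i (v *m invmx (Emat z)) 0 i *: E i z').
split; last by rewrite -mul_Emat mulmxKV// E_unit.
apply: smooth_vfield_sum => i; apply: (@smooth_vfield_scale _ _ _ (fun=> _)).
  by move=> p; exact: smooth_at_cst.
exact: sE.
Qed.

Lemma D_Jfield W z u : gramdet z != 0 -> smooth_vfield W ->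
  D (app11 J W) z u = J z (D W z u).
Proof.
move=> d0; apply: (D_J w_symplectic J_almost_complex wJ_compatible chern).
by move=> v; exact: value_field.
Qed.

Lemma A_J X W z : gramdet z != 0 -> K X -> smooth_vfield W ->
  A X (app11 J W) z = J z (A X W z).
Proof.
by move=> d0 /K_aut[_ hX _] sW; rewrite /A hX// D_Jfield// JB.
Qed.

Lemma am_J X z : gramdet z != 0 -> K X -> jm z *m am X z = am X z *m jm z.
Proof.
move=> d0 kX; transitivity (coef z (fun i => A X (app11 J (E i)) z)).
  by rewrite coef_A// => i; exact/smooth_vfield_J/sE.
rewrite -coefJ//; congr coef; apply/funext => i.
by rewrite A_J//; exact: sE.
Qed.

Lemma gram_unit z : gramdet z != 0 -> gram z \in unitmx.
Proof. by rewrite unitmxE unitfE. Qed.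

(** The bracket with X and D along X both differentiate the metric by the product rule, so their
    difference is skew: [am X z *m gram z] is antisymmetric, and its trace against the symmetric
    inverse Gram matrix vanishes. *)
Lemma tr_am X z : gramdet z != 0 -> K X -> \tr (am X z) = 0.
Proof.
move=> d0 /K_aut[sX _ kX]; have Gu := gram_unit d0.
have symG : (gram z)^T = gram z.
  by apply/matrixP => i j; rewrite !mxE gC.
pose S := am X z *m gram z.
have SE i j : S i j = g z (A X (E i) z) (E j z).
  rewrite (coefK (fun i => A X (E i) z) i d0) -/(am X z).
  have -> : \sum_k am X z i k *: E k z = row i (am X z) *m Emat z.
    by rewrite mul_Emat; apply: eq_bigr => k _; rewrite [in RHS]mxE.
  by rewrite (g_mul_Emat lg gC) -row_mul [RHS]mxE.
have antiS : S^T = - S.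
  apply/matrixP => i j; rewrite [LHS]mxE [RHS]mxE !SE.
  have := D_metric chern z (X z) (sE j) (sE i); rewrite kX//; try exact: sE.
  have gA a b : g z (A X (E a) z) (E b z) =
      g z (bracket X (E a) z) (E b z) - g z (D (E a) z (X z)) (E b z).
    by rewrite /A (gDl lg gC) (gNl lg gC).
  rewrite !gA (gC z (E j z) (bracket _ _ _)) (gC z (E j z) (D _ _ _)); lra.
have -> : am X z = S *m invmx (gram z) by rewrite mulmxK.
have : \tr (S *m invmx (gram z)) = - \tr (S *m invmx (gram z)).
  rewrite -{1}mxtrace_tr trmx_mul trmx_inv symG antiS mulmxN linearN /=.
  by rewrite mxtrace_mulC.
lra.
Qed.

Definition nm X z := coef z (fun i => nijenhuis J X (E i) z).

Lemma D_frame_K X z : gramdet z != 0 -> K X ->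
  coef z (fun i => D X z (E i z)) = - am X z - nm X z.
Proof.
move=> d0 kX; rewrite /am /nm -!coefN -coefD; congr coef; apply/funext => i.
rewrite /A (D_torsion chern z (K_smooth kX) (sE i)).
by apply/rowP => j; rewrite !mxE; lra.
Qed.

Lemma nm_J X z : gramdet z != 0 -> K X -> jm z *m nm X z = - nm X z *m jm z.
Proof.
move=> d0 kX; transitivity (coef z (fun i => nijenhuis J X (app11 J (E i)) z)).
  rewrite -coef_comb; congr coef; apply/funext => i.
  have sX := K_smooth kX.
  (* Tensoriality of N in its second argument is read off from the torsion identity: A_X is
     tensorial, and D X is linear at the point. *)
  have nE W : smooth_vfield W -> nijenhuis J X W z = - A X W z - D X z (W z).
    move=> sW; rewrite /A (D_torsion chern z sX sW).
    by apply/rowP => j; rewrite !mxE; lra.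
  have lD := D_linear chern z sX.
  have D0 : D X z 0 = 0.
    by have := lD (-1) 0 0; rewrite scaler0 addr0 scaleN1r addNr.
  have DD u v : D X z (u + v) = D X z u + D X z v.
    by have := lD 1 u v; rewrite !scale1r.
  have DZ a u : D X z (a *: u) = a *: D X z u.
    by have := lD a u 0; rewrite D0 !addr0.
  have sJE := smooth_vfield_J (sE i).
  rewrite nE// (A_tensorial X d0 sJE) -sumrN.
  rewrite [u in D X z u](coefK (fun i => J z (E i z)) i d0) (big_morph (D X z) DD D0).
  rewrite -sumrN -big_split; apply: eq_bigr => k _ /=.
  rewrite nE; last exact: sE.
  have -> : cf (app11 J (E i)) z 0 k = jm z i k by rewrite /jm coefE.
  by rewrite DZ scalerBr scalerN.
rewrite mulNmx -coefJ// -coefN; congr coef; apply/funext => i.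
by rewrite (nijenhuis_Jr J_almost_complex)//; exact: sE.
Qed.

(** Conjugation by [P] preserves traces but changes the sign of [Q] and of [Q *m P]. *)
Lemma tr_anti (P Q : 'M[R]_m) : P *m P = - 1%:M -> P *m Q = - Q *m P ->
  \tr Q = 0 /\ \tr (Q *m P) = 0.
Proof.
move=> P2 PQ; split.
  have : \tr (P *m Q *m P) = - \tr (Q *m P *m P) by rewrite PQ !mulNmx linearN.
  rewrite -(mulmxA Q) P2 mulmxN mulmx1 linearN opprK mxtrace_mulC mulmxA P2 mulNmx.
  by rewrite mul1mx linearN /=; lra.
have : \tr (P *m Q) = - \tr (Q *m P) by rewrite PQ mulNmx linearN.
by rewrite mxtrace_mulC; lra.
Qed.

Definition trD W z := \tr (coef z (fun i => D W z (E i z))).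
Definition div W z := \sum_i dfun (fun z => cf W z 0 i) z (E i z).

Lemma trD_K X z : gramdet z != 0 -> K X -> trD X z = 0.
Proof.
move=> d0 kX; rewrite /trD D_frame_K// linearB linearN /= tr_am//.
by rewrite (tr_anti (jm2 d0) (nm_J d0 kX)).1 oppr0 addr0.
Qed.

Lemma trD_JK X z : gramdet z != 0 -> K X ->
  trD (app11 J X) z = - \tr (am X z *m jm z).
Proof.
move=> d0 kX; rewrite /trD.
have -> : (fun i => D (app11 J X) z (E i z)) = fun i => J z (D X z (E i z)).
  by apply/funext => i; rewrite D_Jfield//; exact: K_smooth.
rewrite coefJ// D_frame_K// mulmxBl mulNmx linearB linearN /=.
by rewrite (tr_anti (jm2 d0) (nm_J d0 kX)).2 subr0.
Qed.

(* The frame is divergence free, so only the derivatives of the coefficients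
   of W contribute. *)
Lemma trD_div W z : gramdet z != 0 -> smooth_vfield W -> trD W z = div W z.
Proof.
move=> d0 sW; have Eu := E_unit d0.
have DE j : D W z (E j z) = \sum_i (cf W z 0 i *: D (E i) z (E j z) +
    dfun (fun z => cf W z 0 i) z (E j z) *: E i z).
  apply: (frame_derivation lg gC gpos sg sE (T := fun W => D W z (E j z))) => //.
    by move=> U V sU sV; rewrite (D_add chern).
  by move=> f U sf sU; rewrite (D_scale chern).
pose c := \matrix_(j, i) dfun (fun z => cf W z 0 i) z (E j z).
have -> : trD W z = \sum_i cf W z 0 i * trD (E i) z + \tr c.
  rewrite /trD (_ : (fun j => D W z (E j z)) = fun j =>
    (\sum_i cf W z 0 i *: D (E i) z (E j z)) + \sum_i c j i *: E i z); last first.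
    apply/funext => j; rewrite DE big_split; congr (_ + _).
    by apply: eq_bigr => i _; rewrite mxE.
  rewrite coefD coef_comb coef_frame// mulmx1 linearD; congr (_ + _).
  transitivity (\sum_j \sum_i cf W z 0 i * coef z (fun j => D (E i) z (E j z)) j j).
    apply: eq_bigr => j _; rewrite coefE mulmx_suml summxE; apply: eq_bigr => i _.
    by rewrite -scalemxAl mxE coefE.
  by rewrite exchange_big; apply: eq_bigr => i _; rewrite -mulr_sumr.
rewrite big1 ?add0r; last by move=> i _; rewrite trD_K ?mulr0.
by apply: eq_bigr => i _; rewrite mxE.
Qed.

Lemma div_K X z : gramdet z != 0 -> K X -> div X z = 0.
Proof. by move=> d0 kX; rewrite -trD_div ?trD_K//; exact: K_smooth. Qed.

Lemma tr_am_jm X z : gramdet z != 0 -> K X ->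
  \tr (am X z *m jm z) = - div (app11 J X) z.
Proof.
move=> d0 kX; rewrite -trD_div ?trD_JK ?opprK//.
exact/smooth_vfield_J/K_smooth.
Qed.

Lemma cf_inv W z : cf W z = W z *m invmx (Emat z). Proof. by []. Qed.

Lemma smooth_coef (W : 'I_m -> vfield M) i k z : gramdet z != 0 ->
  (forall i, smooth_vfield (W i)) ->
  smooth_at (fun z => coef z (fun i => W i z) i k) z.
Proof.
move=> d0 sW; under eq_fun do rewrite coefE.
exact: (smooth_cf lg gC gpos sg sE k (sW i) d0).
Qed.

Lemma smooth_cm X i k z : gramdet z != 0 -> K X -> smooth_at (fun z => cm X z i k) z.
Proof.
move=> d0 kX; apply: (@smooth_coef (fun i => bracket X (E i))) => // j.
by apply: K_smooth; exact: K_bracket.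
Qed.

(** Infinitesimal form of the invariance of the divergence under X, obtained without flows by
    expanding [X, W] in the frame. The separate name [W'] lets smoothness come from another
    expression of the same field, as J [X, Y] for [X, J Y]. *)
Lemma div_bracket X W W' z : gramdet z != 0 -> K X ->
  smooth_vfield W -> smooth_vfield W' -> (forall z, W' z = bracket X W z) ->
  dfun (div W) z (X z) = div W' z.
Proof.
move=> d0 kX sW sW' W'E; have sX := K_smooth kX.
have su i z' : gramdet z' != 0 -> smooth_at (fun z => cf W z 0 i) z'.
  exact: (smooth_cf lg gC gpos sg sE i sW).
have sdu i (V : vfield M) : smooth_vfield V ->
    smooth_at (fun z => dfun (fun z => cf W z 0 i) z (V z)) z.
  by move=> sV; apply: smooth_at_dfun => //; exact: su.
have cfE k : \forall z' \near z, (\sum_i cf W z' 0 i * cm X z' i k)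
    + dfun (fun z => cf W z 0 k) z' (X z') = cf W' z' 0 k.
  apply: filterS (near_gramdet_neq0 sg sE d0) => z' d'.
  have EX : W' z' = \sum_i (cf W z' 0 i *: bracket X (E i) z' +
      dfun (fun z => cf W z 0 i) z' (X z') *: E i z').
    rewrite W'E; apply: (frame_derivation lg gC gpos sg sE
      (T := fun W => bracket X W z')) => //.
      by move=> U V sU sV; rewrite bracket_add.
    by move=> f U sf sU; rewrite bracket_scale.
  apply/esym; rewrite (cf_inv W') EX big_split mulmxDl mxE; congr (_ + _).
    rewrite mulmx_suml summxE; apply: eq_bigr => i _.
    by rewrite -scalemxAl mxE coefE.
  pose c : 'rV[R]_m := \row_i dfun (fun z => cf W z 0 i) z' (X z').
  have -> : \sum_i dfun (fun z => cf W z 0 i) z' (X z') *: E i z' = c *m Emat z'.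
    by rewrite mul_Emat; apply: eq_bigr => i _; rewrite mxE.
  by rewrite mulmxK ?mxE// E_unit.
have -> : div W' z = \sum_k ((\sum_i cf W z 0 i * dfun (fun z => cm X z i k) z (E k z))
    + (\sum_i cm X z i k * dfun (fun z => cf W z 0 i) z (E k z))
    + dfun (fun z => dfun (fun z => cf W z 0 k) z (X z)) z (E k z)).
  apply: eq_bigr => k _.
  have sp i : smooth_at (fun z => cf W z 0 i * cm X z i k) z.
    by apply: smooth_at_mul; [exact: su|exact: smooth_cm].
  have ss := smooth_at_sum (index_enum 'I_m) sp.
  rewrite (dfun_eq _ (cfE k)); last by apply: smooth_at_add => //; exact: sdu.
  rewrite dfun_add//; last exact: sdu.
  congr (_ + _); rewrite dfun_sum// -big_split; apply: eq_bigr => i _ /=.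
  by rewrite dfun_mul//; [exact: su|exact: smooth_cm].
rewrite !big_split /=.
(* The derivatives of the [cm] add up to div [X, E i], which is 0 because [X, E i] belongs to
   [K]. *)
rewrite [X in X + _ + _]exchange_big [X in _ = X + _ + _]big1 ?add0r; last first.
  move=> i _; rewrite -mulr_sumr.
  have -> : \sum_k dfun (fun z => cm X z i k) z (E k z) = div (bracket X (E i)) z.
    apply: eq_bigr => k _.
    have cmE : (fun z' => cm X z' i k) = fun z' => cf (bracket X (E i)) z' 0 k.
      by apply/funext => z'; rewrite /cm coefE.
    by rewrite cmE.
  by rewrite div_K ?mulr0//; exact: K_bracket.
(* What remains, for each coefficient f of W, is X (E_i f) = E_i (X f) + [X, E_i] f. *)
rewrite exchange_big -big_split dfun_sum; last by move=> i; exact: (sdu i _ (sE i)).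
apply: eq_bigr => i _ /=.
have -> : \sum_k cm X z i k * dfun (fun z => cf W z 0 i) z (E k z) =
    dfun (fun z => cf W z 0 i) z (bracket X (E i) z).
  by rewrite (coefK (fun i => bracket X (E i) z) i d0) dfun_comb.
by rewrite dfun_bracket//; [rewrite subrK|exact: su|exact: sE].
Qed.

Lemma smooth_Xf f X : smooth_fun f -> smooth_vfield X ->
  smooth_fun (fun z => dfun f z (X z)).
Proof. by move=> sf sX p; exact: (smooth_at_dfun (sf p) sX). Qed.

Lemma curvatureE X Y W z : curvature D X Y W z =
  D (cov D Y W) z (X z) - D (cov D X W) z (Y z) - D W z (bracket X Y z).
Proof. by []. Qed.

(** Second derivatives of a coefficient f enter only as X (Y f) - Y (X f) - [X, Y] f = 0. This makes
    the extension chosen in [curvature_at] irrelevant. *)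
Lemma curvature_tensorial X Y W z : gramdet z != 0 -> K X -> K Y ->
  smooth_vfield W ->
  curvature D X Y W z = \sum_i cf W z 0 i *: curvature D X Y (E i) z.
Proof.
move=> d0 kX kY sW; have sX := K_smooth kX; have sY := K_smooth kY.
apply: (frame_tensorial lg gC gpos sg sE (T := fun W => curvature D X Y W z)) => //.
  move=> U V sU sV; rewrite !curvatureE.
  have covD Z : cov D Z (fun z => U z + V z) = fun z => cov D Z U z + cov D Z V z.
    by apply/funext => z'; rewrite /cov (D_add chern).
  rewrite !covD !(D_add chern)//; try exact: (D_cov chern).
  by apply/rowP => j; rewrite !mxE; lra.
move=> f U sf sU; rewrite !curvatureE.
have covZ Z : cov D Z (fun z => f z *: U z) =
    fun z => f z *: cov D Z U z + dfun f z (Z z) *: U z.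
  by apply/funext => z'; rewrite /cov (D_scale chern).
have sfX := smooth_Xf sf sX; have sfY := smooth_Xf sf sY.
have sUX := D_cov chern sX sU; have sUY := D_cov chern sY sU.
rewrite !covZ !(D_add chern) ?(D_scale chern)//; try exact: smooth_vfield_scale.
rewrite (dfun_bracket (sf z) sX sY).
have alg (a b c s t : R) (p p' q r v u : 'rV[R]_m) :
    (a *: p + b *: q + (c *: r + s *: u)) - (a *: p' + c *: r + (b *: q + t *: u))
    - (a *: v + (s - t) *: u) = a *: (p - p' - v).
  by apply/rowP => j; rewrite !mxE; ring.
exact: alg.
Qed.

Definition dmx (a : M -> 'M[R]_m) z v : 'M[R]_m :=
  \matrix_(i, k) dfun (fun z => a z i k) z v.

Lemma dfun_tr_mul (a b : M -> 'M[R]_m) z v :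
  (forall i k, smooth_at (fun z => a z i k) z) ->
  (forall i k, smooth_at (fun z => b z i k) z) ->
  dfun (fun z => \tr (a z *m b z)) z v = \tr (dmx a z v *m b z + a z *m dmx b z v).
Proof.
move=> sa sb; rewrite /mxtrace.
have sab i k : smooth_at (fun z => a z i k * b z k i) z by exact: smooth_at_mul.
have E1 : (fun z => \sum_i (a z *m b z) i i) =
    (fun z => \sum_i \sum_k a z i k * b z k i).
  by apply/funext => z'; apply: eq_bigr => i _; rewrite mxE.
rewrite E1 dfun_sum; last by move=> i; exact: smooth_at_sum.
apply: eq_bigr => i _; rewrite dfun_sum// !mxE -big_split.
by apply: eq_bigr => k _; rewrite dfun_mul// !mxE/=; ring.
Qed.

(** D is written as bracket minus A, first along Y and then along X. The last term appears because D
    along X also differentiates the coefficients of [A Y (E i)]. *)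
Lemma D_cov_frame X Y z : gramdet z != 0 -> K X -> K Y ->
  coef z (fun i => D (cov D Y (E i)) z (X z)) =
  coef z (fun i => bracket X (bracket Y (E i)) z) - cm Y z *m am X z
  - am Y z *m (cm X z - am X z) - dmx (am Y) z (X z).
Proof.
move=> d0 kX kY; have sX := K_smooth kX; have sY := K_smooth kY.
have sB i := K_smooth (K_bracket kY (KE i)).
have sC i := D_cov chern sY (sE i).
have sA i : smooth_vfield (fun z => A Y (E i) z).
  exact: (smooth_vfield_add (sB i) (smooth_vfield_opp (sC i))).
have -> : (fun i => D (cov D Y (E i)) z (X z)) = (fun i =>
    bracket X (bracket Y (E i)) z - A X (bracket Y (E i)) z
    - D (fun z => A Y (E i) z) z (X z)).
  apply/funext => i.
  have -> : cov D Y (E i) = fun z => bracket Y (E i) z + - A Y (E i) z.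
    by apply/funext => z'; rewrite /A opprB addrC subrK.
  rewrite (D_add chern) ?(D_opp chern)//; last exact: smooth_vfield_opp.
  by congr (_ - _); rewrite /A opprB addrC subrK.
rewrite !coefD !coefN coef_A// -/(cm Y z).
have -> : coef z (fun i => D (fun z => A Y (E i) z) z (X z)) =
    am Y z *m (cm X z - am X z) + dmx (am Y) z (X z).
  rewrite -coefN -coefD -coef_comb.
  have -> : dmx (am Y) z (X z) = coef z (fun i => \sum_k dmx (am Y) z (X z) i k *: E k z).
    by rewrite coef_comb coef_frame// mulmx1.
  rewrite -coefD; congr coef; apply/funext => i.
  rewrite (frame_derivation lg gC gpos sg sE (v := X z)
    (T := fun W => D W z (X z)) _ _ d0 (sA i)).
  - rewrite big_split; congr (_ + _); apply: eq_bigr => k _.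
      by rewrite coefE; congr (_ *: _); rewrite /A opprB addrC subrK.
    have amE : (fun z' => am Y z' i k) = fun z' => cf (fun z => A Y (E i) z) z' 0 k.
      by apply/funext => z'; rewrite /am coefE.
    by rewrite mxE amE.
  - by move=> U V sU sV; rewrite (D_add chern).
  by move=> f U sf sU; rewrite (D_scale chern).
by rewrite opprD !addrA.
Qed.

Lemma smooth_am X i k z : gramdet z != 0 -> K X -> smooth_at (fun z => am X z i k) z.
Proof.
move=> d0 kX; apply: (@smooth_coef (fun i z => A X (E i) z)) => // j.
apply: (smooth_vfield_add (K_smooth (K_bracket kX (KE j)))).
exact: (smooth_vfield_opp (D_cov chern (K_smooth kX) (sE j))).
Qed.

Lemma smooth_jm i k z : gramdet z != 0 -> smooth_at (fun z => jm z i k) z.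
Proof.
move=> d0; apply: (@smooth_coef (fun i => app11 J (E i))) => // j.
exact/smooth_vfield_J/sE.
Qed.

(* The Lie derivative of J along X vanishes. *)
Lemma dmx_jm X z : gramdet z != 0 -> K X ->
  dmx jm z (X z) = cm X z *m jm z - jm z *m cm X z.
Proof.
move=> d0 kX; have [sX hX _] := K_aut kX.
apply: (canRL (addrK _)); rewrite addrC -coefJ//.
have -> : (fun i => J z (bracket X (E i) z)) = fun i => bracket X (app11 J (E i)) z.
  by apply/funext => i; rewrite hX//; exact: sE.
have -> : dmx jm z (X z) = coef z (fun i => \sum_k dmx jm z (X z) i k *: E k z).
  by rewrite coef_comb coef_frame// mulmx1.
rewrite -coef_comb -coefD; congr coef; apply/funext => i.
have sJE := smooth_vfield_J (sE i).
rewrite (frame_derivation lg gC gpos sg sE (v := X z)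
  (T := fun W => bracket X W z) _ _ d0 sJE).
- rewrite big_split; congr (_ + _); apply: eq_bigr => k _.
    by rewrite /jm coefE.
  have jmE : (fun z' => jm z' i k) = fun z' => cf (app11 J (E i)) z' 0 k.
    by apply/funext => z'; rewrite /jm coefE.
  by rewrite mxE jmE.
- by move=> U V sU sV; rewrite bracket_add.
by move=> f U sf sU; rewrite bracket_scale.
Qed.

(** The trace is - div (J Y) near [z]; the derivative along X enters the divergence by
    [div_bracket], and passes J because X preserves J. *)
Lemma dfun_tr_am_jm X Y z : gramdet z != 0 -> K X -> K Y ->
  dfun (fun z => \tr (am Y z *m jm z)) z (X z) = - div (app11 J (bracket X Y)) z.
Proof.
move=> d0 kX kY; have [sX hX _] := K_aut kX; have sY := K_smooth kY.
have sJY := smooth_vfield_J sY; have sXY := K_smooth (K_bracket kX kY).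
have sdiv : smooth_at (fun z => -1 * div (app11 J Y) z) z.
  apply: smooth_at_mul; first exact: smooth_at_cst.
  apply: smooth_at_sum => i; apply: smooth_at_dfun; last exact: sE.
  exact: (smooth_cf lg gC gpos sg sE).
have near_div : \forall z' \near z,
    -1 * div (app11 J Y) z' = \tr (am Y z' *m jm z').
  apply: filterS (near_gramdet_neq0 sg sE d0) => z' d'.
  by rewrite tr_am_jm// mulN1r.
rewrite (dfun_eq _ near_div)// dfun_mul; first last.
- apply: smooth_at_sum => i; apply: smooth_at_dfun; last exact: sE.
  exact: (smooth_cf lg gC gpos sg sE).
- exact: smooth_at_cst.
rewrite dfun_cst mulr0 addr0 mulN1r (div_bracket d0 kX sJY (smooth_vfield_J sXY))//.
by move=> z'; rewrite hX.
Qed.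

(** As [aX] and [aY] commute with [j], their two products have the same trace against [j], while [b]
    cancels. The first two traces on the right are arranged to be derivatives of tr (A J), in view
    of [dmx_jm]. *)
Lemma tr_comm_identity (j aX aY cX cY b c a dX dY : 'M[R]_m) :
  j *m aX = aX *m j -> j *m aY = aY *m j ->
  \tr ((((b + c) - cY *m aX - aY *m (cX - aX) - dY)
       - (b - cX *m aY - aX *m (cY - aY) - dX) - (c - a)) *m j) =
  \tr (dX *m j + aX *m (cY *m j - j *m cY))
  - \tr (dY *m j + aY *m (cX *m j - j *m cX)) + \tr (a *m j).
Proof.
move=> aXj aYj; pose F P := \tr (P *m j).
have FD P Q : F (P + Q) = F P + F Q by rewrite /F mulmxDl mxtraceD.
have FN P : F (- P) = - F P by rewrite /F mulNmx linearN.
have FB P Q : F (P - Q) = F P - F Q by rewrite FD FN.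
have t1 : \tr (aX *m (cY *m j)) = F (cY *m aX).
  by rewrite /F mulmxA mxtrace_mulC mulmxA aXj mxtrace_mulC mulmxA.
have t2 : \tr (aX *m (j *m cY)) = F (cY *m aX).
  by rewrite /F mulmxA mxtrace_mulC mulmxA.
have t3 : \tr (aY *m (cX *m j)) = F (cX *m aY).
  by rewrite /F mulmxA mxtrace_mulC mulmxA aYj mxtrace_mulC mulmxA.
have t4 : \tr (aY *m (j *m cX)) = F (cX *m aY).
  by rewrite /F mulmxA mxtrace_mulC mulmxA.
have t5 : F (aX *m aY) = F (aY *m aX).
  by rewrite /F -mulmxA -aYj mxtrace_mulC -[j *m aY *m aX]mulmxA mxtrace_mulC.
have t6 : F (aX *m cY) = F (cY *m aX) by rewrite -t1 mulmxA.
have t7 : F (aY *m cX) = F (cX *m aY) by rewrite -t3 mulmxA.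
have tB P Q S : \tr (P *m (Q - S)) = \tr (P *m Q) - \tr (P *m S).
  by rewrite mulmxBr linearB.
rewrite -/(F _) 2!mxtraceD 2!tB t1 t2 t3 t4 -/(F _) -/(F _) -/(F _).
rewrite (mulmxBr aY) (mulmxBr aX) 9!FB FD 2!FB t5 t6 t7; lra.
Qed.

Lemma tr_curvature X Y z : gramdet z != 0 -> K X -> K Y ->
  \tr (coef z (fun i => curvature D X Y (E i) z) *m jm z) =
  - div (app11 J (bracket Y X)) z.
Proof.
move=> d0 kX kY; pose j := jm z; pose a V := am V z; pose c V := cm V z.
pose b V W := coef z (fun i => bracket V (bracket W (E i)) z).
have bE : b X Y = b Y X + c (bracket X Y).
  rewrite /b /c /cm -coefD; congr coef; apply/funext => i.
  by rewrite -K_jacobi// addrC subrK.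
have -> : coef z (fun i => curvature D X Y (E i) z) =
    (b X Y - c Y *m a X - a Y *m (c X - a X) - dmx (am Y) z (X z))
    - (b Y X - c X *m a Y - a X *m (c Y - a Y) - dmx (am X) z (Y z))
    - (c (bracket X Y) - a (bracket X Y)).
  have E1 := D_cov_frame d0 kX kY; have E2 := D_cov_frame d0 kY kX.
  have E3 : coef z (fun i => D (E i) z (bracket X Y z)) =
      c (bracket X Y) - a (bracket X Y).
    rewrite /a /c /am /cm -coefN -coefD; congr coef.
    by apply/funext => i; rewrite /A subKr.
  by rewrite -E1 -E2 -E3 -!coefN -!coefD.
have T V W : K V -> K W ->
    \tr (dmx (am W) z (V z) *m j + a W *m (c V *m j - j *m c V)) =
    - div (app11 J (bracket V W)) z.
  move=> kV kW; rewrite -(dfun_tr_am_jm d0 kV kW).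
  rewrite (dfun_tr_mul (V z) (fun i k => smooth_am i k d0 kW)
    (fun i k => smooth_jm i k d0)).
  by rewrite (dmx_jm d0 kV).
have tX := T X Y kX kY; have tY := T Y X kY kX.
have tXY := tr_am_jm d0 (K_bracket kX kY).
have aXj : j *m a X = a X *m j by exact: am_J.
have aYj : j *m a Y = a Y *m j by exact: am_J.
have H := tr_comm_identity (c X) (c Y) (b Y X) (c (bracket X Y))
  (a (bracket X Y)) (dmx (am X) z (Y z)) (dmx (am Y) z (X z)) aXj aYj.
rewrite bE; apply: (etrans H).
(* The derivative of tr (A_Y J) along X and the trace of A_[X, Y] against J both equal - div (J
   [X, Y]) and enter with opposite signs; the derivative of tr (A_X J) along Y survives. *)
apply: (etrans (congr2 +%R (congr2 (fun s t => s - t) tY tX) tXY)).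
have alg (s t : R) : - s - - t + - t = - s by rewrite opprK addrK.
exact: alg.
Qed.

(** * Evaluation at a base point where the frame is the standard basis *)

Section AtBase.
Variable x : M.
Hypothesis E_x : forall i, E i x = delta_mx 0 i.

Lemma Emat_x : Emat x = 1%:M.
Proof. by apply/row_matrixP => i; rewrite rowK E_x row1. Qed.

(** A vector in the kernel of the Gram matrix is orthogonal to itself. *)
Lemma gramdet_x : gramdet x != 0.
Proof.
rewrite -unitfE -unitmxE -row_free_unit -kermx_eq0; apply/rowV0P => c.
move=> /sub_kermxP cG; apply: (g_eq0 gpos (z := x)).
have cE : c = \sum_i c 0 i *: E i x by rewrite -mul_Emat Emat_x mulmx1.
rewrite {2}cE (g_sumr lg) big1// => i _; rewrite (gZr lg).
rewrite (_ : g x c (E i x) = 0) ?mulr0//.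
by rewrite -[c]mulmx1 -Emat_x (g_mul_Emat lg gC) cG mxE.
Qed.

Lemma coef_x (r : 'I_m -> 'rV[R]_m) : coef x r = \matrix_i r i.
Proof. by rewrite /coef Emat_x invmx1 mulmx1. Qed.

Lemma cf_x W : cf W x = W x.
Proof. by rewrite cf_inv Emat_x invmx1 mulmx1. Qed.

Lemma endo_tr_sum (h : 'rV[R]_m -> 'rV[R]_m) :
  endo_tr h = \sum_i h (delta_mx 0 i) 0 i.
Proof. by apply: eq_bigr => i _; rewrite mxE. Qed.

Lemma chern_ricci_div X Y : K X -> K Y ->
  chern_ricci J D X Y x = - div (app11 J (bracket Y X)) x.
Proof.
move=> kX kY; rewrite -(tr_curvature gramdet_x kX kY) -coefJ ?gramdet_x//.
rewrite coef_x /chern_ricci endo_tr_sum; apply: eq_bigr => i _.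
rewrite mxE /curvature_at; congr (J x _ 0 i).
have [sV Vx] : smooth_vfield (extend x (delta_mx 0 i)) /\
    extend x (delta_mx 0 i) x = delta_mx 0 i.
  (* [E i] is an admissible extension, so [extend] does not fall back on its default value. *)
  rewrite /extend; case: xgetP => [V -> //|/(_ (E i))[]].
  by split; [exact: sE|exact: E_x].
rewrite (curvature_tensorial gramdet_x kX kY sV) cf_x Vx.
rewrite (bigD1 i)//= mxE !eqxx scale1r big1 ?addr0// => k ki.
by rewrite mxE eqxx (negbTE ki) scale0r.
Qed.

(** In the frame expansion of [E j, J Z] the derivatives of coefficients sum to the divergence, and
    the remaining terms give the correction. Invariance of J turns the bracket itself into J
    [E j, Z]. *)
Lemma div_J Z : K Z -> div (app11 J Z) x =
  \sum_j J x (bracket (E j) Z x) 0 j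
  - \sum_i J x (Z x) 0 i * \sum_j bracket (E j) (E i) x 0 j.
Proof.
move=> kZ; have sJZ := smooth_vfield_J (K_smooth kZ).
apply/eqP; rewrite eq_sym subr_eq; apply/eqP.
under [X in _ = _ + X]eq_bigr do rewrite mulr_sumr.
rewrite exchange_big -big_split; apply: eq_bigr => j _ /=.
have [_ hE _] := K_aut (KE j); rewrite -hE; last exact: K_smooth.
rewrite (frame_derivation lg gC gpos sg sE (v := E j x)
  (T := fun W => bracket (E j) W x) _ _ gramdet_x sJZ).
- rewrite big_split mxE addrC cf_x; congr (_ + _); rewrite summxE.
    rewrite (bigD1 j)//= big1 => [|k kj]; first by rewrite E_x !mxE !eqxx mulr1 addr0.
    by rewrite mxE (E_x k) mxE [j == k]eq_sym (negbTE kj) andbF mulr0.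
  by apply: eq_bigr => i _; rewrite mxE.
- by move=> U V sU sV; rewrite bracket_add.
by move=> f U sf sU; rewrite bracket_scale.
Qed.

End AtBase.
End ChernRicci.

(** * The trace formula *)

Lemma linear_comb (R : pzRingType) (V W : lmodType R) (f : V -> W) k
    (c : 'I_k -> R) (r : 'I_k -> V) : linear f ->
  f (\sum_i c i *: r i) = \sum_i c i *: f (r i).
Proof.
move=> lf; pose L : {linear V -> W} :=
  HB.pack f (GRing.isLinear.Build _ _ _ _ _ lf).
have -> : f = L by [].
by rewrite linear_sum; apply: eq_bigr => i _; rewrite linearZ.
Qed.

Lemma linear_sub (R : pzRingType) (V W : lmodType R) (f g : V -> W) :
  linear f -> linear g -> linear (fun v => f v - g v).
Proof. by move=> lf lg c u v; rewrite lf lg scalerBr opprD addrACA. Qed.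

Section LieBracketLinear.
Variables (R : realType) (N : nat) (G : lieGroup R N).
Implicit Types (X Y : 'rV[R]_N).

Lemma mixed_linear_r X : linear (mixed G X).
Proof.
move=> c Y Y'; have E Z := diff_act_loc_mixed X Z (mul_loc_smooth G).
apply: (etrans (E _)); apply: (etrans (linearP _ c Y Y')); apply: congr2.
  exact: (congr1 _ (esym (E Y))).
exact: (esym (E Y')).
Qed.

Lemma lie_br_linear X : linear (lie_br G X).
Proof.
move=> c Y Y'; rewrite !lie_brE mixed_linear_r.
have -> : mixed G (c *: Y + Y') X = c *: mixed G Y X + mixed G Y' X by exact: linearP.
move: (mixed G X Y) (mixed G X Y') (mixed G Y X) (mixed G Y' X) => a a' b b'.
by rewrite scalerBr opprD addrACA.
Qed.

Lemma lie_br_anti X Y : lie_br G X Y = - lie_br G Y X.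
Proof. by rewrite !lie_brE opprB. Qed.

End LieBracketLinear.

(* [C = 1 - EV *m S] is the projection onto the kernel of [EV]; [F] has no
   diagonal block there. *)
Lemma mxtrace_complement (R : comNzRingType) (N m : nat) (F : 'M[R]_N)
    (EV : 'M[R]_(N, m)) (S : 'M[R]_(m, N)) :
  S *m EV = 1%:M -> (1%:M - EV *m S) *m F *m (1%:M - EV *m S) = 0 ->
  \tr F = \tr (S *m F *m EV).
Proof.
move=> SE; set C := 1%:M - _ => CFC.
have CC : C *m C = C.
  rewrite {2}/C mulmxBr mulmx1 {1}/C mulmxBl mul1mx mulmxA -[EV *m S *m EV]mulmxA.
  by rewrite SE mulmx1 subrr subr0.
have : \tr (C *m F) = 0 by rewrite -CC -mulmxA mxtrace_mulC CFC mxtrace0.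
rewrite mulmxBl mul1mx linearB/= => /eqP; rewrite subr_eq0 => /eqP ->.
by rewrite [LHS]mxtrace_mulC mulmxA [LHS]mxtrace_mulC mulmxA.
Qed.

Lemma isotropy_fund (R : realType) (N m : nat) (G : lieGroup R N)
    (M : manifold R m) (act : G -> M -> M) (e : 'rV[R]_N -> G) (x : M) Z :
  (forall t : R, isotropy act x (e (t *: Z))) -> fund act e Z x = 0.
Proof.
move=> Zx; rewrite /fund (_ : (fun t : R => act (e (t *: Z)) x) = cst x).
  by rewrite /velocity (_ : _ \o _ = cst (coord x x))// derive1_cst.
by apply/funext => t; exact: Zx.
Qed.

Theorem corollary15 (R : realType) (n N : nat)
  (M : manifold R n.*2) (w : form2 M) (J : tensor11 M)
  (G : lieGroup R N) (act : G -> M -> M) (x : M)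
  (e : 'rV[R]_N -> G) (kk mm : {vspace 'rV[R]_N})
  (H : 'rV[R]_N -> 'rV[R]_N) (nabla : covderiv M)
  (M_connected : connected [set: M])
  (w_symplectic : symplectic w)
  (J_almost_complex : almost_complex J)
  (wJ_compatible : compatible w J)
  (G_connected : connected [set: G])
  (act_smooth : smooth_action act)
  (act_transitive : transitive_action act)
  (act_w : preserves_form act w)
  (act_J : preserves_tensor act J)
  (act_effective : almost_effective act)
  (K_compact : compact (isotropy act x))
  (e_exp : is_exp e)
  (kk_lie : forall X, X \in kk <-> forall t : R, isotropy act x (e (t *: X)))
  (g_decomp : (kk + mm = fullv)%VS /\ (kk :&: mm = 0)%VS)
  (mm_AdK : forall g X, isotropy act x g -> X \in mm -> Ad g X \in mm)
  (ev_iso : forall v, exists! X, X \in mm /\ fund act e X x = v)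
  (H_linear : linear H)
  (H_mm : forall X, X \in mm ->
     H X \in mm /\ fund act e (H X) x = J x (fund act e X x))
  (H_kk : forall X, X \in kk -> H X = 0)
  (nabla_chern : chern_connection w J nabla)
  (X Y : 'rV[R]_N) (X_mm : X \in mm) (Y_mm : Y \in mm) :
  chern_ricci J nabla (fund act e X) (fund act e Y) x
  = endo_tr (fun Z => lie_br G (H (lie_br G X Y)) Z
                      - H (lie_br G (lie_br G X Y) Z)).
Proof.
pose br := lie_br G; pose fd := fund act e; pose ev A := fd A x.
have lev : linear ev := fund_linear act_smooth e_exp x.
have lJ : linear (J x) by case: J_almost_complex.
have ev_kk Z : Z \in kk -> ev Z = 0 by move=> /kk_lie /isotropy_fund.
have ev_inj A B : A \in mm -> B \in mm -> ev A = ev B -> A = B.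
  move=> Am Bm AB; have [C [_ uC]] := ev_iso (ev A).
  exact: (etrans (esym (uC A (conj Am erefl))) (uC B (conj Bm (esym AB)))).
have /choice [xi xiP] i : exists A, A \in mm /\ ev A = delta_mx 0 i.
  by have [A [AP _]] := ev_iso (delta_mx 0 i); exists A.
have evB A B : ev (A - B) = ev A - ev B.
  by rewrite -scaleN1r addrC lev scaleN1r addrC.
have evD A B : ev (A + B) = ev A + ev B.
  exact: (etrans (congr1 (fun u => ev (u + B)) (esym (scale1r A)))
    (etrans (lev 1 A B) (congr1 (fun u => u + ev B) (scale1r (ev A))))).
have ev_sum (c : 'I_n.*2 -> R) (r : 'I_n.*2 -> 'rV[R]_N) :
    ev (\sum_i c i *: r i) = \sum_i c i *: ev (r i).
  exact: linear_comb.
(* The inverse of evaluation on [mm]; thus [s (ev A)] is the component of [A] in [mm]. *)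
pose s (v : 'rV[R]_n.*2) := \sum_i v 0 i *: xi i.
have s_mm v : s v \in mm by apply: memv_suml => i _; apply: memvZ; case: (xiP i).
have evs v : ev (s v) = v.
  rewrite ev_sum [RHS]row_sum_delta; apply: eq_bigr => i _.
  by case: (xiP i) => _ ->.
have s_ev A : A \in mm -> s (ev A) = A by move=> Am; apply: ev_inj.
have split_kk A : A - s (ev A) \in kk.
  have /memv_addP[k kk_k [a mm_a ->]] : A \in (kk + mm)%VS by rewrite g_decomp.1 memvf.
  have -> : ev (k + a) = ev a.
    by apply: (etrans (evD k a)); rewrite (ev_kk k kk_k) add0r.
  by rewrite s_ev// addrK.
(* As [H] and [ev] vanish on [kk], the relation between [H] and J extends from [mm] to the whole Lie
   algebra. *)
have HP A : H A \in mm /\ ev (H A) = J x (ev A).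
  have [Hm He] := H_mm _ (s_mm (ev A)).
  suff -> : H A = H (s (ev A)).
    by split; [exact: Hm|exact: (etrans He (congr1 (J x) (evs (ev A))))].
  have := H_linear 1 (A - s (ev A)) (s (ev A)).
  by rewrite !scale1r (H_kk (A - _))// add0r subrK.
(* Infinitesimal form of the Ad-invariance of [mm]. *)
have br_mm Z A : Z \in kk -> A \in mm -> br Z A \in mm.
  move=> /kk_lie Zk Am; apply: (lie_br_Ad_stable e_exp) => t.
  exact: mm_AdK.
have fbr A B : bracket (fd A) (fd B) = fd (- br A B).
  exact: fund_bracket.
pose K (V : vfield M) := exists A, V = fd A.
have K_aut V : K V -> infinitesimal_automorphism w J V.
  case=> A ->; split; first exact: smooth_fund.
    case: J_almost_complex => lJ' sJ _ W z.
    exact: (fund_holomorphic act_smooth e_exp lJ' sJ act_J).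
  by move=> U V' z; apply: fund_killing.
have K_bracket V W : K V -> K W -> K (bracket V W).
  by move=> [A ->] [B ->]; exists (- br A B).
have K_jacobi V W U z : K V -> K W -> K U ->
    bracket V (bracket W U) z - bracket W (bracket V U) z =
    bracket (bracket V W) U z.
  by move=> [A ->] [B ->] [C ->]; apply: fund_jacobi.
(* Global fields whose values at [x] are the standard basis, hence a frame near [x]. *)
pose E i := fd (xi i).
have KE i : K (E i) by exists (xi i).
have E_x i : E i x = delta_mx 0 i by case: (xiP i).
have Kfd A : K (fd A) by exists A.
rewrite (chern_ricci_div w_symplectic J_almost_complex wJ_compatible nabla_chern
  K_aut K_bracket K_jacobi KE E_x (Kfd X) (Kfd Y)).
(* The sign in [fund_bracket] absorbs the exchange of arguments: the bracket of the fields of [Y]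
   and [X] is the field of [X, Y]. *)
pose eta := br X Y; pose f Z := br (H eta) Z - H (br eta Z).
have -> : bracket (fund act e Y) (fund act e X) = fd eta.
  by rewrite [LHS]fbr /eta /br lie_br_anti opprK.
rewrite (div_J w_symplectic J_almost_complex wJ_compatible
  K_aut KE E_x (Kfd eta)).
rewrite -[endo_tr _]/(endo_tr f).
have lf : linear f.
  apply: linear_sub; first exact: lie_br_linear.
  by move=> c A B; rewrite /br lie_br_linear H_linear.
(* For [Z] in [kk], [H eta, Z] lies in [mm] because [H eta] does, and the other term is a value of
   [H]. *)
have f_kk Z : Z \in kk -> f Z \in mm.
  move=> Zk; apply: memvB; last exact: (HP _).1.
  by rewrite /br lie_br_anti memvN; apply: br_mm; [exact: Zk|exact: (HP _).1].
(* [lin1_mx ev *m S] is the projection onto [mm] along [kk]. By [f_kk] the block of [f] from [kk] to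
   itself is 0, so the whole trace is the one over [mm]. *)
have -> : endo_tr f = \sum_i ev (f (xi i)) 0 i.
  pose fL : {linear 'rV[R]_N -> 'rV[R]_N} :=
    HB.pack f (GRing.isLinear.Build _ _ _ _ _ lf).
  pose eL : {linear 'rV[R]_N -> 'rV[R]_n.*2} :=
    HB.pack ev (GRing.isLinear.Build _ _ _ _ _ lev).
  pose S := \matrix_i xi i.
  have vS v : v *m S = s v.
    by rewrite mulmx_sum_row; apply: eq_bigr => i _; rewrite rowK.
  have vF v : v *m lin1_mx f = f v := mul_rV_lin1 fL v.
  have vE v : v *m lin1_mx ev = ev v := mul_rV_lin1 eL v.
  have SE : S *m lin1_mx ev = 1%:M.
    by apply/row_matrixP => i; rewrite row_mul rowK vE (xiP i).2 row1.
  have CFC : (1%:M - lin1_mx ev *m S) *m lin1_mx f *m (1%:M - lin1_mx ev *m S) = 0.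
    have vC v : v *m (1%:M - lin1_mx ev *m S) = v - s (ev v).
      by rewrite mulmxBr mulmx1 mulmxA vE vS.
    apply/row_matrixP => i; rewrite -mulmxA row_mul row0 mulmxA vC.
    have : row i (1%:M - lin1_mx ev *m S) \in kk by rewrite rowE vC.
    by move: (row i _) => k kk_k; rewrite vF s_ev ?subrr// f_kk.
  rewrite /endo_tr (mxtrace_complement SE CFC); apply: eq_bigr => i _.
  have -> (B : 'M[R]_n.*2) : B i i = row i B 0 i by rewrite mxE.
  by rewrite !row_mul rowK vF vE.
have brE i A : bracket (E i) (fd A) x = ev (br A (xi i)).
  by rewrite fbr /br lie_br_anti opprK.
have T_lin A : linear (fun B => ev (br B A)).
  by move=> c B B'; rewrite /br !(lie_br_anti _ _ A) lie_br_linear opprD -scalerN lev.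
have HE A : s (J x (ev A)) = H A by rewrite -(HP A).2 s_ev//; exact: (HP A).1.
(* The components of J (ev eta) are the coordinates of [H eta] in the basis [xi]; after the sums are
   exchanged, the inner one is ev [H eta, xi j] for each [j]. *)
rewrite opprB; under [X in X - _ = _]eq_bigr do rewrite mulr_sumr.
rewrite exchange_big -sumrB; apply: eq_bigr => j _ /=.
have fE : ev (f (xi j)) = ev (br (H eta) (xi j)) - J x (ev (br eta (xi j))).
  exact: (etrans (evB _ _) (congr1 (fun u => _ - u) (HP _).2)).
rewrite brE fE [RHS]mxE [X in _ = _ + X]mxE; congr (_ - _).
rewrite -HE (linear_comb _ _ (T_lin (xi j))) summxE; apply: eq_bigr => i _.
by rewrite [RHS]mxE (brE j (xi i)).
Qed.
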